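(* Let $K$ be a closed and unbounded trapezoid with height $L\in(0,\infty]$ and base $K_0$. Let $(u_0,v_0)\in L^{1,1}(K_0;\mathbb R^n)$ and $f\in L^1(K;\mathbb R^n)$. Then there exists $T_0$, with $T_0\in(0,L]$ if $L<\infty$ and $T_0\in(0,\infty)$ if $L=\infty$, such that the equation $$\partial_t^2u-\partial_x^2u=\sum_{j,k=1}^n\Gamma_{jk}(u)(\partial_tu_j\partial_tu_k-\partial_xu_j\partial_xu_k)+P(u)f,\qquad u(0,\cdot)=u_0,\ \partial_tu(0,\cdot)=v_0,$$ has a unique $\mathbb R^n$-valued mild solution in the class $\mathscr H(\widetilde K)$, where $\widetilde K=([0,T_0]\times K_0)\cap K$.
   Context: Standing assumption: $\Gamma_{jk}:\mathbb R^n\to\mathbb R^n$ ($1\le j,k\le n$) and $P:\mathbb R^n\to\mathcal L(\mathbb R^n)$ are bounded and globally Lipschitz. Trapezoids: a closed convex set $K\subseteq[0,\infty)\times\mathbb R$ of positive Lebesgue measure is a trapezoid if for every $(t,x)\in K$ the closed triangle with vertices $(t,x),(0,x-t),(0,x+t)$ is contained in $K$. $K_t=\{x:(t,x)\in K\}$; $K_0$ is the base; the height of $K$ is $\infty$ if $\{t:K_t\neq\emptyset\}$ is unbounded and otherwise the maximum of this set. ''Unbounded'' means that $K$ is an unbounded set. For an interval $I$: $\dot W^{1,1}(I;\mathbb R^n)$ is the set of locally absolutely continuous $v:I\to\mathbb R^n$ with $Dv=v'\in L^1(I)$; $L^{1,1}(I;\mathbb R^n)=(L^\infty(I;\mathbb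 R^n)\cap\dot W^{1,1}(I;\mathbb R^n))\times L^1(I;\mathbb R^n)$. $\mathscr H(K)$ for a trapezoid $K$ of finite height $T_0$: all continuous $u:K\to\mathbb R^n$ with finite norm $\|u\|_{\mathscr H(K)}=\sup_K|u|+\sup_t\int_{K_t}(|\partial_xu|+|\partial_tu|)\,dx$, whose weak derivatives $\partial_tu,\partial_xu$ exist in $L^1(\mathrm{int}\,K)$ and belong to $C([0,T_0];L^1(K_\cdot))$, meaning that their extensions by $0$ to $[0,T_0]\times K_0$ are continuous functions of $t$ with values in $L^1(K_0)$. An $\mathbb R^n$-valued mild solution on a trapezoid $K$ with data $(u_0,v_0)$ and forcing $f$ is a continuous $u:K\to\mathbb R^n$ whose weak derivatives $\partial_tu,\partial_xu$ exist as locally integrable functions and such that for every $(t,x)\in K$ (the double integral being of an integrable function) $$u(t,x)=\tfrac12\big(u_0(x+t)+u_0(x-t)\big)+\tfrac12\int_{x-t}^{x+t}v_0(y)\,dy+\tfrac12\int_0^t\int_{x-t+\tau}^{x+t-\tau}\Big[\sum_{j,k}\Gamma_{jk}(u)(\partial_tu_j\partial_tu_k-\partial_xu_j\partial_xu_k)+P(u)f\Big](\tau,y)\,dy\,d\tau.$$ *)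

(* Defs.v *)
From HB Require Import structures.
From mathcomp Require Import all_boot all_order all_algebra.
From mathcomp Require Import all_classical all_reals all_analysis.

Set Implicit Arguments.
Unset Strict Implicit.
Unset Printing Implicit Defensive.

Import Order.TTheory GRing.Theory Num.Theory.
Import numFieldNormedType.Exports.

Local Open Scope classical_set_scope.
Local Open Scope ring_scope.

(* Points of the plane are pairs (t, x) with the time coordinate first.
   Vectors of R^n are columns, with the library norm, which is the maximum of
   the absolute values of the entries.  Functions on a subset of R or R * R
   are total functions whose values off the subset play no role. *)

Notation lebesgue1 R := (@lebesgue_measure R).
Notation lebesgue2 R := (lebesgue1 R \x lebesgue1 R)%E.

(* The closed triangle with vertices (t, x), (0, x - t) and (0, x + t). *)
Definition triangle (R : realType) (t x : R) : set (R * R) :=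
  [set p | 0 <= p.1 <= t /\ x - t + p.1 <= p.2 <= x + t - p.1].

Definition trapezoid (R : realType) (K : set (R * R)) : Prop :=
  [/\ closed K, convex_set K, K `<=` [set p | 0 <= p.1],
      (0 < lebesgue2 R K)%E
    & forall t x, K (t, x) -> triangle t x `<=` K].

(* A supremum, because the set of times need not have a maximum when it is
   bounded but K is not: take 0 <= t <= 1 - (1 + x)^-1 with x >= 0. *)
Definition height (R : realType) (K : set (R * R)) : \bar R :=
  ereal_sup [set t%:E | t in [set t | xsection K t !=set0]].

Definition truncate (R : realType) (K : set (R * R)) (T0 : R) : set (R * R) :=
  (`[0, T0] `*` xsection K 0) `&` K.

Section vector_valued.
Context {d : measure_display} {T : measurableType d} {R : realType} {n : nat}.
Variables (mu : {measure set T -> \bar R}) (D : set T) (F : T -> 'cV[R]_n).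

Definition L1 : Prop :=
  forall i, mu.-integrable D (fun x => (F x i ord0)%:E).

Definition vintegral : 'cV[R]_n :=
  \col_i (\int[mu]_(x in D) F x i ord0).

End vector_valued.

Definition absolutely_continuous (R : realType) (n : nat) (a b : R)
    (v : R -> 'cV[R]_n) : Prop :=
  forall eps : R, 0 < eps -> exists2 delta : R, 0 < delta &
    forall (m : nat) (l r : 'I_m -> R),
      (forall i, a <= l i /\ l i <= r i /\ r i <= b) ->
      (forall i j, i != j -> r i <= l j \/ r j <= l i) ->
      \sum_i (r i - l i) < delta -> \sum_i `|v (r i) - v (l i)| < eps.

Definition W11dot (R : realType) (n : nat) (I : set R) (v : R -> 'cV[R]_n) :
    Prop :=
  (forall a b, `[a, b] `<=` I -> absolutely_continuous a b v) /\
  exists2 dv : R -> 'cV[R]_n, L1 (lebesgue1 R) I dv &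
    {ae lebesgue1 R, forall x, I x -> is_derive x 1 v (dv x)}.

Definition Linfty (R : realType) (n : nat) (I : set R) (v : R -> 'cV[R]_n) :
    Prop :=
  (forall i, measurable_fun I (fun x => v x i ord0)) /\
  exists M : R, {ae lebesgue1 R, forall x, I x -> `|v x| <= M}.

Definition L11 (R : realType) (n : nat) (I : set R) (u0 v0 : R -> 'cV[R]_n) :
    Prop :=
  [/\ Linfty I u0, W11dot I u0 & L1 (lebesgue1 R) I v0].

Section weak_derivatives.
Context {R : realType}.

Definition dir_t : R * R := (1, 0).
Definition dir_x : R * R := (0, 1).

Fixpoint Ck (k : nat) (phi : R * R -> R) : Prop :=
  if k is k'.+1 then
    [/\ forall p, derivable phi p dir_t /\ derivable phi p dir_x,
        Ck k' ('D_dir_t phi) & Ck k' ('D_dir_x phi)]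
  else continuous phi.

Definition test_function (O : set (R * R)) (phi : R * R -> R) : Prop :=
  let supp := closure [set p | phi p != 0] in
  [/\ forall k, Ck k phi, compact supp & supp `<=` O].

Definition locL1 (n : nat) (O : set (R * R)) (g : R * R -> 'cV[R]_n) : Prop :=
  forall C, compact C -> C `<=` O -> L1 (lebesgue2 R) C g.

Definition weak_derivative (n : nat) (O : set (R * R)) (e : R * R)
    (u g : R * R -> 'cV[R]_n) : Prop :=
  locL1 O g /\ forall phi, test_function O phi ->
    vintegral (lebesgue2 R) O (fun p => 'D_e phi p *: u p) =
    - vintegral (lebesgue2 R) O (fun p => phi p *: g p).

End weak_derivatives.

Section solution_class.
Context {R : realType} {n : nat}.
Implicit Types (K : set (R * R)) (u ut ux g : R * R -> 'cV[R]_n).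

Definition zero_ext K g : R * R -> 'cV[R]_n := patch (fun=> 0) K g.

(* g in C([0, T0]; L^1(K_.)), where T0 is the (finite) height of K. *)
Definition continuous_L1 K g : Prop :=
  forall t : R, `[0, fine (height K)]%classic t ->
    L1 (lebesgue1 R) (xsection K 0) (fun x => zero_ext K g (t, x)) /\
    (\int[lebesgue1 R]_(x in xsection K 0%R)
        `|zero_ext K g (s, x) - zero_ext K g (t, x)|%:E)%E
      @[s --> within `[0, fine (height K)]%classic (nbhs t)] --> 0%E.

Definition Hnorm K u ut ux : \bar R :=
  (ereal_sup [set `|u p|%:E | p in K] +
   ereal_sup [set \int[lebesgue1 R]_(x in xsection K t)
                    (`|ux (t, x)| + `|ut (t, x)|)%:E
             | t in `[0%R, fine (height K)]])%E.

Definition Hspace K u : Prop :=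
  {within K, continuous u} /\
  exists ut ux,
    [/\ weak_derivative K° dir_t u ut /\ weak_derivative K° dir_x u ux,
        L1 (lebesgue2 R) K° ut /\ L1 (lebesgue2 R) K° ux,
        continuous_L1 K ut /\ continuous_L1 K ux
      & (Hnorm K u ut ux < +oo)%E].

End solution_class.

Section mild_solutions.
Context {R : realType} {n : nat}.
Variables (Gamma : 'I_n -> 'I_n -> 'cV[R]_n -> 'cV[R]_n)
  (P : 'cV[R]_n -> 'M[R]_n).
Implicit Types (u ut ux f : R * R -> 'cV[R]_n).

Definition wave_rhs f u ut ux (p : R * R) : 'cV[R]_n :=
  \sum_j \sum_k (ut p j ord0 * ut p k ord0 - ux p j ord0 * ux p k ord0)
      *: Gamma j k (u p)
  + P (u p) *m f p.

Definition mild_solution (K : set (R * R)) (u0 v0 : R -> 'cV[R]_n) f u : Prop :=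
  {within K, continuous u} /\
  exists ut ux,
    [/\ weak_derivative K° dir_t u ut, weak_derivative K° dir_x u ux
      & forall t x, K (t, x) ->
        L1 (lebesgue2 R) (triangle t x) (wave_rhs f u ut ux) /\
        u (t, x) =
          2^-1 *: (u0 (x + t) + u0 (x - t))
          + 2^-1 *: vintegral (lebesgue1 R) `[x - t, x + t] v0
          + 2^-1 *: vintegral (lebesgue1 R) `[0, t] (fun tau =>
              vintegral (lebesgue1 R) `[x - t + tau, x + t - tau] (fun y =>
                wave_rhs f u ut ux (tau, y)))].

End mild_solutions.

(* Main.v *)
From HB Require Import structures.
From mathcomp Require Import all_boot all_order all_algebra.
From mathcomp Require Import all_classical all_reals all_analysis.
From mathcomp Require Import measurable_realfun ring lra.
Require Import Defs.

Set Implicit Arguments.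
Unset Strict Implicit.
Unset Printing Implicit Defensive.

Import Order.TTheory GRing.Theory Num.Theory.
Import numFieldNormedType.Exports.

Local Open Scope classical_set_scope.
Local Open Scope ring_scope.

(** Write [p = ut + ux] and [q = ut - ux].  Along a characteristic [x + t = z] the
    equation says that [p] changes by the integral of the right-hand side, and [q]
    does so along [x - t = z].  The right-hand side has a null structure: the
    difference of the products of time and of space derivatives is a sum of products of
    one entry of [p] and one entry of [q] ([nonlin_null]).  This makes integrable
    derivatives sufficient: if [|p| <= a (x + t)] and [|q| <= a (x - t)] for one
    integrable function [a] of one variable, then the quadratic terms are dominated by
    [a (x + t) * a (x - t)], which is integrable over the plane.

    The unknown is taken to be the source [F], the right-hand side itself as an
    integrable function on the plane.  D'Alembert's formula [wave] gives the solution
    of the linear problem with source [F], and [transp] gives its [p] and [q]; inserting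
    them in the nonlinearity defines the map [source].  On each backward triangle a mild
    solution is the wave driven by a fixed point of [source] cut off to the triangle
    ([mild_wave], [mild_solution_fixpoint]), and fixed points cut off to a time strip
    give mild solutions ([fixpoint_mild]).

    On the characteristics [x + t = z] and [x - t = z] the majorant above is
    [a z * a (z -+ 2 t)].  As
    integrals of [a] over short intervals are uniformly small, its integral over the
    part of the characteristic in a thin time slab is at most [th * a z] for a
    prescribed small number [th], with the same slab height for all [z] and all positions of the slab; the forcing is included by
    adding to [a] the mass of the forcing along characteristics
    ([small_interaction]).  Consequently, on a thin slab, [source] preserves the
    bounds by [a] and halves differences of sources measured against the majorant
    ([contraction]).  Iteration gives a fixed point on a first slab ([source_fixpoint]);
    two fixed points on the same set agree, one slab after the other
    ([source_unique]).  The time [T0] is the height of such a slab, but less than the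
    time [t1] of some chosen point of the trapezoid.

    Three dictionaries connect this with the formulation of the theorem.  Absolutely
    continuous data are primitives of their derivatives ([scalar_ac_ftc]).  Half the sum
    and half the difference of [p] and [q] are the weak derivatives of the wave, by
    integration by parts on lines ([weak_derivative_t], [weak_derivative_x]); for a given
    mild solution they are so by the du Bois-Reymond lemma ([du_bois_reymond],
    [weak_derivative_unique]).  Continuity in time with values in the integrable
    functions follows from the continuity of translations ([translation_L1]) and of the
    source terms ([duhamel_slices]); passing to the sections of the trapezoid preserves
    it, since almost every point of the line stays inside or outside the sections
    at nearby times ([section_stable]). *)

(** * Integrals of real functions *)

(** Integrals over subsets are written over the whole space, with an indicator as a
    factor: sums, products and changes of variables then need no domains. *)
Notation intg m f := (m.-integrable [set: _] (EFin \o f)).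

Section real_integrals.
Context {d : measure_display} {T : measurableType d} {R : realType}.
Variable m : {measure set T -> \bar R}.
Implicit Types f g : T -> R.

Lemma aeS (P Q : T -> Prop) : (forall x, P x -> Q x) ->
  {ae m, forall x, P x} -> {ae m, forall x, Q x}.
Proof. by move=> PQ; apply: filterS. Qed.

Lemma aeS2 (P Q S : T -> Prop) : (forall x, P x -> Q x -> S x) ->
  {ae m, forall x, P x} -> {ae m, forall x, Q x} -> {ae m, forall x, S x}.
Proof. by move=> PQ; apply: filterS2. Qed.

Lemma aeS3 (P Q S U : T -> Prop) : (forall x, P x -> Q x -> S x -> U x) ->
  {ae m, forall x, P x} -> {ae m, forall x, Q x} -> {ae m, forall x, S x} ->
  {ae m, forall x, U x}.
Proof. by move=> PQ; apply: filterS3. Qed.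

Lemma ae_ord n (P : 'I_n -> T -> Prop) :
  (forall i, {ae m, forall x, P i x}) -> {ae m, forall x, forall i, P i x}.
Proof.
move=> aP; have : {ae m, forall x, forall k : nat,
    if insub k is Some i then P i x else True}.
  by apply: ae_foralln => k; case: insubP => [i _ _|_]; [exact: aP|exact: aeW].
by apply: aeS => x Px i; have := Px i; rewrite valK.
Qed.

Lemma intg_measurable f : intg m f -> measurable_fun setT f.
Proof. by move/measurable_int => /measurable_EFinP. Qed.

Lemma intg_ext f g : (forall x, f x = g x) -> intg m f -> intg m g.
Proof. by move=> fg; apply: eq_integrable => // x _ /=; rewrite fg. Qed.

Lemma intgD f g : intg m f -> intg m g -> intg m (fun x => f x + g x).
Proof.
move=> intf ing; have := integrableD measurableT intf ing.
by apply: eq_integrable => // x _ /=; rewrite EFinD.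
Qed.

Lemma intgZ k f : intg m f -> intg m (fun x => k * f x).
Proof.
move=> intf; have := integrableZl measurableT k intf.
by apply: eq_integrable => // x _ /=; rewrite EFinM.
Qed.

Lemma intgB f g : intg m f -> intg m g -> intg m (fun x => f x - g x).
Proof.
move=> intf ing; have := integrableB measurableT intf ing.
by apply: eq_integrable => // x _ /=; rewrite EFinB.
Qed.

Lemma intg0 : intg m (fun=> 0 : R).
Proof. exact: integrable0. Qed.

Lemma intg_sum (I : Type) (s : seq I) (F : I -> T -> R) :
  (forall i, intg m (F i)) -> intg m (fun x => \sum_(i <- s) F i x).
Proof.
move=> iF; elim: s => [|i s IH].
  by apply: intg_ext intg0 => x; rewrite big_nil.
by apply: intg_ext (intgD (iF i) IH) => x; rewrite big_cons.
Qed.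

Lemma intg_norm f : intg m f -> intg m (fun x => `|f x|).
Proof. by move/integrable_norm. Qed.

Lemma intg_le_ae f g : measurable_fun setT f -> intg m g ->
  {ae m, forall x, `|f x| <= g x} -> intg m f.
Proof.
move=> mf ig fg.
apply/integrableP; split; first exact/measurable_EFinP.
move/integrableP: (intg_norm ig) => [mg]; apply: le_lt_trans.
apply: ae_ge0_le_integral => //.
- by apply/measurableT_comp => //; exact/measurable_EFinP.
- by apply/measurableT_comp.
move: fg; apply: filterS => x h _ /=.
by rewrite normr_id lee_fin (le_trans h)// ler_norm.
Qed.

Lemma intg_le f g : measurable_fun setT f -> intg m g ->
  (forall x, `|f x| <= g x) -> intg m f.
Proof. by move=> mf ig fg; apply: intg_le_ae ig _ => //; exact: aeW. Qed.

Lemma intg_indic (A : set T) f : measurable A -> intg m f ->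
  intg m (fun x => \1_A x * f x).
Proof.
move=> mA intf; apply: (intg_le _ (intg_norm intf)).
  apply: measurable_funM; first exact: measurable_indic.
  exact: intg_measurable intf.
move=> x; rewrite normrM indicE; case: (_ \in _) => /=.
  by rewrite normr1 mul1r.
by rewrite normr0 mul0r.
Qed.

Lemma intg_restrict (A : set T) f : measurable A ->
  m.-integrable A (EFin \o f) <-> intg m (fun x => \1_A x * f x).
Proof.
move=> mA; rewrite (integrable_mkcond _ mA); split;
  apply: eq_integrable => // x _; rewrite patchE /= indicE;
  by case: (_ \in _) => /=; rewrite ?mul1r ?mul0r.
Qed.

Lemma intg_indicator (A : set T) : measurable A -> (m A < +oo)%E ->
  intg m (\1_A : T -> R).
Proof.
move=> mA Aoo; apply/integrableP; split.
  by apply/measurable_EFinP; exact: measurable_indic.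
under eq_integral => x _ do rewrite /= ger0_norm ?indicE//.
by under eq_integral => x _ do rewrite -indicE; rewrite integral_indic// setIT.
Qed.

Lemma Rint_indicator (A : set T) : measurable A ->
  \int[m]_x (\1_A x : R) = fine (m A).
Proof. by move=> mA; rewrite /Rintegral integral_indic// setIT. Qed.

Lemma Rint_indic (A : set T) f :
  \int[m]_(x in A) f x = \int[m]_x (\1_A x * f x).
Proof.
rewrite Rintegral_mkcond; apply: eq_Rintegral => x _.
by rewrite patchE indicE; case: (_ \in _); rewrite ?mul1r ?mul0r.
Qed.

Lemma eq_Rint f g : (forall x, f x = g x) -> \int[m]_x f x = \int[m]_x g x.
Proof. by move=> fg; apply: eq_Rintegral => x _; rewrite fg. Qed.

Lemma Rint_eq0 f : (forall x, f x = 0) -> \int[m]_x f x = 0.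
Proof.
by move=> f0; rewrite (eq_Rint (g := fun=> 0))// /Rintegral integral0.
Qed.

Lemma Rint_ae_eq f g : measurable_fun setT f -> measurable_fun setT g ->
  {ae m, forall x, f x = g x} -> \int[m]_x f x = \int[m]_x g x.
Proof.
move=> mf mg fg; congr fine; apply: ae_eq_integral => //.
- exact/measurable_EFinP.
- exact/measurable_EFinP.
- by apply: filterS fg => x -> .
Qed.

Lemma Rint_norm_le f : intg m f -> `|\int[m]_x f x| <= \int[m]_x `|f x|.
Proof. by move=> intf; apply: le_normr_Rintegral. Qed.

Lemma EFin_Rint f : intg m f -> (\int[m]_x f x)%:E = (\int[m]_x (f x)%:E)%E.
Proof. by move=> intf; rewrite /Rintegral fineK//; exact: integrable_fin_num. Qed.

Lemma Rint_le_ae f g : intg m f -> intg m g ->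
  {ae m, forall x, f x <= g x} -> \int[m]_x f x <= \int[m]_x g x.
Proof.
move=> intf intg' fg.
have mf := intg_measurable intf; have mg := intg_measurable intg'.
rewrite (@Rint_ae_eq g (fun x => Num.max (f x) (g x))) //; last 2 first.
- exact: measurable_maxr.
- by apply: filterS fg => x /max_idPr.
apply: le_Rintegral => // [|x _]; last by rewrite le_max lexx.
apply: (intg_le _ (intgD (intg_norm intf) (intg_norm intg'))).
  exact: measurable_maxr.
by move=> x; case: (leP (f x) (g x)) => _; [rewrite lerDr|rewrite lerDl].
Qed.

Lemma Rint_le f g : intg m f -> intg m g ->
  (forall x, f x <= g x) -> \int[m]_x f x <= \int[m]_x g x.
Proof. by move=> intf intg' fg; apply: Rint_le_ae => //; exact: aeW. Qed.

Lemma Rint_ge0 f : (forall x, 0 <= f x) -> 0 <= \int[m]_x f x.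
Proof. by move=> f0; exact: Rintegral_ge0. Qed.

Lemma RintD f g : intg m f -> intg m g ->
  \int[m]_x (f x + g x) = \int[m]_x f x + \int[m]_x g x.
Proof. by move=> intf intg'; rewrite RintegralD. Qed.

Lemma RintB f g : intg m f -> intg m g ->
  \int[m]_x (f x - g x) = \int[m]_x f x - \int[m]_x g x.
Proof. by move=> intf intg'; rewrite RintegralB. Qed.

Lemma RintZ k f : intg m f -> \int[m]_x (k * f x) = k * \int[m]_x f x.
Proof. by move=> intf; rewrite RintegralZl. Qed.

Lemma Rint_sum (I : Type) (s : seq I) (F : I -> T -> R) :
  (forall i, intg m (F i)) ->
  \int[m]_x (\sum_(i <- s) F i x) = \sum_(i <- s) \int[m]_x F i x.
Proof.
move=> iF; elim: s => [|i s IH].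
  rewrite big_nil (eq_Rint (g := fun=> 0)) => [|x]; last by rewrite big_nil.
  by rewrite /Rintegral integral0.
rewrite big_cons -IH -RintD//; last exact: intg_sum.
by apply: eq_Rint => x; rewrite big_cons.
Qed.

Lemma Rint_bound_ae f g : measurable_fun setT f -> intg m g ->
  {ae m, forall x, `|f x| <= g x} -> `|\int[m]_x f x| <= \int[m]_x g x.
Proof.
move=> mf intg' fg; have intf := intg_le_ae mf intg' fg.
apply: le_trans (Rint_norm_le intf) _; apply: Rint_le_ae => //.
exact: intg_norm.
Qed.

Lemma ae_eq0_of_Rint f : intg m f -> (forall x, 0 <= f x) ->
  \int[m]_x f x = 0 -> {ae m, forall x, f x = 0}.
Proof.
move=> intf f0 If.
have If0 : (\int[m]_x `|(f x)%:E| = 0)%E.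
  rewrite -[RHS]/(0%:E) -If EFin_Rint//; apply: eq_integral => x _.
  by rewrite /= ger0_norm.
have /integral_abs_eq0 h := measurable_int _ intf.
have [+ _] := ae_eq_integral_abs m measurableT (measurable_int _ intf).
move=> /(_ If0); apply: filterS => x /(_ I) /=.
by case.
Qed.

(** The limits of bumps, of translates and of moving sections are all taken
    through this form of dominated convergence. *)
Lemma Rint_dominated (f_ : nat -> T -> R) f g :
  (forall k, measurable_fun setT (f_ k)) -> measurable_fun setT f ->
  intg m g -> (forall k, {ae m, forall x, `|f_ k x| <= g x}) ->
  {ae m, forall x, f_ k x @[k --> \oo] --> f x} ->
  \int[m]_x f_ k x @[k --> \oo] --> \int[m]_x f x.
Proof.
move=> mf_ mf ig fg cv.
have fg' : {ae m, forall x k, [set: T] x -> (`|(f_ k x)%:E| <= (g x)%:E)%E}.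
  have := ae_foralln fg; apply: filterS => x h k _.
  by rewrite /= lee_fin.
have [||//|intf _ lim] := @dominated_convergence _ _ _ m setT measurableT
  (fun k => EFin \o f_ k) (EFin \o f) (EFin \o g) _ _ _ ig fg'.
- by move=> k; exact/measurable_EFinP.
- exact/measurable_EFinP.
- apply: filterS cv => x h _ /=.
  by apply: cvg_EFin => //; exact: nearW.
have {}lim : ((\int[m]_x f_ k x)%:E @[k --> \oo] --> (\int[m]_x f x)%:E)%E.
  rewrite EFin_Rint//; apply: cvg_trans lim; apply: near_eq_cvg.
  apply: nearW => k /=; rewrite EFin_Rint//.
  exact: intg_le_ae ig (fg k).
by move/fine_cvgP: lim => [].
Qed.

End real_integrals.

(** * Images of measures and Lebesgue measure on the plane *)

(** The image measure as a structure that depends on a proof of measurability, so that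
    integrals with respect to it can be formed for a map given by a variable. *)
Definition image_measure {d1 d2 : measure_display} {T1 : measurableType d1}
    {T2 : measurableType d2} {R : realType} (m : {measure set T1 -> \bar R})
    (phi : T1 -> T2) (mphi : measurable_fun setT phi) :
    {measure set T2 -> \bar R} :=
  measure_function_pushforward__canonical__measure_function_Measure m mphi.

Section scaling_maps.
Context {d1 d2 : measure_display} {T1 : measurableType d1}
  {T2 : measurableType d2} {R : realType}.
Variables (m1 : {measure set T1 -> \bar R}) (m2 : {measure set T2 -> \bar R}).

(** Affine maps of the line and shears and swaps of the plane are all of this kind, so
    that one change of variables covers them. *)
Definition scales (k : {nonneg R}) (phi : T1 -> T2) :=
  measurable_fun setT phi /\
  forall A, measurable A -> m1 (phi @^-1` A) = (k%:num%:E * m2 A)%E.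

Lemma scales_integral_ge0 k phi (f : T2 -> \bar R) : scales k phi ->
  measurable_fun setT f -> (forall y, (0 <= f y)%E) ->
  (\int[m1]_x f (phi x) = k%:num%:E * \int[m2]_y f y)%E.
Proof.
move=> [mphi phiE] mf f0.
rewrite -ge0_integral_mscale//.
have /esym -> := @ge0_integral_pushforward _ _ _ _ _ phi mphi m1 setT f measurableT mf (fun y _ => f0 y).
apply: eq_measure_integral => A mA _ /=.
by rewrite /pushforward phiE.
Qed.

Lemma scales_intg k phi (f : T2 -> R) : scales k phi ->
  intg m2 f -> intg m1 (f \o phi).
Proof.
move=> sphi intf; have mf := intg_measurable intf.
have [mphi _] := sphi.
apply/integrableP; split.
  by apply/measurable_EFinP; exact: measurableT_comp.
rewrite (@scales_integral_ge0 k phi (fun y => `|(f y)%:E|%E))//.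
  case/integrableP: intf => _ foo.
  by apply: lte_mul_pinfty => //; rewrite ?lee_fin// ge0_fin_numE// integral_ge0.
by apply: measurableT_comp => //; exact/measurable_EFinP.
Qed.

Lemma scales_Rint k phi (f : T2 -> R) : scales k phi ->
  intg m2 f -> \int[m1]_x f (phi x) = k%:num * \int[m2]_y f y.
Proof.
move=> sphi intf.
have fin := integrable_fin_num measurableT intf.
rewrite -[RHS]/(fine (_ * _)%:E) EFinM EFin_Rint//; congr fine.
rewrite integralE [X in (_ * X)%E]integralE muleBr//; last first.
  apply: fin_num_adde_defl.
  by rewrite fin_numN; apply: integrable_fin_num => //; exact: integrable_funeneg.
have mf : measurable_fun setT (EFin \o f) by exact: measurable_int intf.
have hp := scales_integral_ge0 sphi (measurable_funepos mf)
  (fun y => funepos_ge0 _ y).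
have hn := scales_integral_ge0 sphi (measurable_funeneg mf)
  (fun y => funeneg_ge0 _ y).
by congr (_ - _)%E; [rewrite -hp|rewrite -hn]; apply: eq_integral => x _;
  rewrite ?funeposE ?funenegE.
Qed.

Lemma scales_ae k phi (P : T2 -> Prop) : scales k phi ->
  {ae m2, forall y, P y} -> {ae m1, forall x, P (phi x)}.
Proof.
move=> [mphi phiE] [N [mN N0 PN]]; exists (phi @^-1` N); split.
- by rewrite -[X in measurable X]setTI; exact: mphi.
- by rewrite phiE// N0 mule0.
- by move=> x /= Px; exact: PN.
Qed.

End scaling_maps.

Section lebesgue_plane.
Context {R : realType}.
Local Notation mu := (lebesgue1 R).
Local Notation mu2 := (lebesgue2 R).

Local Notation Rm := (measurableTypeR R).

(** The line carries two measurable structures with the same sets but with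
    different displays: that of [R] and that of its Lebesgue measure.  The next lemmas
    move between them. *)
Lemma measurable_toRm d (T : measurableType d) (D : set T) (f : T -> R) :
  measurable_fun D f -> measurable_fun D (f : T -> Rm).
Proof. by []. Qed.

Lemma measurable_idR : measurable_fun setT (id : Rm -> R).
Proof. by move=> _ Y mY; rewrite setTI. Qed.

Lemma measurable_ofR (f : R -> R) :
  measurable_fun setT f -> measurable_fun setT (f : Rm -> R).
Proof. by []. Qed.

Lemma measurable_fstR : measurable_fun setT (fst : Rm * Rm -> R).
Proof. exact: (measurableT_comp measurable_idR measurable_fst). Qed.

Lemma measurable_sndR : measurable_fun setT (snd : Rm * Rm -> R).
Proof. exact: (measurableT_comp measurable_idR measurable_snd). Qed.

Lemma measurable_affine (z k : R) :
  measurable_fun setT (fun x : Rm => z + k * x).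
Proof.
by apply: measurable_funD => //; apply: measurable_funM => //;
  exact: measurable_idR.
Qed.

(** The image of the Lebesgue measure under an affine map, rescaled, has the value
    [b - a] on every interval from [a] to [b], which characterizes the Lebesgue measure. *)
Lemma mu_affine (z k : R) (A : set R) : k != 0 -> measurable A ->
  mu ((fun x => z + k * x) @^-1` A) = (`|k|^-1%:E * mu A)%E.
Proof.
move=> k0 mA; pose phi := (fun x : Rm => z + k * x : Rm).
have mphi := measurable_toRm (measurable_affine z k).
pose nu : {measure set Rm -> \bar R} :=
  [the measure _ _ of mscale (NngNum (normr_ge0 k)) (image_measure mu mphi)].
have k1 : 0 < `|k| by rewrite normr_gt0.
rewrite (@lebesgue_measure_unique R nu _ A mA); last first.
  move=> X /ocitvP[->|[[a b]/= ab ->]]; first by rewrite !measure0.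
  rewrite /nu /mscale /= /pushforward lebesgue_measure_itv /= lte_fin ab.
  have [kp|kn] := ltP 0 k.
    have -> : phi @^-1` `]a, b] = `](a - z) / k, (b - z) / k]%classic.
      apply/seteqP; split=> x /=; rewrite !in_itv /= /phi;
        rewrite ltr_pdivrMr// ler_pdivlMr// ltrBlDl lerBrDl [x * k]mulrC//.
    rewrite lebesgue_measure_itv /= lte_fin ltr_pM2r ?invr_gt0// ltrD2r ab.
    rewrite gtr0_norm// -!EFinB -EFinM; congr EFin; field.
    by rewrite gt_eqF.
  have {}kn : k < 0 by rewrite lt_neqAle k0.
  have -> : phi @^-1` `]a, b] = `[(b - z) / k, (a - z) / k[%classic.
    apply/seteqP; split=> x /=; rewrite !in_itv /= /phi;
      rewrite ltr_ndivlMr// ler_ndivrMr// ltrBlDl lerBrDl [x * k]mulrC// andbC//.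
  rewrite lebesgue_measure_itv /= lte_fin ltr_nM2r ?invr_lt0// ltrD2r ab.
  rewrite ltr0_norm// -!EFinB -EFinM; congr EFin; field.
  by rewrite lt_eqF.
rewrite /nu /mscale /= /pushforward muleA -EFinM mulVf ?mul1e//.
by rewrite gt_eqF.
Qed.

Lemma scales_affine (z k : R) : k != 0 ->
  scales mu mu `|k^-1|%:nng (fun x : Rm => z + k * x : Rm).
Proof.
move=> k0; split; first exact: measurable_toRm (measurable_affine z k).
by move=> A mA /=; rewrite [LHS](mu_affine z k0 mA) normfV.
Qed.

(** A shear acts on each fibre as an isometry of the line. *)
Lemma scales_shear (g : R -> R) (c : R) : measurable_fun setT (g : Rm -> R) ->
  `|c| = 1 ->
  scales mu2 mu2 1%:nng (fun p : Rm * Rm => (p.1, g p.1 + c * p.2 : Rm)).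
Proof.
move=> mg c1; set phi := (fun p : Rm * Rm => _).
have c0 : c != 0 by rewrite -normr_gt0 c1.
have mphi : measurable_fun setT phi.
  apply: measurable_fun_pair; first exact: measurable_fst.
  apply: measurable_toRm; apply: measurable_funD.
    exact: (measurableT_comp mg measurable_fst).
  by apply: measurable_funM => //; exact: measurable_sndR.
split => // A mA; rewrite mul1e; apply/esym.
pose nu := image_measure mu2 mphi.
rewrite -[RHS]/(nu A); apply: product_measure_unique => // B C mB mC.
rewrite -[LHS]/(\int[mu]_t mu (xsection (phi @^-1` (B `*` C)) t))%E.
rewrite (eq_integral (fun t => (mu C) * (\1_B t)%:E)%E); last first.
  move=> t _; rewrite indicE; have [tB|tB] := boolP (t \in B).
    rewrite mule1 -[RHS]mul1e; have := mu_affine (g t) c0 mC.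
    rewrite c1 invr1 => <-; congr (mu _); apply/seteqP; split=> x /=.
      by rewrite /xsection /= inE /phi /= => -[].
    by rewrite /xsection /= inE /phi /= => Cx; split => //; exact/set_mem.
  rewrite mule0 -(measure0 mu); congr (mu _).
  apply/seteqP; split=> x //=; rewrite /xsection /= inE /phi /= => -[] Bt.
  by move: tB; rewrite mem_set.
rewrite ge0_integralZl//; last first.
  by apply/measurable_EFinP; apply: measurable_indic.
by rewrite integral_indic// setIT muleC.
Qed.

Lemma scales_swap : scales mu2 mu2 1%:nng (fun p : Rm * Rm => (p.2, p.1)).
Proof.
set phi := (fun p : Rm * Rm => _).
have mphi : measurable_fun setT phi.
  by apply: measurable_fun_pair; [exact: measurable_snd|exact: measurable_fst].
split => // A mA; rewrite mul1e; apply/esym.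
pose nu := image_measure mu2 mphi.
rewrite -[RHS]/(nu A); apply: product_measure_unique => // B C mB mC.
rewrite -[LHS]/(mu2 (phi @^-1` (B `*` C))).
have -> : phi @^-1` (B `*` C) = C `*` B.
  by apply/seteqP; split=> x /= [? ?]; split.
by rewrite product_measure1E// muleC.
Qed.

Lemma ae_xsection (P : R * R -> Prop) : {ae mu2, forall p, P p} ->
  {ae mu, forall t, {ae mu, forall x, P (t, x)}}.
Proof.
move=> [N [mN N0 PN]].
have h : (\int[mu]_t `|mu (xsection N t)| = 0)%E.
  by rewrite -[RHS]N0; apply: eq_integral => t _; rewrite gee0_abs.
have := (ae_eq_integral_abs mu measurableT (measurable_fun_xsection mu mN)).1 h.
apply: filterS => t /(_ I) /= Nt.
exists (xsection N t); split => //; first exact: measurable_xsection.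
by move=> x /= Px; rewrite /xsection /= inE; exact: PN.
Qed.

Lemma ae_ysection (P : R * R -> Prop) : {ae mu2, forall p, P p} ->
  {ae mu, forall x, {ae mu, forall t, P (t, x)}}.
Proof. by move/(scales_ae scales_swap)/ae_xsection. Qed.

End lebesgue_plane.

(** * Iterated integrals and Borel sets of the plane *)

Section plane_integrals.
Context {R : realType}.
Local Notation mu := (lebesgue1 R).
Local Notation mu2 := (lebesgue2 R).
Local Notation Rm := (measurableTypeR R).
Implicit Types f g : R * R -> R.

Lemma integrable_fine d (T : measurableType d) (m : {measure set T -> \bar R})
    (F : T -> \bar R) : m.-integrable setT F ->
  intg m (fine \o F) /\ \int[m]_x fine (F x) = fine (\int[m]_x F x)%E.
Proof.
move=> iF; have mF := measurable_int _ iF.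
have mfF : measurable_fun setT (fine \o F) by exact: measurableT_comp.
have Ffin := integrable_ae measurableT iF.
have aeE : {ae m, forall x, (fine (F x))%:E = F x}.
  by apply: aeS Ffin => x /(_ I) /fineK.
split.
  apply/integrableP; split; first exact/measurable_EFinP.
  case/integrableP: iF => _; apply: le_lt_trans.
  apply: ge0_le_integral => //; [|exact: measurableT_comp|].
    by apply: measurableT_comp => //; exact/measurable_EFinP.
  by move=> x _ /=; case: (F x) => [r| |] //=; rewrite leey.
congr fine; apply: ae_eq_integral => //; first exact/measurable_EFinP.
by apply: aeS aeE => x ->.
Qed.

Lemma intg_xsection f : intg mu2 f ->
  {ae mu, forall t, intg mu (fun x => f (t, x))}.
Proof. by move/ae_integrable1. Qed.

Lemma intg_fubini f : intg mu2 f -> intg mu (fun t => \int[mu]_x f (t, x)).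
Proof. by move/integrable_fubini_F/integrable_fine => []. Qed.

Lemma Rint_fubini f : intg mu2 f ->
  \int[mu2]_p f p = \int[mu]_t \int[mu]_x f (t, x).
Proof.
move=> intf; rewrite [RHS](integrable_fine (integrable_fubini_F intf)).2.
by congr fine; rewrite -(integral12_prod_meas1 intf).
Qed.

Lemma intg_swap f : intg mu2 f -> intg mu2 (fun p => f (p.2, p.1)).
Proof. by move/(scales_intg scales_swap). Qed.

Lemma Rint_swap f : intg mu2 f ->
  \int[mu2]_p f (p.2, p.1) = \int[mu2]_p f p.
Proof. by move/(scales_Rint scales_swap) => ->; rewrite mul1r. Qed.

Lemma intg_ysection f : intg mu2 f ->
  {ae mu, forall x, intg mu (fun t => f (t, x))}.
Proof. by move/intg_swap/intg_xsection. Qed.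

Lemma intg_fubiniC f : intg mu2 f -> intg mu (fun x => \int[mu]_t f (t, x)).
Proof. by move/intg_swap/intg_fubini. Qed.

Lemma Rint_fubiniC f : intg mu2 f ->
  \int[mu2]_p f p = \int[mu]_x \int[mu]_t f (t, x).
Proof. by move=> intf; rewrite -Rint_swap// Rint_fubini//; exact: intg_swap. Qed.

(** Integrability over the plane from bounds on lines of constant time, which is what the
    derivatives of waves come with. *)
Lemma intg_tonelli f (b : R -> R) : measurable_fun setT (f : Rm * Rm -> R) ->
  intg mu b ->
  {ae mu, forall t, intg mu (fun x => f (t, x)) /\
                    \int[mu]_x `|f (t, x)| <= b t} ->
  intg mu2 f.
Proof.
move=> mf ib fb.
have mf' : measurable_fun [set: Rm * Rm] (EFin \o f) by exact/measurable_EFinP.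
apply/(integrable12ltyP mu mu mf').
case/integrableP: ib => mb; apply: le_lt_trans.
apply: ae_ge0_le_integral => //.
- by move=> t _; exact: integral_ge0.
- have h : measurable_fun [set: Rm * Rm] (fun p => `|(f p)%:E|%E).
    exact: measurableT_comp.
  exact: (measurable_fun_fubini_tonelli_F (m2 := mu) _ h (fun=> abse_ge0 _)).
- exact: measurableT_comp.
apply: aeS fb => t [ift fb] _.
rewrite -[X in (X <= _)%E](EFin_Rint (intg_norm ift)) lee_fin.
exact: le_trans fb (ler_norm _).
Qed.

Lemma measurable_Rint d (T : measurableType d) (f : T * Rm -> R) :
  measurable_fun setT f -> measurable_fun setT (fun t => \int[mu]_x f (t, x)).
Proof.
move=> mf; apply: (measurableT_comp (f := fine)); first exact: fine_measurable.
have -> : (fun t => \int[mu]_x (f (t, x))%:E)%E =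
    (fun t => fubini_F mu (EFin \o f)^\+ t - fubini_F mu (EFin \o f)^\- t)%E.
  apply/funext => t; rewrite integralE /fubini_F.
  by congr (_ - _)%E; apply: eq_integral => x _; rewrite ?funeposE ?funenegE.
have mf' : measurable_fun setT (EFin \o f) by exact/measurable_EFinP.
apply: emeasurable_funB.
- exact: (measurable_fun_fubini_tonelli_F (m2 := mu) _ (measurable_funepos mf')
    (funepos_ge0 _)).
- exact: (measurable_fun_fubini_tonelli_F (m2 := mu) _ (measurable_funeneg mf')
    (funeneg_ge0 _)).
Qed.

Definition open_box (q : R * R * R * R) : set (R * R) :=
  [set p | q.1.1.1 < p.1 < q.1.1.2 /\ q.1.2 < p.2 < q.2].

Definition closed_box (q : R * R * R * R) : set (R * R) :=
  [set p | q.1.1.1 <= p.1 <= q.1.1.2 /\ q.1.2 <= p.2 <= q.2].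

(** Countably many boxes through which open sets are described; indices that code no
    quadruple of rational numbers give a degenerate box. *)
Definition rat_box (k : nat) : R * R * R * R :=
  if @unpickle (rat * rat * rat * rat)%type k is Some (a, b, c, d)
  then (ratr a, ratr b, ratr c, ratr d) else 0.

Lemma measurable_open_box q : measurable (open_box q : set (Rm * Rm)).
Proof.
have -> : open_box q = `]q.1.1.1, q.1.1.2[ `*` `]q.1.2, q.2[.
  by apply/seteqP; split=> x /=; rewrite /open_box /= !in_itv.
by apply: measurableX; exact: measurable_itv.
Qed.

Lemma open_rat_boxes (O : set (R * R)) : open O -> forall p, O p ->
  exists k, open_box (rat_box k) p /\ closed_box (rat_box k) `<=` O.
Proof.
move=> oO p Op; have /nbhs_ballP[e /= e0 be] := open_nbhs_nbhs (conj oO Op).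
have [a] : exists a : rat, ratr a \in `]p.1 - e, p.1[%R.
  by apply: rat_in_itvoo; rewrite gtrBl.
have [b] : exists a : rat, ratr a \in `]p.1, p.1 + e[%R.
  by apply: rat_in_itvoo; rewrite ltrDl.
have [c] : exists a : rat, ratr a \in `]p.2 - e, p.2[%R.
  by apply: rat_in_itvoo; rewrite gtrBl.
have [d] : exists a : rat, ratr a \in `]p.2, p.2 + e[%R.
  by apply: rat_in_itvoo; rewrite ltrDl.
rewrite !in_itv /= => /andP[d1 d2] /andP[c1 c2] /andP[b1 b2] /andP[a1 a2].
exists (pickle (a, b, c, d)); rewrite /rat_box pickleK; split.
  by rewrite /open_box /= a2 b1 c2 d1.
move=> x; rewrite /closed_box /= => -[/andP[x1 x2] /andP[x3 x4]].
apply: be; split; rewrite /ball /= ltr_distlC; apply/andP; split; lra.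
Qed.

Lemma open_measurable2 (O : set (R * R)) : open O ->
  measurable (O : set (Rm * Rm)).
Proof.
move=> oO.
have -> : O = \bigcup_k (if `[< closed_box (rat_box k) `<=` O >]
                         then open_box (rat_box k) else set0).
  apply/seteqP; split=> [p Op|p [k _]].
    have [k [kp kO]] := open_rat_boxes oO Op.
    by exists k => //; rewrite asboolT.
  case: asboolP => // kO [/andP[p1 p2] /andP[p3 p4]]; apply: kO.
  by rewrite /closed_box /= !ltW.
apply: bigcupT_measurable => k; case: asboolP => _ //.
exact: measurable_open_box.
Qed.

Lemma closed_measurable2 (C : set (R * R)) : closed C ->
  measurable (C : set (Rm * Rm)).
Proof.
move=> cC; rewrite -[C]setCK; apply: measurableC; apply: open_measurable2.
exact: closed_openC.
Qed.

Lemma continuous_measurable2 f : continuous f ->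
  measurable_fun setT (f : Rm * Rm -> R).
Proof.
move=> cf.
apply: (measurability _ (RGenOpens.measurableE R)).
move=> _ [_ [a [b ->]] <-]; rewrite setTI; apply: open_measurable2.
by apply: open_comp => // x _; exact: cf.
Qed.

(** A graph has one point over each value of the first coordinate.  The boundaries of triangles, cones and
    bands, on which their indicators need special care, are null for this reason. *)
Lemma ae_graph (g : R -> R) : measurable_fun setT (g : Rm -> R) ->
  {ae mu2, forall p, p.2 != g p.1}.
Proof.
move=> mg; pose N : set (Rm * Rm) := [set p | p.2 = g p.1].
have mN : measurable N.
  have -> : N = (fun p : Rm * Rm => p.2 - g p.1 : R) @^-1` [set 0].
    by apply/seteqP; split=> p /=; rewrite /N /= => h; apply/eqP; move/eqP: h;
      rewrite subr_eq0.
  rewrite -[X in measurable X]setTI.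
  have : measurable_fun setT (fun p : Rm * Rm => p.2 - g p.1 : R).
    apply: measurable_funB; first exact: measurable_sndR.
    exact: (measurableT_comp mg measurable_fst).
  by apply.
exists N; split => //; last by move=> p /= /negP; rewrite negbK => /eqP.
rewrite -[LHS]/(\int[mu]_t mu (xsection N t))%E.
rewrite (eq_integral (fun=> 0%E)) ?integral0// => t _.
have -> : xsection N t = [set g t].
  by apply/seteqP; split=> x; rewrite /xsection /= inE.
exact: lebesgue_measure_set1.
Qed.

End plane_integrals.

(** * Primitives of integrable functions *)

Section line_integrals.
Context {R : realType}.
Local Notation mu := (lebesgue1 R).
Local Notation Rm := (measurableTypeR R).
Implicit Types (f g : R -> R) (a b x y z e d k : R).

Lemma intg_affine z k f : k != 0 -> intg mu f ->
  intg mu (fun x => f (z + k * x)).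
Proof. by move=> k0 /(scales_intg (scales_affine z k0)). Qed.

Lemma Rint_affine z k f : k != 0 -> intg mu f ->
  \int[mu]_x f (z + k * x) = `|k^-1| * \int[mu]_x f x.
Proof. by move=> k0 /(scales_Rint (scales_affine z k0)) ->. Qed.

Lemma measurable_itvR (i : interval R) : measurable ([set` i] : set Rm).
Proof. exact: measurable_itv. Qed.

Lemma measurable_indic_itv (i : interval R) :
  measurable_fun setT (\1_[set` i] : Rm -> R).
Proof. by apply: measurable_indic; exact: measurable_itvR. Qed.

Lemma intg_indic_itv a b : intg mu (\1_(`[a, b]%classic) : R -> R).
Proof. exact: integrable_indic_itv. Qed.

Lemma indic_itvE (i : interval R) x : \1_[set` i] x = (x \in i)%:R :> R.
Proof. by rewrite indicE; congr (nat_of_bool _)%:R; apply/idP/idP; rewrite inE. Qed.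

Lemma intg_cst_itv a b c : intg mu (fun x => \1_(`[a, b]%classic) x * c).
Proof.
by apply: intg_ext (intgZ c (intg_indic_itv a b)) => x; rewrite mulrC.
Qed.

Lemma intg_itv (i : interval R) g : intg mu g ->
  intg mu (fun x => \1_[set` i] x * g x).
Proof. by apply: intg_indic; exact: measurable_itvR. Qed.

(** The absolute continuity of the integral, with one [d] for all positions of the interval:
    this uniformity is the source of all smallness in thin time slabs. *)
Lemma intg_small g e : intg mu g -> 0 < e -> exists2 d, 0 < d &
  forall a b, b - a < d -> \int[mu]_x (\1_(`[a, b]%classic) x * `|g x|) < e.
Proof.
move=> ig e0; have [d [d0 h]] := integral_normr_continuous ig e0.
exists d => // a b abd; rewrite -Rint_indic; apply: h => //.
rewrite [X in (X < _)%E](lebesgue_measure_itv `[a, b]) /= lte_fin.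
case: ifPn => _; last by rewrite lte_fin.
by rewrite -EFinB lte_fin.
Qed.

Definition primitive g x := \int[mu]_y (\1_(`]-oo, x]%classic) y * g y).

Lemma primitiveB g a b : intg mu g -> a <= b ->
  primitive g b - primitive g a = \int[mu]_y (\1_(`]a, b]%classic) y * g y).
Proof.
move=> ig ab; rewrite -RintB; [|exact: intg_itv..].
apply: eq_Rint => y; rewrite !indic_itvE !in_itv /=.
by case: (ltP a y) (leP y b) => [ay|ya] [yb|by']; rewrite /= ?mul0r ?mul1r ?subrr ?subr0//; lra.
Qed.

Lemma primitive_le g x : intg mu g -> `|primitive g x| <= \int[mu]_y `|g y|.
Proof.
move=> ig; apply: Rint_bound_ae (intg_norm ig) _; last first.
  apply: aeW => y; rewrite normrM indic_itvE ler_piMl//.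
  by case: (_ \in _); rewrite ?normr1 ?normr0.
exact: intg_measurable (intg_itv _ ig).
Qed.

Lemma primitive_dist g a b : intg mu g -> a <= b ->
  `|primitive g b - primitive g a| <=
  \int[mu]_y (\1_(`[a, b]%classic) y * `|g y|).
Proof.
move=> ig ab; rewrite primitiveB//.
apply: Rint_bound_ae; last 1 first.
- apply: aeW => y; rewrite normrM ler_wpM2r// !indic_itvE !in_itv /=.
  by case: (ltP a y) (leP y b) => [ay|ya] [yb|by']; rewrite /= ?normr1 ?normr0 ?(ltW ay)//.
- exact: intg_measurable (intg_itv _ ig).
- exact: intg_itv (intg_norm ig).
Qed.

Lemma primitive_continuous g : intg mu g -> continuous (primitive g).
Proof.
move=> ig x; apply/cvgrPdist_lt => e e0.
have [d d0 h] := intg_small ig e0.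
near=> y.
have xy : `|x - y| < d by near: y; apply: cvgr_dist_lt.
have [yx|/ltW yx] := leP y x.
  apply: le_lt_trans (primitive_dist ig yx) _; apply: h.
  exact: le_lt_trans (ler_norm _) xy.
rewrite distrC; apply: le_lt_trans (primitive_dist ig yx) _; apply: h.
by rewrite distrC in xy; exact: le_lt_trans (ler_norm _) xy.
Unshelve. all: by end_near. Qed.

(** Lebesgue's differentiation theorem. *)
Lemma primitive_derivable g : intg mu g ->
  {ae mu, forall x, derivable (primitive g) x 1 /\ (primitive g)^`()%classic x = g x}.
Proof.
move=> ig.
have -> : primitive g = (fun x => \int[mu]_(t in [set` `]-oo, x]]) g t)%R.
  by apply/funext => x; rewrite Rint_indic.
apply: FTC1Ny => [y|].
  by apply: integrableS ig => //; exact: measurable_itvR.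
split; [exact: intg_measurable ig|exact: openT|].
move=> K _ cK; case/integrableP: ig => mg; apply: le_lt_trans.
apply: ge0_subset_integral => //; first exact: compact_measurable.
apply/measurable_EFinP; apply: measurableT_comp => //.
exact/measurable_EFinP.
Qed.

(** The primitive is continuous, so it vanishes identically, and [g] is its derivative
    almost everywhere. *)
Lemma primitive_eq0 g : intg mu g -> (forall r : rat, primitive g (ratr r) = 0) ->
  {ae mu, forall x, g x = 0}.
Proof.
move=> ig g0.
have {}g0 x : primitive g x = 0.
  apply/eqP; rewrite -normr_le0; apply/ler_addgt0Pr => e e0; rewrite add0r.
  have [d d0 h] := intg_small ig e0.
  have [r] : exists r : rat, ratr r \in `]x, x + d[%R.
    by apply: rat_in_itvoo; rewrite ltrDl.
  rewrite in_itv /= => /andP[xr rd].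
  have := primitive_dist ig (ltW xr); rewrite g0 sub0r normrN => /le_trans; apply.
  by apply/ltW/h; rewrite ltrBlDl.
apply: aeS (primitive_derivable ig) => x [_].
have -> : primitive g = cst 0 by apply/funext => y; rewrite g0.
by rewrite derive1_cst.
Qed.

End line_integrals.

(** * Integration by parts against a primitive *)

Lemma measurable_bool d (T : measurableType d) (R : realType) (D : set T)
  (b : T -> bool) : measurable D -> measurable_fun D b ->
  measurable_fun D (fun x => (b x)%:R : R).
Proof.
move=> mD mb.
have -> : (fun x => (b x)%:R : R) = (fun x => if b x then 1 else 0).
  by apply/funext => x; case: (b x).
exact: measurable_fun_if.
Qed.

Lemma norm_bool_le (R : realType) (b : bool) (x : R) : `|b%:R * x| <= `|x|.
Proof. by case: b; rewrite ?mul1r// mul0r normr0. Qed.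

(** Measurability of arithmetic expressions in coordinates and of truth values
    of inequalities between them. *)
Ltac meas := repeat first
  [ match goal with H : measurable_fun _ ?f |- measurable_fun _ ?f =>
      exact: H end
  | exact: measurable_cst | exact: measurable_indic_itv
  | exact: measurable_fstR | exact: measurable_sndR | exact: measurable_idR
  | apply: measurable_funD | apply: measurable_funB
  | apply: measurable_funM | apply: measurable_funN
  | apply: measurable_bool; [exact: measurableT|]
  | apply: measurable_and | apply: measurable_fun_ler
  | apply: measurable_fun_ltr | apply: normr_measurable
  | exact: measurable_fst | exact: measurable_snd
  | exact: intg_measurable ].

Section integration_by_parts.
Context {R : realType}.
Local Notation mu := (lebesgue1 R).
Local Notation mu2 := (lebesgue2 R).
Local Notation Rm := (measurableTypeR R).
Implicit Types (f g phi dphi V : R -> R) (a b A B x t s : R).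

Lemma intg_prod f g : intg mu f -> intg mu g ->
  intg mu2 (fun p => f p.1 * g p.2).
Proof.
move=> intf intg'.
have mf := intg_measurable intf; have mg := intg_measurable intg'.
apply: (intg_tonelli (b := fun t => `|f t| * \int[mu]_x `|g x|)).
- apply: measurable_funM.
    exact: (measurableT_comp mf measurable_fst).
  exact: (measurableT_comp mg measurable_snd).
- apply: intg_ext (intgZ (\int[mu]_x `|g x|) (intg_norm intf)) => t /=.
  by rewrite mulrC.
apply: aeW => t /=; split; first exact: intgZ.
rewrite -RintZ; last exact: intg_norm.
apply: Rint_le => [||x]; last by rewrite normrM.
  exact/intg_norm/intgZ.
exact/intgZ/intg_norm.
Qed.

Lemma continuous_bounded_itv f a b : continuous f ->
  exists2 M : R, 0 <= M & forall x, a <= x <= b -> `|f x| <= M.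
Proof.
move=> cf; have [ab|ba] := leP a b; last first.
  by exists 0 => // x /andP[ax xb]; have := le_trans ax xb; rewrite leNgt ba.
have cnf : continuous (fun x => `|f x|).
  by move=> x; apply: cvg_norm; exact: cf.
have [c _ cm] := EVT_max ab (continuous_subspaceT cnf).
by exists `|f c| => // x xab; apply: cm; rewrite in_itv.
Qed.

Lemma intg_continuous_itv f a b : continuous f ->
  intg mu (fun x => \1_(`[a, b]%classic) x * f x).
Proof.
move=> cf; have [M M0 fM] := continuous_bounded_itv a b cf.
have mf : measurable_fun setT (f : Rm -> R).
  by apply: measurable_ofR; exact: continuous_measurable_fun.
apply: (intg_le _ (intg_cst_itv a b M)); first by meas.
move=> x; rewrite normrM indic_itvE in_itv /=.
have [/fM|_] := boolP (a <= x <= b); first by rewrite normr1 !mul1r.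
by rewrite normr0 !mul0r.
Qed.

Lemma Rint_derivative phi dphi a b : a <= b ->
  (forall x, is_derive x 1 phi (dphi x)) -> continuous dphi ->
  \int[mu]_x (\1_(`[a, b]%classic) x * dphi x) = phi b - phi a.
Proof.
move=> ab dp cd; rewrite -Rint_indic.
have [-> |nab] := eqVneq a b; first by rewrite set_itv1 Rintegral_set1 subrr.
have {}ab : a < b by rewrite lt_neqAle nab.
have cphi : continuous phi.
  move=> x; apply: differentiable_continuous; apply/derivable1_diffP.
  exact: ex_derive.
rewrite /Rintegral (@continuous_FTC2 _ dphi phi) //=.
- exact: continuous_subspaceT.
- split=> [x _| |]; first exact: ex_derive.
    by apply: cvg_at_right_filter; exact: cphi.
  by apply: cvg_at_left_filter; exact: cphi.
- by move=> x _; rewrite derive1E derive_val.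
Qed.

(** Insert the formula for [V] and exchange the integrals over the triangle [s <= t]: the
    inner integral of [dphi] is then a difference of two values of [phi].  [V] may
    fail to be differentiable on a null set, where the product rule says nothing. *)
Lemma Rint_by_parts A B phi dphi g V : A <= B -> phi A = 0 -> phi B = 0 ->
  (forall x, is_derive x 1 phi (dphi x)) -> continuous dphi ->
  intg mu (fun s => \1_(`[A, B]%classic) s * g s) ->
  (forall t, A <= t <= B ->
     V t = V A + \int[mu]_s (\1_(`[A, t]%classic) s * g s)) ->
  \int[mu]_t (\1_(`[A, B]%classic) t * (dphi t * V t)) =
  - \int[mu]_s (\1_(`[A, B]%classic) s * (phi s * g s)).
Proof.
move=> AB pA pB dp cd ig VE.
set G := (fun s => \1_(`[A, B]%classic) s * g s) in ig.
have iD := intg_continuous_itv A B cd.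
set D := (fun t => \1_(`[A, B]%classic) t * dphi t) in iD.
have mG := intg_measurable ig; have mD := intg_measurable iD.
pose H (p : R * R) := (p.2 <= p.1)%R%:R * (D p.1 * G p.2) : R.
have iH : intg mu2 H.
  apply: (intg_le _ (intg_norm (intg_prod iD ig))).
    apply: measurable_funM; first by meas.
    apply: measurable_funM.
      exact: (measurableT_comp mD measurable_fst).
    exact: (measurableT_comp mG measurable_snd).
  by move=> p; exact: norm_bool_le.
have HE t : \int[mu]_s H (t, s) = D t * primitive G t.
  rewrite /primitive -RintZ; last exact: intg_itv.
  apply: eq_Rint => s; rewrite /H /= indic_itvE in_itv /=; ring.
have -> : \int[mu]_t (\1_(`[A, B]%classic) t * (dphi t * V t)) =
    \int[mu]_t (V A * D t + \int[mu]_s H (t, s)).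
  apply: eq_Rint => t; rewrite HE /D indic_itvE in_itv /=.
  have [tAB|_] := boolP (A <= t <= B); last by rewrite !mul0r mulr0 addr0.
  rewrite (VE _ tAB) /primitive !mul1r.
  have -> : \int[mu]_s (\1_(`[A, t]%classic) s * g s) =
      \int[mu]_y (\1_(`]-oo, t]%classic) y * G y).
    apply: eq_Rint => s; rewrite /G !indic_itvE !in_itv /=.
    case/andP: tAB => At tB.
    case: (leP A s) (leP s t) => [As|As] [st|st];
      rewrite /= ?(le_trans st tB) ?mul1r ?mul0r ?mulr0//.
  ring.
rewrite RintD; [|exact: intgZ|exact: intg_fubini].
rewrite RintZ// Rint_derivative// pA pB subrr mulr0 add0r.
rewrite -Rint_fubini// Rint_fubiniC// -mulN1r -RintZ; last first.
  have cphi : continuous phi.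
    move=> x; apply: differentiable_continuous; apply/derivable1_diffP.
    exact: ex_derive.
  have [M M0 hM] := continuous_bounded_itv A B cphi.
  have mphi : measurable_fun setT (phi : Rm -> R).
    by apply: measurable_ofR; exact: continuous_measurable_fun.
  apply: intg_ext (_ : intg mu (fun s => phi s * G s)) => [s|].
    rewrite /G; ring.
  apply: (intg_le _ (intgZ M (intg_norm ig))); first by meas.
  move=> s; rewrite normrM /G !normrM indic_itvE in_itv /=.
  have [/hM hs|_] := boolP (A <= s <= B); last by rewrite normr0 !mul0r !mulr0.
  by rewrite ler_wpM2r// mulr_ge0.
apply: eq_Rint => s.
have -> : \int[mu]_t H (t, s) =
    \int[mu]_t (G s * (\1_(`[s, B]%classic) t * dphi t)).
  apply: eq_Rint => t; rewrite /H /D /G /= !indic_itvE !in_itv /=.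
  case: (leP A s) (leP s B) (leP s t) (leP A t) (leP t B) => [As|As] [sB|sB] [st|st] [At|At] [tB|tB];
    rewrite /= ?mul1r ?mul0r ?mulr0 ?mul0r//; try ring; try lra.
rewrite RintZ; last exact: intg_continuous_itv.
rewrite /G indic_itvE in_itv /=.
have [/andP[As sB]|_] := boolP (A <= s <= B); last by rewrite !mul0r mulr0.
by rewrite Rint_derivative// pB; ring.
Qed.

End integration_by_parts.

(** * Absolutely continuous functions with vanishing derivative *)

Section absolute_continuity.
Context {R : realType}.
Local Notation mu := (lebesgue1 R).
Local Notation Rm := (measurableTypeR R).
Implicit Types (G g : R -> R) (a b x y e : R).

(** The condition of [absolutely_continuous] for one entry of a column, to which
    the one-dimensional theory applies. *)
Definition scalar_ac a b G : Prop :=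
  forall eps : R, 0 < eps -> exists2 delta : R, 0 < delta &
    forall (m : nat) (l r : 'I_m -> R),
      (forall i, a <= l i /\ l i <= r i /\ r i <= b) ->
      (forall i j, i != j -> r i <= l j \/ r j <= l i) ->
      \sum_i (r i - l i) < delta -> \sum_i `|G (r i) - G (l i)| < eps.

Lemma Rint_indic_oc x y : x <= y ->
  \int[mu]_z (\1_(`]x, y]%classic) z : R) = y - x.
Proof.
move=> xy; rewrite /Rintegral integral_indic//.
rewrite setIT [X in fine X](lebesgue_measure_itv `]x, y]) /= lte_fin.
move: xy; rewrite le_eqVlt => /predU1P[->|xy]; first by rewrite ltxx subrr.
by rewrite xy.
Qed.

Lemma is_derive0_small G x e : is_derive x 1 G 0 -> 0 < e ->
  exists2 d, 0 < d & forall y, `|y - x| < d -> `|G y - G x| <= e * `|y - x|.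
Proof.
move=> [dG G0] e0.
have {G0} : h^-1 *: (G (h *: 1 + x) - G x) @[h --> 0^'] --> (0 : R).
  by rewrite -[X in _ --> X]G0; exact: dG.
move/cvgrPdist_le => /(_ e e0) [d /= d0 h]; exists d => // y yx.
have [->|xy] := eqVneq y x; first by rewrite !subrr !normr0 mulr0.
have := h (y - x); rewrite /ball /= sub0r normrN subr_eq0 => /(_ yx xy).
rewrite sub0r normrN normrZ normfV.
rewrite [_ *: 1]mulr1 subrK ler_pdivrMl ?normr_gt0 ?subr_eq0// mulrC.
by [].
Qed.

(** A chain of intervals leads from [a] to [x].  Along it [G] moves by at most [e] per
    unit length, except on the recorded intervals, which lie in [U]; their total
    length is stated through the primitive of the indicator of [U], which adds up
    along the chain. *)
Let reach (U : set R) e a G x := exists m (l r : 'I_m -> R),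
  [/\ (forall i, a <= l i /\ l i <= r i /\ r i <= x),
      (forall i j, i != j -> r i <= l j \/ r j <= l i),
      \sum_i (r i - l i) <= primitive \1_U x - primitive \1_U a
    & `|G x - G a| <= e * (x - a) + \sum_i `|G (r i) - G (l i)|].

Let step (U : set R) e G x y :=
  `|G y - G x| <= e * (y - x) \/ `]x, y] `<=` U.

Let reach_step (U : set R) e a G x y : intg mu (\1_U : R -> R) -> 0 <= e ->
  a <= x -> x <= y -> reach U e a G x -> step U e G x y -> reach U e a G y.
Proof.
move=> iU e0 ax xy [m [l [r [h1 h2 h3 h4]]]] st.
have pU : primitive \1_U x <= primitive \1_U y.
  rewrite -subr_ge0 primitiveB//; apply: Rint_ge0 => z.
  by rewrite mulr_ge0 ?indic_itvE.
have tri : `|G y - G a| <= `|G y - G x| + `|G x - G a|.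
  by have := ler_normD (G y - G x) (G x - G a); rewrite addrA subrK.
case: st => [st|st].
  exists m, l, r; split => //.
  - by move=> i; have [? [? ?]] := h1 i; split => //; split => //; exact: le_trans xy.
  - by apply: le_trans h3 _; rewrite lerD2r.
  - by lra.
have unl (j : 'I_m) : unlift ord_max (widen_ord (leqnSn m) j) = Some j.
  have -> : widen_ord (leqnSn m) j = lift ord_max j; last exact: liftK.
  by apply: val_inj; rewrite /= /bump leqNgt ltn_ord.
exists m.+1, (fun i => if unlift ord_max i is Some j then l j else x),
  (fun i => if unlift ord_max i is Some j then r j else y); split.
- move=> i; case: unliftP => [j|] _ //; have [? [? rx]] := h1 j.
  by split => //; split => //; exact: le_trans xy.
- move=> i j; case: unliftP => [i'|] ->; case: unliftP => [j'|] -> // ij.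
  + by apply: h2; apply: contra_neq ij => ->.
  + by left; have [_ []] := h1 i'.
  + by right; have [_ []] := h1 j'.
  + by rewrite eqxx in ij.
- rewrite big_ord_recr /= unlift_none.
  have -> : y - x = primitive \1_U y - primitive \1_U x.
    rewrite primitiveB// -(Rint_indic_oc xy); apply: eq_Rint => z.
    rewrite indic_itvE; have [zxy|_] := boolP (_ \in _).
      by rewrite mul1r indicE mem_set//; apply: st.
    by rewrite mul0r.
  under eq_bigr do rewrite unl.
  by lra.
- rewrite big_ord_recr /= unlift_none.
  under eq_bigr do rewrite unl.
  have : 0 <= e * (y - x) by rewrite mulr_ge0// subr_ge0.
  by lra.
Qed.

(** The supremum of the points that can be reached is reached, and it cannot be less than
    [b]: steps from the left end and to the right exist near every point. *)
Let reach_end (U : set R) e a b G : intg mu (\1_U : R -> R) -> 0 <= e -> a <= b ->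
  (forall s, a <= s <= b -> exists2 d, 0 < d & forall x y, a <= x -> x <= s ->
     s <= y -> y <= b -> s - x < d -> y - s < d -> step U e G x s /\ step U e G s y) ->
  reach U e a G b.
Proof.
move=> iU e0 ab loc.
pose S := [set x | a <= x <= b /\ reach U e a G x].
have Sa : S a.
  split; first by rewrite lexx.
  exists 0%N, (fun=> a), (fun=> a); split => [[]//|[]//||].
    by rewrite big_ord0 subrr.
  by rewrite big_ord0 !subrr mulr0 normr0 addr0.
have hsS : has_sup S.
  by split; [exists a|exists b => x [/andP[]]].
pose s := sup S.
have as_ : a <= s by apply: ub_le_sup => //; exact: hsS.2.
have sb : s <= b by apply: ge_sup; [exists a|move=> x [/andP[]]].
have [d d0 hd] := loc s (introT andP (conj as_ sb)).
have [x [/andP[ax xb] rx] sx] := sup_adherent d0 hsS.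
have xs : x <= s by apply: ub_le_sup; [exact: hsS.2|split => //; rewrite ax].
have sxd : s - x < d by rewrite ltrBlDr -ltrBlDl.
have rs : reach U e a G s.
  apply: (reach_step iU e0 ax xs rx).
  by have [] := hd x s ax xs (lexx _) sb sxd; rewrite ?subrr.
have [->//|bs] := eqVneq b s.
have sb' : s < b by rewrite lt_neqAle eq_sym bs.
pose y := Num.min b (s + d / 2).
have sy : s < y by rewrite lt_min sb' ltrDl divr_gt0.
have yb : y <= b by rewrite ge_min lexx.
have ysd : y - s < d.
  by rewrite ltrBlDl (le_lt_trans (y := s + d / 2)) ?ge_min ?lexx ?orbT// ltrD2l; lra.
have ry : reach U e a G y.
  apply: (reach_step iU e0 as_ (ltW sy) rs).
  by have [] := hd s y as_ (lexx _) (ltW sy) yb; rewrite ?subrr.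
have : y <= s.
  apply: ub_le_sup; first exact: hsS.2.
  by split => //; rewrite (le_trans as_ (ltW sy)).
by rewrite leNgt sy.
Qed.

(** The points of the exceptional null set lie in an open set of small measure.  A chain of
    small intervals, each either inside that open set or with a small increment
    of [G], leads from one end of the segment to the other; absolute continuity bounds
    the increments over the intervals of the first kind. *)
Lemma scalar_ac_constant a b G : a <= b -> scalar_ac a b G ->
  {ae mu, forall x, a < x < b -> is_derive x 1 G 0} -> G b = G a.
Proof.
move=> ab acG [N [mN N0 GN]].
apply/eqP; rewrite -subr_eq0 -normr_le0; apply/ler_addgt0Pr => e0 e0_gt0.
rewrite add0r; pose e := e0 / 2 / (b - a + 1).
have e_gt0 : 0 < e by rewrite divr_gt0 ?divr_gt0//; lra.
have [d d0 hd] := acG (e0 / 2) (divr_gt0 e0_gt0 (ltr0n _ 2)).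
(* Nothing is known about [G] at the two ends, which therefore join the null set. *)
pose N' := N `|` [set a] `|` [set b].
have mN' : measurable (N' : set Rm).
  by apply: measurableU => //; apply: measurableU.
have N'0 : mu N' = 0.
  rewrite null_set_setU ?null_set_setU//; try exact: lebesgue_measure_set1.
  exact: measurableU.
have [|U [oU NU Ud]] := @lebesgue_regularity_outer R N' d mN' _ d0.
  by rewrite [X in (X < _)%E]N'0 ltry.
have mU : measurable (U : set Rm) by exact: open_measurable.
have {}Ud : (mu U < d%:E)%E.
  apply: le_lt_trans Ud; rewrite -[X in (_ <= X)%E]add0e -[X in (_ <= X + _)%E]N'0.
  rewrite -measureU//; [|exact: measurableD|by rewrite setDIK].
  by rewrite setDUK.
have iU : intg mu (\1_U : R -> R).
  by apply: intg_indicator => //; apply: lt_trans Ud _; rewrite ltry.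
have : reach U e a G b.
  apply: (reach_end iU (ltW e_gt0) ab) => s /andP[as_ sb].
  have [Ns|nNs] := pselect (N' s).
    have /nbhs_ballP[r /= r0 rU] := open_nbhs_nbhs (conj oU (NU _ Ns)).
    exists r => // x y ax xs sy yb sx ys; split; right => z /=; rewrite in_itv /= => /andP[z1 z2];
      by apply: rU; rewrite /ball /= ltr_distlC; apply/andP; split; lra.
  have dG : is_derive s 1 G 0.
    apply: contrapT => nG; apply: (nNs); left; left; apply: GN => /= h.
    apply: (nG); apply: h; rewrite !lt_neqAle as_ sb !andbT.
    apply/andP; split; apply/eqP => E; apply: nNs; first by left; right.
    by right.
  have [r r0 hr] := is_derive0_small dG e_gt0; exists r => // x y ax xs sy yb sx ys.
  split; left.
    by have := hr x; rewrite distrC ger0_norm ?subr_ge0// distrC => /(_ sx).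
  by have := hr y; rewrite ger0_norm ?subr_ge0//; apply.
move=> [m [l [r [h1 h2 h3 h4]]]].
apply: le_trans h4 _.
have : \sum_i `|G (r i) - G (l i)| < e0 / 2.
  apply: hd => //; apply: le_lt_trans h3 _.
  apply: le_lt_trans (ler_norm _) _; apply: le_lt_trans (primitive_dist iU ab) _.
  apply: (@le_lt_trans _ _ (\int[mu]_x \1_U x)).
    apply: Rint_le => // [|x]; first exact/intg_itv/intg_norm.
    have U0 : 0 <= \1_U x :> R by rewrite indicE.
    by rewrite ger0_norm// ler_piMl// indic_itvE; case: (_ \in _).
  rewrite Rint_indicator// -lte_fin fineK ?ge0_fin_numE//.
  by apply: lt_trans Ud _; rewrite ltry.
have : e * (b - a) <= e0 / 2.
  rewrite /e mulrAC ler_pdivrMr; last lra.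
  by rewrite ler_wpM2l//; [rewrite divr_ge0// ltW|lra].
lra.
Qed.

End absolute_continuity.

(** * Absolutely continuous functions as primitives *)

Section absolute_continuity_primitive.
Context {R : realType}.
Local Notation mu := (lebesgue1 R).
Local Notation Rm := (measurableTypeR R).
Implicit Types (v dv g k : R -> R) (a b x y z e h : R).

Lemma scalar_ac_primitive a b g : intg mu g -> scalar_ac a b (primitive g).
Proof.
move=> ig e e0; have [d [d0 hd]] := integral_normr_continuous ig e0.
exists d => // m l r h1 h2 h3.
pose I i := `]l i, r i]%classic.
pose A := \bigcup_(i in [set: 'I_m]) I i.
have mA : measurable (A : set Rm).
  by apply: fin_bigcup_measurable => // i _; exact: measurable_itvR.
have sumE x : \sum_i \1_(I i) x = \1_A x :> R.
  rewrite [RHS]indicE; have [|nA] := boolP (x \in A).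
    rewrite inE => -[j _ Ij]; rewrite (bigD1 j)//= indicE mem_set// big1 ?addr0//.
    move=> i ij; rewrite indicE memNset// /I /= in_itv /= => /andP[lx xr].
    move: Ij; rewrite /I /= in_itv /= => /andP[lx' xr'].
    by case: (h2 _ _ ij); lra.
  rewrite big1// => i _; rewrite indicE memNset// => Ii.
  by move/negP: nA; apply; rewrite inE; exists i.
have iI i : intg mu (\1_(I i) : R -> R) by exact: integrable_indic_itv.
have Ad : (mu A < d%:E)%E.
  have iA : intg mu (\1_A : R -> R).
    by apply: intg_ext (intg_sum (index_enum _) iI) => x; exact: sumE.
  have Aoo : (mu A < +oo)%E.
    case/integrableP: iA => _; apply: le_lt_trans.
    rewrite -[X in (X <= _)%E](_ : \int[mu]_x (\1_A x)%:E = _)%E; last first.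
      by rewrite integral_indic// setIT.
    apply: ge0_le_integral => //; do ?[by move=> x _; rewrite lee_fin indicE].
    - by apply/measurable_EFinP; exact: measurable_indic.
    - apply: measurableT_comp => //; apply/measurable_EFinP; exact: measurable_indic.
    - by move=> x _; rewrite /= lee_fin ler_norm.
  have E : \int[mu]_x (\1_A x : R) = \sum_i (r i - l i).
    transitivity (\int[mu]_x (\sum_i \1_(I i) x : R)); first exact/eq_Rint.
    rewrite Rint_sum//; apply: eq_bigr => i _.
    by rewrite Rint_indic_oc//; have [_ []] := h1 i.
  rewrite -(@fineK _ (mu A)) ?ge0_fin_numE// lte_fin.
  by rewrite [X in X < _](_ : _ = \sum_i (r i - l i))// -E Rint_indicator.
suff h : \sum_i `|primitive g (r i) - primitive g (l i)| <=
    \int[mu]_(x in A) `|g x| by apply: le_lt_trans h _; exact: hd.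
rewrite Rint_indic.
have -> : \int[mu]_x (\1_A x * `|g x|) =
    \int[mu]_x (\sum_i (\1_(I i) x * `|g x|)).
  by apply: eq_Rint => x; rewrite -sumE mulr_suml.
rewrite Rint_sum => [|i]; last by apply: intg_itv; exact: intg_norm.
apply: ler_sum => i _; have [_ [lr _]] := h1 i.
rewrite primitiveB//.
have := Rint_norm_le (intg_itv `]l i, r i] ig); move=> /le_trans; apply.
rewrite le_eqVlt; apply/orP; left; apply/eqP; apply: eq_Rint => x.
by rewrite normrM ger0_norm// indic_itvE.
Qed.

Lemma scalar_acB a b v g : scalar_ac a b v -> scalar_ac a b g ->
  scalar_ac a b (fun x => v x - g x).
Proof.
move=> acv acg e e0; have e20 : 0 < e / 2 by rewrite divr_gt0.
have [d1 d10 h1] := acv _ e20; have [d2 d20 h2] := acg _ e20.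
exists (Num.min d1 d2) => [|m l r lr dis]; first by rewrite lt_min d10.
rewrite lt_min => /andP[s1 s2].
have := h1 m l r lr dis s1; have := h2 m l r lr dis s2.
suff : \sum_i `|v (r i) - g (r i) - (v (l i) - g (l i))| <=
    \sum_i `|v (r i) - v (l i)| + \sum_i `|g (r i) - g (l i)| by lra.
rewrite -big_split; apply: ler_sum => i _ /=.
by have := ler_normB (v (r i) - v (l i)) (g (r i) - g (l i));
  rewrite (_ : _ - _ - (_ - _) = v (r i) - g (r i) - (v (l i) - g (l i)))//; ring.
Qed.

(** The difference of [v] and the primitive of [dv] is absolutely continuous and has
    vanishing derivative almost everywhere. *)
Lemma scalar_ac_ftc a b v dv : a <= b -> scalar_ac a b v -> intg mu dv ->
  {ae mu, forall x, a < x < b -> is_derive x 1 v (dv x)} ->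
  v b - v a = primitive dv b - primitive dv a.
Proof.
move=> ab acv idv dvE.
suff : v b - primitive dv b = v a - primitive dv a by lra.
apply: (@scalar_ac_constant R a b (fun x => v x - primitive dv x)) => //.
  by apply: scalar_acB => //; exact: scalar_ac_primitive.
apply: aeS2 dvE (primitive_derivable idv) => x h1 [h2 h3] xab.
have h4 : is_derive x 1 (primitive dv) (dv x).
  by split; [exact: h2|rewrite -derive1E; exact: h3].
rewrite -(subrr (dv x)); have := h1 xab => h5.
exact: is_deriveB.
Qed.

(** An interval of times is mapped by [z + k0 * t] to an interval whose length depends on
    neither [s] nor [z]. *)
Lemma small_affine g (k0 : R) e : intg mu g -> k0 != 0 -> 0 < e ->
  exists2 h : R, 0 < h & forall s z,
    \int[mu]_t (\1_(`[s, s + h]%classic) t * `|g (z + k0 * t)|) < e.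
Proof.
move=> ig k00 e0; have k1 : 0 < `|k0| by rewrite normr_gt0.
have [d d0 hd] := intg_small ig (mulr_gt0 e0 k1).
pose h := d / (4 * `|k0|); have h0 : 0 < h by rewrite divr_gt0 ?mulr_gt0.
exists h => // s z; pose c := z + k0 * s; pose w := `|k0| * h.
pose J := `[c - w, c + w]%classic.
have wd : c + w - (c - w) < d.
  have -> : c + w - (c - w) = d / 2 by rewrite /w /h; field; rewrite gt_eqF.
  lra.
have iJ : intg mu (fun y => \1_J y * `|g y|) by apply: intg_itv; exact: intg_norm.
apply: (@le_lt_trans _ _ (\int[mu]_t (\1_J (z + k0 * t) * `|g (z + k0 * t)|))).
  apply: Rint_le => [| |t].
  - by apply: intg_itv; apply: intg_norm; exact: intg_affine.
  - exact: (intg_affine z k00 iJ).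
  - rewrite ler_wpM2r// !indic_itvE !in_itv /= .
    have [/andP[st th]|_] := boolP (s <= t <= s + h); last exact: ler0n.
    suff /ler_normlP[J1 J2] : `|k0 * (t - s)| <= w.
      by have -> : c - w <= z + k0 * t <= c + w by apply/andP; split; rewrite /c; lra.
    by rewrite normrM /w ler_wpM2l// ger0_norm; lra.
rewrite (Rint_affine z k00 iJ) normfV -[X in _ < X]mulr1 -(mulfV (lt0r_neq0 k1)).
by rewrite [X in _ < X]mulrA mulrC ltr_pM2r ?invr_gt0// hd.
Qed.

End absolute_continuity_primitive.

(** * Continuity of translations in the mean *)

Section translations.
Context {R : realType}.
Local Notation mu := (lebesgue1 R).
Local Notation Rm := (measurableTypeR R).
Implicit Types (g k : R -> R) (a b x y z e h N : R).

Lemma cvg_of_seq (f : R -> R) (p l : R) :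
  (forall u : nat -> R, u j @[j --> \oo] --> p -> f (u j) @[j --> \oo] --> l) ->
  f x @[x --> p] --> l.
Proof. by move=> h; apply/(@cvg_nbhsP R R^o). Qed.

Lemma intg_shift g h : intg mu g -> intg mu (fun x => g (x + h)).
Proof.
move=> ig; apply: intg_ext (intg_affine h (oner_neq0 R) ig) => x /=.
by rewrite mul1r addrC.
Qed.

Lemma Rint_shift g h : intg mu g -> \int[mu]_x g (x + h) = \int[mu]_x g x.
Proof.
move=> ig; rewrite -[RHS]mul1r -[X in X * _](normr1 R) -[X in `|X|]invr1.
rewrite -(Rint_affine h (oner_neq0 R) ig); apply: eq_Rint => x.
by rewrite mul1r addrC.
Qed.

Let cutoff N x : R := (\1_(`[- N, N]%classic) x).

Lemma Rint_tail g e : intg mu g -> 0 < e ->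
  exists N, \int[mu]_x ((1 - cutoff N x) * `|g x|) < e.
Proof.
move=> ig e0.
have mg := intg_measurable ig.
have cutoff01 N x : `|1 - cutoff N x| <= 1.
  by rewrite /cutoff indic_itvE; case: (_ \in _); rewrite ?subrr ?normr0// subr0 normr1.
have : \int[mu]_x ((1 - cutoff j%:R x) * `|g x|) @[j --> \oo] -->
    \int[mu]_x (0 : R).
  apply: (Rint_dominated (m := mu)
    (f_ := fun j x => (1 - cutoff j%:R x) * `|g x|) (f := fun=> 0)
    (g := fun x => `|g x|)).
  - move=> j; meas; apply: measurableT_comp => //.
  - by meas.
  - exact: intg_norm.
  - by move=> j; apply: aeW => x; rewrite normrM normr_id ler_piMl.
  - apply: aeW => x; apply: cvg_near_cst; near=> j.
    rewrite /cutoff indic_itvE in_itv /=.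
    suff -> : - j%:R <= x <= j%:R by rewrite subrr mul0r.
    rewrite -ler_norml; near: j; exact: nbhs_infty_ger.
rewrite /Rintegral integral0 => /cvgrPdist_lt /(_ _ e0) [j _ /(_ j (leqnn _))].
rewrite sub0r normrN => h; exists j%:R; exact: le_lt_trans (ler_norm _) h.
Unshelve. all: by end_near. Qed.

(** Cut off the tail of [g], then approximate what remains on a bounded interval. *)
Lemma continuous_approx g e : intg mu g -> 0 < e -> exists k N,
  [/\ continuous k, intg mu (fun x => cutoff N x * k x) &
      \int[mu]_x `|g x - cutoff N x * k x| < e].
Proof.
move=> ig e0; have e2 : 0 < e / 2 by rewrite divr_gt0.
have [N tail] := Rint_tail ig e2.
have foo : (mu (`[(- N)%R, N]%classic : set Rm) < +oo)%E.
  rewrite [X in (X < _)%E](lebesgue_measure_itv `[- N, N]) /=.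
  by case: ifP => _; rewrite ?ltry// -EFinB ltry.
have iEg : mu.-integrable (`[(- N)%R, N]%classic : set Rm) (EFin \o g).
  by apply: integrableS ig => //; exact: measurable_itvR.
have [k_ [ck ik]] := approximation_continuous_integrable
  (measurable_itvR `[- N, N]) foo iEg.
move=> /fine_cvgP[_ /cvgrPdist_lt /(_ _ e2) [j _ /(_ j (leqnn _))]].
rewrite /= sub0r normrN => kj.
have ikj := intg_continuous_itv (- N) N (ck j).
exists (k_ j), N; split => //.
have iN : intg mu (fun x => cutoff N x * `|g x - k_ j x|).
  apply: intg_ext (intg_norm (intgB (intg_itv `[- N, N] ig) ikj)) => x.
  by rewrite -mulrBr normrM /cutoff indic_itvE ger0_norm.
have iC : intg mu (fun x => (1 - cutoff N x) * `|g x|).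
  apply: intg_ext (intgB (intg_norm ig) (intg_itv `[- N, N] (intg_norm ig))) => x.
  by rewrite mulrBl mul1r.
apply: (@le_lt_trans _ _ (\int[mu]_x ((1 - cutoff N x) * `|g x| +
    cutoff N x * `|g x - k_ j x|))).
  apply: Rint_le => [| |x]; first exact/intg_norm/intgB.
    exact: intgD.
  rewrite /cutoff indic_itvE; case: (_ \in _).
    by rewrite !mul1r subrr mul0r add0r.
  by rewrite !mul0r subr0 subr0 mul1r addr0.
rewrite RintD//.
have : \int[mu]_x (cutoff N x * `|g x - k_ j x|) < e / 2; last by lra.
rewrite -Rint_indic; apply: le_lt_trans (ler_norm _) _; exact: kj.
Qed.

(** Dominated convergence: off the two points [- N] and [N] the truncated function is
    continuous, and translates by a bounded amount vanish off one bounded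
    interval. *)
Lemma translation_cutoff k N : continuous k ->
  intg mu (fun x => cutoff N x * k x) ->
  \int[mu]_x `|cutoff N (x + h) * k (x + h) - cutoff N x * k x|
    @[h --> (0 : R)] --> (0 : R).
Proof.
move=> ck ik; set f := (fun x => cutoff N x * k x).
apply: cvg_of_seq => h_ h0.
have [H H0 hH] : exists2 H : R, 0 <= H & forall j, `|h_ j| <= H.
  have /cvg_seq_bounded[M [_ hM]] : cvgn h_ by apply/cvg_ex; exists 0.
  exists (`|M| + 1); first by rewrite addr_ge0.
  by move=> j; apply: hM => //; rewrite (le_lt_trans (ler_norm _))// ltrDl.
have [M M0 hM] := continuous_bounded_itv (- N) N ck.
have fM x : `|f x| <= M * cutoff N x.
  rewrite /f /cutoff indic_itvE in_itv /=.
  have [/hM|_] := boolP (- N <= x <= N); first by rewrite mul1r mulr1.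
  by rewrite mul0r mulr0 normr0.
have -> : (0 : R) = \int[mu]_x (0 : R) by rewrite /Rintegral integral0.
apply: (Rint_dominated (m := mu)
  (f_ := fun j x => `|f (x + h_ j) - f x|) (f := fun=> 0)
  (g := fun x => 2 * M * cutoff (N + H) x)).
- move=> j; apply: measurableT_comp => //; apply: measurable_funB.
    exact: intg_measurable (intg_shift (h_ j) ik).
  exact: intg_measurable ik.
- by meas.
- exact/intgZ/intg_indic_itv.
- move=> j; apply: aeW => x; rewrite normr_id.
  apply: le_trans (ler_normB _ _) _.
  have := fM (x + h_ j); have := fM x; rewrite /f.
  have := hH j; rewrite ler_norml => /andP[hj1 hj2].
  rewrite /cutoff !indic_itvE !in_itv /=.
  have [/andP[xN1 xN2]|xN] := boolP (- (N + H) <= x <= N + H).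
    have le1 (b : bool) : M * b%:R <= M by case: b; rewrite ?mulr1 ?mulr0.
    by move=> h1 h2; have := le1 (- N <= x <= N); have := le1 (- N <= x + h_ j <= N);
      rewrite mulr1; lra.
  have -> : (- N <= x <= N) = false.
    by apply/negP => /andP[? ?]; move/negP: xN; apply; apply/andP; split; lra.
  have -> : (- N <= x + h_ j <= N) = false.
    by apply/negP => /andP[? ?]; move/negP: xN; apply; apply/andP; split; lra.
  by rewrite !mulr0 => h1 h2; lra.
- have nN a : {ae mu, forall x, x != a}.
    exists [set a]; split => //; first exact: lebesgue_measure_set1.
    by move=> x /= /negP; rewrite negbK => /eqP.
  apply: aeS2 (nN N) (nN (- N)) => x xN xNN.
  have fx : {for x, continuous f}.
    have [/andP[l1 l2]|] := boolP (- N < x < N).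
      have : k y @[y --> x] --> f x.
        rewrite /f /cutoff indic_itvE in_itv /= !ltW// mul1r; exact: ck.
      apply: cvg_trans; apply: near_eq_cvg; near=> y.
      rewrite /f /cutoff indic_itvE in_itv /=.
      have -> : - N <= y by apply/ltW; near: y; exact: lt_nbhsr.
      have -> : y <= N by apply/ltW; near: y; exact: lt_nbhsl.
      by rewrite mul1r.
    rewrite negb_and -!leNgt => xo.
    have {}xo : x < - N \/ N < x.
      by case/orP: xo => x3; [left|right]; rewrite lt_neqAle x3 andbT// eq_sym.
    have f0 y : y < - N \/ N < y -> f y = 0.
      move=> yN; rewrite /f /cutoff indic_itvE in_itv /=.
      suff -> : (- N <= y <= N) = false by rewrite mul0r.
      by case: yN => yN; rewrite !leNgt yN ?andbF.
    have : (0 : R) @[y --> x] --> f x by rewrite (f0 _ xo); exact: cvg_cst.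
    apply: cvg_trans; apply: near_eq_cvg.
    case: xo => x3.
      have := lt_nbhsl x3; apply: filterS => y yN.
      by rewrite f0//; left.
    have := lt_nbhsr x3; apply: filterS => y yN.
    by rewrite f0//; right.
  have : f (x + h_ j) @[j --> \oo] --> f x.
    apply: continuous_cvg; first exact: fx.
    by rewrite -[X in _ --> X]addr0; apply: cvgD => //; exact: cvg_cst.
  move=> /cvgrPdist_lt ff; apply/cvgrPdist_lt => e e0.
  apply: filterS (ff e e0) => j.
  by rewrite sub0r normrN normr_id distrC.
Unshelve. all: by end_near. Qed.

(** A translation does not change integrals, so that the error of an approximation of [g]
    by truncated continuous functions enters twice. *)
Lemma translation_L1 g : intg mu g ->
  \int[mu]_x `|g (x + h) - g x| @[h --> (0 : R)] --> (0 : R).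
Proof.
move=> ig; apply/cvgrPdist_lt => e e0.
have e3 : 0 < e / 3 by rewrite divr_gt0.
have [k [N [ck ik gk]]] := continuous_approx ig e3.
have /cvgrPdist_lt/(_ _ e3) := translation_cutoff ck ik.
apply: filterS => h; set f := (fun x => cutoff N x * k x) in ik gk *.
rewrite !sub0r !normrN => /(le_lt_trans (ler_norm _)) fh.
rewrite ger0_norm; last by apply: Rint_ge0.
have ifh := intg_shift h ik; have igh := intg_shift h ig.
have id1 : intg mu (fun x => `|g (x + h) - f (x + h)|) by exact/intg_norm/intgB.
have id2 : intg mu (fun x => `|f (x + h) - f x|) by exact/intg_norm/intgB.
have id3 : intg mu (fun x => `|g x - f x|) by exact/intg_norm/intgB.
apply: (@le_lt_trans _ _ (\int[mu]_x (`|g (x + h) - f (x + h)| +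
    `|f (x + h) - f x| + `|g x - f x|))).
  apply: Rint_le => [| |x]; first exact/intg_norm/intgB.
    by apply: intgD => //; exact: intgD.
  have := ler_normD (g (x + h) - f (x + h)) (f (x + h) - f x).
  have := ler_normB (g (x + h) - f (x + h) + (f (x + h) - f x)) (g x - f x).
  rewrite [X in `|X|](_ : _ = g (x + h) - g x); last by ring.
  by lra.
rewrite RintD//; last exact: intgD.
rewrite RintD//.
have := Rint_shift h (intg_norm (intgB ig ik)) => ->.
by move: fh gk; rewrite /f; lra.
Qed.

End translations.

(** * Integrals along characteristics *)

Section characteristics.
Context {R : realType}.
Local Notation mu := (lebesgue1 R).
Local Notation mu2 := (lebesgue2 R).
Local Notation Rm := (measurableTypeR R).
Implicit Types (F G H : R * R -> R) (g r : R -> R) (c t x z s : R).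

(** The integral of the source along the characteristic [x + c t = const] through the
    point, from time zero on. *)
Definition duhamel c F (p : R * R) : R :=
  \int[mu]_s ((0 <= s <= p.1)%R%:R * F (s, p.2 + c * (p.1 - s))).

(** This depends on the characteristic alone, and it bounds the Duhamel integrals at all
    times on it; it is integrable in [z] by Fubini's theorem. *)
Definition charmass c F z : R := \int[mu]_s `|F (s, z - c * s)|.

Lemma scales_char c :
  scales mu2 mu2 1%:nng (fun p : Rm * Rm => (p.1, p.2 - c * p.1 : Rm)).
Proof.
have mg : measurable_fun setT (fun t : Rm => - (c * t) : R) by meas.
have := scales_shear mg (normr1 R).
by under eq_fun do rewrite mul1r addrC.
Qed.

Lemma intg_char c F : intg mu2 F -> intg mu2 (fun p => F (p.1, p.2 - c * p.1)).
Proof. by move/(scales_intg (scales_char c)). Qed.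

Lemma Rint_char c F : intg mu2 F ->
  \int[mu2]_p F (p.1, p.2 - c * p.1) = \int[mu2]_p F p.
Proof.
by move/(scales_Rint (scales_char c)) => ->; rewrite mul1r.
Qed.

(** Characteristics are the lines of constant second coordinate in the plane sheared by
    [scales_char]. *)
Lemma ae_char c (P : R * R -> Prop) : {ae mu2, forall p, P p} ->
  {ae mu, forall z, {ae mu, forall s, P (s, z - c * s)}}.
Proof. by move/(scales_ae (scales_char c))/ae_ysection. Qed.

Lemma measurable_char c F z : measurable_fun setT (F : Rm * Rm -> R) ->
  measurable_fun setT (fun s : Rm => F (s, z - c * s)).
Proof.
move=> mF; apply: (measurableT_comp mF).
apply: measurable_fun_pair; first exact: measurable_id.
by apply: measurable_toRm; meas.
Qed.

Lemma intg_char_ae c F : intg mu2 F ->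
  {ae mu, forall z, intg mu (fun s => F (s, z - c * s))}.
Proof. by move/(intg_char c)/intg_ysection. Qed.

Lemma intg_charmass c F : intg mu2 F -> intg mu (charmass c F).
Proof. by move/intg_norm/(intg_char c)/intg_fubiniC. Qed.

Lemma Rint_charmass c F : intg mu2 F ->
  \int[mu]_z charmass c F z = \int[mu2]_p `|F p|.
Proof.
move=> iF; rewrite -(Rint_char c (intg_norm iF)) Rint_fubiniC//.
exact: (intg_char c (intg_norm iF)).
Qed.

Lemma charmass_ge0 c F z : 0 <= charmass c F z.
Proof. by apply: Rint_ge0. Qed.

Lemma measurable_duhamel c F : measurable_fun setT (F : Rm * Rm -> R) ->
  measurable_fun setT (duhamel c F : Rm * Rm -> R).
Proof.
move=> mF.
apply: (measurable_Rint (f := fun q : (Rm * Rm) * Rm =>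
  (0 <= q.2 <= q.1.1)%R%:R * F (q.2, q.1.2 + c * (q.1.1 - q.2)))).
have m2 : measurable_fun setT (fun q : (Rm * Rm) * Rm => q.2 : R).
  exact: (measurableT_comp measurable_idR measurable_snd).
have m11 : measurable_fun setT (fun q : (Rm * Rm) * Rm => q.1.1 : R).
  exact: (measurableT_comp measurable_fstR measurable_fst).
have m12 : measurable_fun setT (fun q : (Rm * Rm) * Rm => q.1.2 : R).
  exact: (measurableT_comp measurable_sndR measurable_fst).
apply: measurable_funM; first by meas.
apply: (measurableT_comp mF); apply: measurable_fun_pair.
  exact: measurable_snd.
by apply: measurable_toRm; meas.
Qed.

Lemma duhamel_charE c F t z :
  duhamel c F (t, z - c * t) =
  \int[mu]_s ((0 <= s <= t)%R%:R * F (s, z - c * s)).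
Proof. by apply: eq_Rint => s /=; congr (_ * F (_, _)); ring. Qed.

Lemma measurable_char_itv c F z t : measurable_fun setT (F : Rm * Rm -> R) ->
  measurable_fun setT (fun s : Rm => (0 <= s <= t)%R%:R * F (s, z - c * s)).
Proof.
by move=> mF; apply: measurable_funM; [meas|exact: measurable_char].
Qed.

(** The bound by [H] holds almost everywhere on almost every characteristic, and the
    integral over the part of it before [t] is dominated by the integral over all of
    it, whatever [t] is.  Keeping all times on one characteristic is essential: the
    exceptional set must not depend on [t]. *)
Lemma duhamel_bound c F H : measurable_fun setT (F : Rm * Rm -> R) ->
  intg mu2 H -> {ae mu2, forall p, `|F p| <= H p} ->
  {ae mu, forall z, forall t, `|duhamel c F (t, z - c * t)| <=
                              \int[mu]_s H (s, z - c * s)}.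
Proof.
move=> mF iH FH.
apply: aeS2 (ae_char c FH) (intg_char_ae c iH) => z FHz iHz t.
rewrite duhamel_charE; apply: Rint_bound_ae => //.
  exact: measurable_char_itv.
by apply: aeS FHz => s FHs; apply: le_trans (norm_bool_le _ _) FHs.
Qed.

Lemma duhamel_le_charmass c F : intg mu2 F ->
  {ae mu, forall z, forall t, `|duhamel c F (t, z - c * t)| <= charmass c F z}.
Proof.
move=> iF; apply: (@duhamel_bound c F (fun p => `|F p|)) => //.
- exact: intg_measurable iF.
- exact: intg_norm.
- exact: aeW.
Qed.

(** Causality: only the source before time [T] matters up to time [T]. *)
Lemma duhamel_local c F G T : measurable_fun setT (F : Rm * Rm -> R) ->
  measurable_fun setT (G : Rm * Rm -> R) ->
  {ae mu2, forall p, p.1 <= T -> F p = G p} ->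
  {ae mu, forall z, forall t, t <= T ->
    duhamel c F (t, z - c * t) = duhamel c G (t, z - c * t)}.
Proof.
move=> mF mG FG; apply: aeS (ae_char c FG) => z FGz t tT.
rewrite !duhamel_charE; apply: Rint_ae_eq; [exact: measurable_char_itv..|].
apply: aeS FGz => s /= FGs; have [/andP[s0 st]|_] := boolP (0 <= s <= t).
  by rewrite FGs// (le_trans st).
by rewrite !mul0r.
Qed.

Lemma ae_snd (P : R -> Prop) : {ae mu, forall z, P z} ->
  {ae mu2, forall p, P p.2}.
Proof.
move=> [N [mN N0 PN]]; exists ([set: Rm] `*` N); split.
- exact: measurableX.
- by rewrite product_measure1E// [X in (_ * X)%E]N0 mule0.
- by move=> p /= Pp; split => //; exact: PN.
Qed.

(** A null set of characteristics covers a null set of points, by the shear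
    [scales_char]. *)
Lemma ae_char_points c (Q : R -> R -> Prop) :
  {ae mu, forall z, forall t, Q t (z - c * t)} ->
  {ae mu2, forall p, Q p.1 p.2}.
Proof.
move=> aQ; have := scales_ae (scales_char (- c)) (ae_snd aQ).
apply: aeS => p /= /(_ p.1).
by rewrite (_ : p.2 - - c * p.1 - c * p.1 = p.2)//; ring.
Qed.

(** At a fixed time the foot [x + c * t] runs through the line by a translation. *)
Lemma duhamel_ae_x c t (P : R -> R -> Prop) :
  {ae mu, forall z, P z (z - c * t)} -> {ae mu, forall x, P (x + c * t) x}.
Proof.
move/(scales_ae (scales_affine (c * t) (oner_neq0 R))); apply: aeS => x.
by rewrite mul1r addrC addrK.
Qed.

(** At each fixed time the Duhamel integral is, after a translation, dominated by
    [charmass]. *)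
Lemma intg_duhamel c F t : intg mu2 F ->
  intg mu (fun x => duhamel c F (t, x)) /\
  \int[mu]_x `|duhamel c F (t, x)| <= \int[mu2]_p `|F p|.
Proof.
move=> iF; have mF := intg_measurable iF.
have iC := intg_shift (c * t) (intg_charmass c iF).
have bound : {ae mu, forall x, `|duhamel c F (t, x)| <= charmass c F (x + c * t)}.
  apply: (@duhamel_ae_x c t (fun z x => `|duhamel c F (t, x)| <= charmass c F z)).
  by apply: aeS (duhamel_le_charmass c iF) => z /(_ t).
have mD : measurable_fun setT (fun x : Rm => duhamel c F (t, x)).
  exact: (measurableT_comp (measurable_duhamel c mF) (pair1_measurable t)).
have iD := intg_le_ae mD iC bound.
split => //; rewrite -(Rint_charmass c iF) -(Rint_shift (c * t) (intg_charmass c iF)).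
by apply: Rint_le_ae => //; exact: intg_norm.
Qed.

Lemma intg_timemass F : intg mu2 F -> intg mu (fun s => \int[mu]_x `|F (s, x)|).
Proof. by move/intg_norm/intg_fubini. Qed.

(** Fubini's theorem for the slab, first along characteristics and then along
    lines of constant time. *)
Lemma Rint_slab c F a b : intg mu2 F ->
  intg mu (fun z => \int[mu]_s (\1_(`[a, b]%classic) s * `|F (s, z - c * s)|)) /\
  \int[mu]_z \int[mu]_s (\1_(`[a, b]%classic) s * `|F (s, z - c * s)|) =
  \int[mu]_s (\1_(`[a, b]%classic) s * \int[mu]_x `|F (s, x)|).
Proof.
move=> iF; pose Fab (p : R * R) := \1_(`[a, b]%classic) p.1 * `|F p|.
have iFab : intg mu2 Fab.
  apply: (intg_le _ (intg_norm iF)).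
    apply: measurable_funM.
      exact: (measurableT_comp (measurable_indic_itv _) measurable_fst).
    exact: intg_measurable (intg_norm iF).
  by move=> p; rewrite /Fab indic_itvE -[X in _ <= X]normr_id; exact: norm_bool_le.
have iC := intg_char c iFab.
split; first exact: (intg_fubiniC iC).
rewrite -(Rint_fubiniC iC) (Rint_char c iFab) Rint_fubini//.
apply: (@Rint_ae_eq _ _ _ mu); first exact: intg_measurable (intg_fubini iFab).
  exact: intg_measurable (intg_itv _ (intg_timemass iF)).
apply: aeS (intg_xsection (intg_norm iF)) => s iFs.
by rewrite -RintZ.
Qed.

(** On one characteristic the difference is the integral of the source between the two
    times; integrating over all characteristics collects the mass of the slab. *)
Lemma duhamel_time c F a b : intg mu2 F -> 0 <= a -> a <= b ->
  \int[mu]_z `|duhamel c F (b, z - c * b) - duhamel c F (a, z - c * a)| <=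
  \int[mu]_s (\1_(`[a, b]%classic) s * \int[mu]_x `|F (s, x)|).
Proof.
move=> iF a0 ab; have [iS <-] := Rint_slab c a b iF.
have iD t : intg mu (fun z => duhamel c F (t, z - c * t)).
  exact: (intg_shift (- (c * t)) (intg_duhamel c t iF).1).
apply: Rint_le_ae => //; first exact/intg_norm/intgB.
apply: aeS (intg_char_ae c iF) => z iFz; rewrite !duhamel_charE.
have ib t : intg mu (fun s => (0 <= s <= t)%R%:R * F (s, z - c * s)).
  by apply: intg_ext (intg_itv `[0, t] iFz) => s; rewrite indic_itvE in_itv.
rewrite -RintB//; apply: Rint_bound_ae.
- exact: intg_measurable (intgB (ib b) (ib a)).
- exact/intg_itv/intg_norm.
apply: aeW => s; rewrite -mulrBl normrM ler_wpM2r// indic_itvE in_itv /=.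
case: (leP 0 s) (leP s b) (leP s a) (leP a s) => [h1|h1] [h2|h2] [h3|h3] [h4|h4];
  rewrite /= ?subrr ?normr0 ?subr0 ?normr1//; lra.
Qed.

End characteristics.

(** * Integrals over backward triangles *)

Section potentials.
Context {R : realType}.
Local Notation mu := (lebesgue1 R).
Local Notation mu2 := (lebesgue2 R).
Local Notation Rm := (measurableTypeR R).
Implicit Types (F G H : R * R -> R) (g r : R -> R) (c t x y z s a b d e : R).

(** The backward triangle as a truth value.  The bound [p.1 <= t] is a consequence of the
    last two inequalities. *)
Definition in_tri t x (p : R * R) : bool :=
  [&& 0 <= p.1, p.2 + p.1 <= x + t & x - t <= p.2 - p.1].

Lemma triangleE t x p : triangle t x p <-> in_tri t x p.
Proof.
rewrite /triangle /in_tri /=; split.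
  by move=> [/andP[h1 h2] /andP[h3 h4]]; apply/and3P; split; lra.
by move=> /and3P[h1 h2 h3]; split; apply/andP; split; lra.
Qed.

Lemma measurable_in_tri t x : measurable_fun setT (in_tri t x : Rm * Rm -> bool).
Proof. by rewrite /in_tri; meas. Qed.

Lemma measurable_cone c t x : measurable_fun setT (fun q : Rm * Rm =>
  [&& 0 <= q.1, 0 <= c * (q.2 - x) & q.1 + c * (q.2 - x) <= t]).
Proof. by meas. Qed.

Lemma measurable_band c t a b : measurable_fun setT (fun q : Rm * Rm =>
  [&& 0 <= q.1, q.1 <= t & a <= q.2 - c * (t - q.1) <= b]).
Proof. by meas. Qed.

Lemma measurable_strip c a b : measurable_fun setT (fun q : Rm * Rm =>
  a <= q.2 + c * q.1 <= b).
Proof. by meas. Qed.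

(** The solution of the wave equation with vanishing data and source [F]. *)
Definition potential F (p : R * R) : R :=
  2^-1 * \int[mu2]_q ((in_tri p.1 p.2 q)%:R * F q).

Lemma intg_bool (b : R * R -> bool) F :
  measurable_fun setT (b : Rm * Rm -> bool) ->
  intg mu2 F -> intg mu2 (fun q => (b q)%:R * F q).
Proof.
move=> mb iF; apply: (intg_le _ (intg_norm iF)).
  by apply: measurable_funM; [apply: measurable_bool|exact: intg_measurable iF].
by move=> q; exact: norm_bool_le.
Qed.

Lemma potential_bound F H p : measurable_fun setT (F : Rm * Rm -> R) ->
  intg mu2 H -> {ae mu2, forall p, `|F p| <= H p} ->
  `|potential F p| <= 2^-1 * \int[mu2]_q H q.
Proof.
move=> mF iH FH; rewrite /potential normrM ger0_norm ?invr_ge0//.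
rewrite ler_wpM2l ?invr_ge0//; apply: Rint_bound_ae => //.
  apply: measurable_funM => //; apply: measurable_bool => //.
  exact: measurable_in_tri.
by apply: aeS FH => q; apply: le_trans; exact: norm_bool_le.
Qed.

Lemma potential_local F G T p : measurable_fun setT (F : Rm * Rm -> R) ->
  measurable_fun setT (G : Rm * Rm -> R) ->
  {ae mu2, forall q, q.1 <= T -> F q = G q} -> p.1 <= T ->
  potential F p = potential G p.
Proof.
move=> mF mG FG pT; congr (_ * _).
have mT := measurable_bool (R := R) measurableT (measurable_in_tri p.1 p.2).
apply: Rint_ae_eq; [exact: measurable_funM..|].
apply: aeS FG => q FGq; have [/and3P[q1 q2 q3]|_] := boolP (in_tri _ _ _).
  by rewrite FGq// (le_trans _ pT)//; lra.
by rewrite !mul0r.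
Qed.

Lemma sqr1_norm c : c * c = 1 -> `|c| = 1.
Proof.
move=> cc; apply/eqP; rewrite -(eqrXn2 (n := 2))// expr1n.
by rewrite -normrX expr2 cc normr1.
Qed.

(** The cone swept by the characteristics of speed [c] issued upwards from the
    source to the vertical segment below [(t, x)]: one half of the triangle. *)
Lemma Rint_duhamel_time c F t x : c * c = 1 -> intg mu2 F ->
  intg mu (fun s => \1_(`[0, t]%classic) s * duhamel c F (s, x)) /\
  \int[mu]_s (\1_(`[0, t]%classic) s * duhamel c F (s, x)) =
  \int[mu2]_q ([&& 0 <= q.1, 0 <= c * (q.2 - x) &
                   q.1 + c * (q.2 - x) <= t]%:R * F q).
Proof.
move=> cc iF.
pose b (q : R * R) := [&& 0 <= q.1, 0 <= c * (q.2 - x) & q.1 + c * (q.2 - x) <= t].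
have mb : measurable_fun setT (b : Rm * Rm -> bool) := measurable_cone c t x.
have ib := intg_bool mb iF.
have mg : measurable_fun setT (fun s : Rm => x - c * s : R) by meas.
have sc := scales_shear mg (sqr1_norm cc).
have iK := scales_intg sc ib.
pose K (p : R * R) := (b p)%:R * F p.
have KE s : \int[mu]_q K (q, x - c * q + c * s) =
    \1_(`[0, t]%classic) s * duhamel c F (s, x).
  rewrite indic_itvE in_itv /= /duhamel /K /b /=.
  have E q : c * (x - c * q + c * s - x) = s - q.
    by rewrite (_ : x - c * q + c * s - x = c * (s - q)) ?mulrA ?cc ?mul1r//; ring.
  have [/andP[s0 st]|nst] := boolP (0 <= s <= t).
    rewrite mul1r; apply: eq_Rint => q; rewrite E.
    congr (_%:R * F (_, _)); last by rewrite mulrBr addrA addrAC -addrA; ring.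
    by rewrite subr_ge0 addrC subrK st andbT.
  rewrite mul0r (_ : (fun q => _) = fun=> 0); first by rewrite /Rintegral integral0.
  apply/funext => q; rewrite E subr_ge0 addrC subrK.
  case: (boolP [&& _, _ & _]); last by rewrite mul0r.
  move=> /and3P[q0 qs st]; move/negP: nst; case.
  by rewrite st (le_trans q0 qs).
split.
  by apply: intg_ext (intg_fubiniC iK) => s; rewrite -KE.
transitivity (\int[mu]_s \int[mu]_q K (q, x - c * q + c * s)).
  by apply: eq_Rint => s; rewrite KE.
rewrite -(Rint_fubiniC iK).
by have := scales_Rint sc ib; rewrite mul1r => ->.
Qed.

Lemma in_tri_split t x s y : y != x ->
  (in_tri t x (s, y))%:R =
  [&& 0 <= s, 0 <= 1 * (y - x) & s + 1 * (y - x) <= t]%:R +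
  [&& 0 <= s, 0 <= -1 * (y - x) & s + -1 * (y - x) <= t]%:R :> R.
Proof.
rewrite /in_tri /= !mul1r !mulN1r !opprB !subr_ge0 => yx.
have [xy|xy|E] := ltgtP x y; last by rewrite E eqxx in yx.
- rewrite andbF addr0; congr (nat_of_bool _)%:R.
  by case: (leP 0 s) => //= s0; apply/idP/idP => [/andP[]|h]; [|apply/andP; split]; lra.
- rewrite andbF add0r; congr (nat_of_bool _)%:R.
  by case: (leP 0 s) => //= s0; apply/idP/idP => [/andP[]|h]; [|apply/andP; split]; lra.
Qed.

(** The derivative in time: the triangle consists of the two cones of [Rint_duhamel_time],
    right and left of its axis [y = x], which is a null set. *)
Lemma potential_time F t x : 0 <= t -> intg mu2 F ->
  potential F (t, x) = \int[mu]_s (\1_(`[0, t]%classic) s *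
    (2^-1 * (duhamel 1 F (s, x) + duhamel (-1) F (s, x)))).
Proof.
move=> t0 iF.
have [i1 e1] := Rint_duhamel_time t x (mul1r 1) iF.
have [i2 e2] := Rint_duhamel_time t x (etrans (mulrNN 1 1) (mul1r 1)) iF.
transitivity (2^-1 * (\int[mu]_s (\1_(`[0, t]%classic) s * duhamel 1 F (s, x)) +
    \int[mu]_s (\1_(`[0, t]%classic) s * duhamel (-1) F (s, x)))); last first.
  rewrite -RintD// -RintZ; last exact: intgD.
  by apply: eq_Rint => s; ring.
congr (_ * _); rewrite e1 e2.
have ib c : intg mu2 (fun q => [&& 0 <= q.1, 0 <= c * (q.2 - x) &
    q.1 + c * (q.2 - x) <= t]%:R * F q).
  exact: (intg_bool (measurable_cone c t x) iF).
rewrite -RintD//; apply: Rint_ae_eq.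
- exact: intg_measurable (intg_bool (measurable_in_tri t x) iF).
- exact: intg_measurable (intgD (ib 1) (ib (-1))).
apply: aeS (ae_graph (measurable_cst x)) => -[s y] /= yx.
by rewrite -mulrDl -in_tri_split.
Qed.

(** The characteristics of speed [c] issued upwards from the source that reach the
    segment from [a] to [b] at time [t] fill a parallelogram. *)
Lemma Rint_duhamel_space c F t a b : intg mu2 F ->
  \int[mu]_y (\1_(`[a, b]%classic) y * duhamel c F (t, y)) =
  \int[mu2]_q (([&& 0 <= q.1, q.1 <= t &
                 a <= q.2 - c * (t - q.1) <= b])%:R * F q).
Proof.
move=> iF.
pose B (q : R * R) := [&& 0 <= q.1, q.1 <= t & a <= q.2 - c * (t - q.1) <= b].
have mB : measurable_fun setT (B : Rm * Rm -> bool) := measurable_band c t a b.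
have ib := intg_bool mB iF.
have mg : measurable_fun setT (fun s : Rm => c * (t - s) : R) by meas.
have sc := scales_shear mg (normr1 R).
have iK := scales_intg sc ib.
have := scales_Rint sc ib; rewrite mul1r => <-.
rewrite (Rint_fubiniC iK); apply: eq_Rint => y.
rewrite indic_itvE in_itv /= /B /=.
transitivity (\int[mu]_s ((a <= y <= b)%R%:R * ((0 <= s <= t)%R%:R * F (s, y + c * (t - s))))).
  by case: (a <= y <= b); rewrite /duhamel;
    [rewrite mul1r; apply: eq_Rint => s; rewrite mul1r
    |rewrite mul0r -[LHS](_ : \int[mu]_s (0 : R) = _);
      [by apply: eq_Rint => s; rewrite mul0r|by rewrite /Rintegral integral0]].
apply: eq_Rint => s; rewrite mulrA; congr (_ * F (_, _)); last by ring.
rewrite (_ : c * (t - s) + 1 * y - c * (t - s) = y); last by ring.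
by case: (a <= y); case: (y <= b); case: (0 <= s); case: (s <= t);
  rewrite /= ?mulr0 ?mul0r ?mulr1.
Qed.

(** When the apex moves from [a] to [b] the triangle gains the parallelogram along its
    right side and loses the one along its left side, up to boundaries. *)
Lemma in_tri_shift t a b s y : a <= b ->
  y != a + 1 * (t - s) -> y != b + 1 * (t - s) ->
  y != a + -1 * (t - s) -> y != b + -1 * (t - s) ->
  (in_tri t b (s, y))%:R - (in_tri t a (s, y))%:R =
  [&& 0 <= s, s <= t & a <= y - 1 * (t - s) <= b]%:R -
  [&& 0 <= s, s <= t & a <= y - -1 * (t - s) <= b]%:R :> R.
Proof.
move=> ab n3 n4 n1 n2; rewrite /in_tri /=.
have [s0|s0] := leP 0 s; last by rewrite !subrr.
have E u v : u <= v -> y != u -> y != v ->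
    (u <= y <= v)%R%:R = (y < v)%R%:R - (y < u)%R%:R :> R.
  move=> uv yu yv; case: (ltgtP y v) yv => //= yv _; case: (ltgtP u y) yu => //= uy _;
    rewrite ?subrr ?subr0//; lra.
have [st|st] := leP s t; last first.
  rewrite /= subrr; have F0 x : (y + s <= x + t) && (x - t <= y - s) = false.
    by apply/negP => /andP[h1 h2]; lra.
  by rewrite !F0 subrr.
rewrite /=.
have T x : (y + s <= x + t) && (x - t <= y - s) =
    (x + -1 * (t - s) <= y <= x + 1 * (t - s)).
  by apply/idP/idP => /andP[h1 h2]; apply/andP; split; lra.
have S c : (a <= y - c * (t - s) <= b) = (a + c * (t - s) <= y <= b + c * (t - s)).
  by rewrite lerBrDr lerBlDr.
by rewrite !T !S !E//; first ring; lra.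
Qed.

(** The derivative in space, from the gain and the loss in [in_tri_shift]. *)
Lemma potential_space F t a b : 0 <= t -> a <= b -> intg mu2 F ->
  potential F (t, b) - potential F (t, a) =
  \int[mu]_y (\1_(`[a, b]%classic) y *
    (2^-1 * (duhamel 1 F (t, y) - duhamel (-1) F (t, y)))).
Proof.
move=> t0 ab iF; have mF := intg_measurable iF.
have iD c := intg_itv `[a, b] (intg_duhamel c t iF).1.
transitivity (2^-1 * (\int[mu]_y (\1_(`[a, b]%classic) y * duhamel 1 F (t, y)) -
    \int[mu]_y (\1_(`[a, b]%classic) y * duhamel (-1) F (t, y)))); last first.
  rewrite -RintB// -RintZ; last exact: intgB.
  by apply: eq_Rint => y; ring.
rewrite !Rint_duhamel_space// -mulrBr; congr (_ * _).
have itri x := intg_bool (measurable_in_tri t x) iF.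
have ib c : intg mu2 (fun q => [&& 0 <= q.1, q.1 <= t &
    a <= q.2 - c * (t - q.1) <= b]%:R * F q).
  exact: (intg_bool (measurable_band c t a b) iF).
rewrite -!RintB//; apply: Rint_ae_eq.
- exact: intg_measurable (intgB (itri b) (itri a)).
- exact: intg_measurable (intgB (ib 1) (ib (-1))).
have g c x : {ae mu2, forall q, q.2 != x + c * (t - q.1)}.
  apply: (ae_graph (g := fun s => x + c * (t - s))); by meas.
have := aeS2 (fun q h1 h2 => conj h1 h2) (g 1 a) (g 1 b).
have := aeS2 (fun q h1 h2 => conj h1 h2) (g (-1) a) (g (-1) b).
apply: aeS2 => -[s y] /= [n1 n2] [n3 n4].
by rewrite -!mulrBl in_tri_shift.
Qed.

(** Two triangles with close apexes differ only in two thin characteristic strips. *)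
Lemma in_tri_stable (p q : R * R) s y d :
  `|p.1 - q.1| < d -> `|p.2 - q.2| < d ->
  `|(in_tri p.1 p.2 (s, y))%:R - (in_tri q.1 q.2 (s, y))%:R| <=
  (p.2 + p.1 - 2 * d <= y + 1 * s <= p.2 + p.1 + 2 * d)%R%:R +
  (p.2 - p.1 - 2 * d <= y + -1 * s <= p.2 - p.1 + 2 * d)%R%:R :> R.
Proof.
move=> q1 q2; rewrite /in_tri /=.
  move: q1 q2; rewrite !ltr_norml => /andP[q1 q1'] /andP[q2 q2'].
  have le1 (b b' : bool) : `|b%:R - b'%:R| <= 1 :> R.
    by case: b; case: b'; rewrite ?subrr ?subr0 ?sub0r ?normrN ?normr0 ?normr1.
  have [A|nA] := boolP (_ <= y + 1 * s <= _).
    by apply: le_trans (le1 _ _) _; rewrite lerDl ler0n.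
  have [B|nB] := boolP (_ <= y + -1 * s <= _).
    by apply: le_trans (le1 _ _) _; rewrite lerDr ler0n.
  rewrite addr0; have [s0|_] := leP 0 s; last by rewrite subrr normr0.
  suff -> : (y + s <= p.2 + p.1) && (p.2 - p.1 <= y - s) =
      (y + s <= q.2 + q.1) && (q.2 - q.1 <= y - s) by rewrite subrr normr0.
  have -> : (y + s <= p.2 + p.1) = (y + s <= q.2 + q.1).
    apply/idP/idP => h; rewrite leNgt; apply/negP => h'; move/negP: nA; apply;
      by apply/andP; split; lra.
  congr (_ && _).
  apply/idP/idP => h; rewrite leNgt; apply/negP => h'; move/negP: nB; apply;
    by apply/andP; split; lra.
Qed.

(** The mass of a thin characteristic strip is the integral of [charmass] over a short
    interval. *)
Lemma potential_continuous F : intg mu2 F -> continuous (potential F).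
Proof.
move=> iF p; apply/cvgrPdist_lt => e e0.
have [d1 d10 h1] := intg_small (intg_charmass 1 iF) e0.
have [d2 d20 h2] := intg_small (intg_charmass (-1) iF) e0.
(* The strips of [in_tri_stable] have width [4 * d], to be less than [d1] and [d2]. *)
pose d := Num.min d1 d2 / 5; have d0 : 0 < d by rewrite divr_gt0 ?lt_min ?d10.
have dd1 : 5 * d <= d1 by rewrite /d mulrCA mulfV// mulr1 ge_min lexx.
have dd2 : 5 * d <= d2 by rewrite /d mulrCA mulfV// mulr1 ge_min lexx orbT.
have strip c al h : c * c = 1 -> (forall a b, b - a < h ->
      \int[mu]_x (\1_(`[a, b]%classic) x * `|charmass c F x|) < e) -> 5 * d <= h ->
    intg mu2 (fun q => (al - 2 * d <= q.2 + c * q.1 <= al + 2 * d)%R%:R * `|F q|) /\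
    \int[mu2]_q ((al - 2 * d <= q.2 + c * q.1 <= al + 2 * d)%R%:R * `|F q|) < e.
  move=> cc hc hd.
  have ib : intg mu2 (fun q => (al - 2 * d <= q.2 + c * q.1 <= al + 2 * d)%R%:R * `|F q|).
    exact: (intg_bool (measurable_strip c _ _) (intg_norm iF)).
  split => //; have dh : (al + 2 * d) - (al - 2 * d) < h by lra.
  apply: le_lt_trans (hc _ _ dh).
  rewrite -(Rint_char c ib) (Rint_fubiniC (intg_char c ib)).
  rewrite le_eqVlt; apply/orP; left; apply/eqP.
  apply: Rint_ae_eq; first exact: intg_measurable (intg_fubiniC (intg_char c ib)).
    apply: measurable_funM; first by meas.
    apply: measurableT_comp => //; exact: intg_measurable (intg_charmass c iF).
  apply: aeS (intg_char_ae c iF) => z iFz.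
  rewrite ger0_norm ?charmass_ge0// indic_itvE in_itv /= -RintZ; last exact: intg_norm.
  by apply: eq_Rint => s /=; rewrite subrK.
have : nbhs p [set q | `|p.1 - q.1| < d /\ `|p.2 - q.2| < d].
  by apply/nbhs_ballP; exists d => //= q [].
apply: filterS => q [q1 q2].
have [i1 s1] := strip 1 (p.2 + p.1) d1 (mul1r 1) h1 dd1.
have [i2 s2] := strip (-1) (p.2 - p.1) d2 (etrans (mulrNN 1 1) (mul1r 1)) h2 dd2.
rewrite /potential -mulrBr normrM ger0_norm ?invr_ge0//.
have itri (o : R * R) := intg_bool (measurable_in_tri o.1 o.2) iF.
rewrite -RintB; [|exact: itri..].
suff : `|\int[mu2]_x ((in_tri p.1 p.2 x)%:R * F x - (in_tri q.1 q.2 x)%:R * F x)| < e + e.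
  by lra.
apply: le_lt_trans (ltrD s1 s2); rewrite -RintD//.
apply: Rint_bound_ae; last 1 first.
- apply: aeW => -[s y]; rewrite -mulrBl -mulrDl normrM ler_wpM2r//.
  exact: in_tri_stable.
- exact: intg_measurable (intgB (itri p) (itri q)).
- exact: intgD.
Qed.

End potentials.

(** * Weak derivatives from integrals on lines *)

Section weak_derivatives_from_lines.
Context {R : realType}.
Local Notation mu := (lebesgue1 R).
Local Notation mu2 := (lebesgue2 R).
Local Notation Rm := (measurableTypeR R).
Implicit Types (F G W phi : R * R -> R) (t x y s T M : R) (O : set (R * R)).

Lemma test_function_smooth O phi : test_function O phi ->
  [/\ continuous phi, continuous ('D_(dir_t : R * R) phi),
      continuous ('D_(dir_x : R * R) phi) &
      forall p, derivable phi p dir_t /\ derivable phi p dir_x].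
Proof.
move=> [sm _ _]; have [d1 c1 c2] := sm 1%N.
by split; [exact: (sm 0%N)|exact: c1|exact: c2|exact: d1].
Qed.

Let supp phi := closure [set p | phi p != 0].

Lemma derive_off_support phi (p e : R * R) : ~ supp phi p -> phi p = 0 /\ 'D_e phi p = 0.
Proof.
move=> np; split.
  by apply: contrapT => /eqP pp; apply: np; exact: subset_closure.
have np' : nbhs p [set q | phi q = 0].
  have oS : open (~` supp phi) by rewrite openC; exact: closed_closure.
  have := @open_nbhs_nbhs _ p _ (conj oS np); apply: filterS => q nq.
  by apply: contrapT => /eqP pp; apply: nq; exact: subset_closure.
rewrite (@near_eq_derive _ _ _ phi (cst 0) p e) ?derive_cst//.
Qed.

Lemma test_function_off O phi (p e : R * R) : test_function O phi -> ~ O p ->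
  phi p = 0 /\ 'D_e phi p = 0.
Proof. by move=> [_ _ sO] nO; apply: derive_off_support => /sO. Qed.

Lemma test_function_box O phi : test_function O phi -> exists2 M : R, 0 < M &
  forall p e : R * R, (M < `|p.1|) || (M < `|p.2|) -> phi p = 0 /\ 'D_e phi p = 0.
Proof.
move=> [_ cS _]; have /pinfty_ex_gt0[M M0 hM] := compact_bounded cS.
exists M => // p e pM; apply: derive_off_support => Sp.
have /= := hM p Sp; rewrite /Num.norm /= ge_max => /andP[p1 p2].
by case/orP: pM; rewrite ltNge ?p1 ?p2.
Qed.

Lemma bounded_of_box phi M : continuous phi ->
  (forall p, (M < `|p.1|) || (M < `|p.2|) -> phi p = 0) ->
  exists2 C : R, 0 <= C & forall p, `|phi p| <= C.
Proof.
move=> cphi off.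
have cB : compact (`[- M, M]%classic `*` `[- M, M]%classic : set (R * R)).
  by apply: compact_setX; exact: segment_compact.
have /compact_bounded/pinfty_ex_gt0[C C0 hC] :
    compact (phi @` (`[- M, M]%classic `*` `[- M, M]%classic)).
  by apply: continuous_compact => //; exact: continuous_subspaceT.
exists C; first exact: ltW.
move=> p; have [pM|] := boolP ((M < `|p.1|) || (M < `|p.2|)).
  by rewrite off// normr0 ltW.
rewrite negb_or -!leNgt => /andP[p1 p2]; apply: hC; exists p => //.
by split => /=; rewrite in_itv /= -ler_norml.
Qed.

Lemma is_derive_dir_t phi t x : derivable phi (t, x) dir_t ->
  is_derive t 1 (fun s => phi (s, x)) ('D_dir_t phi (t, x)).
Proof.
have E : (fun h : R => h^-1 *: (((fun s => phi (s, x)) \o shift t) (h *: 1) - phi (t, x)))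
    = (fun h : R => h^-1 *: ((phi \o shift (t, x)) (h *: (dir_t : R * R)) - phi (t, x))).
  apply/funext => h /=; congr (_ *: (phi _ - _)).
  rewrite /shift /= -[h *: dir_t + _]/(h *: 1 + t, h *: 0 + x).
  by rewrite scaler0 add0r.
by move=> dp; split; rewrite /derivable /derive E.
Qed.

Lemma is_derive_dir_x phi t x : derivable phi (t, x) dir_x ->
  is_derive x 1 (fun y => phi (t, y)) ('D_dir_x phi (t, x)).
Proof.
have E : (fun h : R => h^-1 *: (((fun s => phi (t, s)) \o shift x) (h *: 1) - phi (t, x)))
    = (fun h : R => h^-1 *: ((phi \o shift (t, x)) (h *: (dir_x : R * R)) - phi (t, x))).
  apply/funext => h /=; congr (_ *: (phi _ - _)).
  rewrite /shift /= -[h *: dir_x + _]/(h *: 0 + t, h *: 1 + x).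
  by rewrite scaler0 add0r.
by move=> dp; split; rewrite /derivable /derive E.
Qed.

Lemma continuous_vline phi t : continuous phi -> continuous (fun x => phi (t, x)).
Proof.
move=> cp x; have H : (t, y) @[y --> x] --> (t, x).
  exact: (@cvg_pair R R R (nbhs x) (nbhs t) (nbhs x) _ _ _ (fun=> t) id
    (cvg_cst _) cvg_id).
exact: (@continuous_comp _ _ _ (fun x => (t, x)) phi x H (cp (t, x))).
Qed.

Lemma continuous_hline phi x : continuous phi -> continuous (fun t => phi (t, x)).
Proof.
move=> cp t; have H : (s, x) @[s --> t] --> (t, x).
  exact: (@cvg_pair R R R (nbhs t) (nbhs t) (nbhs x) _ _ _ id (fun=> x)
    cvg_id (cvg_cst _)).
exact: (@continuous_comp _ _ _ (fun t => (t, x)) phi t H (cp (t, x))).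
Qed.

Lemma intg_continuous_box phi M : continuous phi ->
  (forall p, (M < `|p.1|) || (M < `|p.2|) -> phi p = 0) -> intg mu2 phi.
Proof.
move=> cphi off; have [C C0 hC] := bounded_of_box cphi off.
have iI := intg_indic_itv (- M) M.
apply: (intg_le _ (intgZ C (intg_prod iI iI))); first exact: continuous_measurable2.
move=> p; rewrite !indic_itvE !in_itv /= -!ler_norml.
have [pM|] := boolP ((M < `|p.1|) || (M < `|p.2|)).
  by rewrite off// normr0 !mulr_ge0.
by rewrite negb_or -!leNgt => /andP[-> ->]; rewrite !mulr1.
Qed.

Lemma intg_bounded_mul phi G C : measurable_fun setT (phi : Rm * Rm -> R) ->
  (forall p, `|phi p| <= C) -> intg mu2 G -> intg mu2 (fun p => phi p * G p).
Proof.
move=> mphi hC iG; apply: (intg_le _ (intgZ C (intg_norm iG))).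
  by apply: measurable_funM => //; exact: intg_measurable iG.
by move=> p; rewrite normrM ler_wpM2r.
Qed.

(** The support is compact and lies above the initial line.  [T] is larger than the bound
    of the support, so that test functions vanish also on the sides of the box, where
    the integration by parts has its boundary terms. *)
Lemma test_function_strip O phi W G : test_function O phi ->
  O `<=` [set p | 0 < p.1] -> continuous W ->
  (forall T, intg mu2 (fun p => \1_(`[0, T]%classic) p.1 * G p)) ->
  exists T, [/\ 0 < T,
    forall p e : R * R, [|| p.1 <= 0, T <= `|p.1| | T <= `|p.2|] ->
      phi p = 0 /\ 'D_e phi p = 0,
    intg mu2 (fun p => 'D_(dir_t : R * R) phi p * W p),
    intg mu2 (fun p => 'D_(dir_x : R * R) phi p * W p)
  & intg mu2 (fun p => phi p * G p)].
Proof.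
move=> tf O0 cW iG; have [cphi ct cx _] := test_function_smooth tf.
have [M M0 off] := test_function_box tf.
pose T := M + 1; have MT : M < T by rewrite ltrDl.
have offT (p e : R * R) : [|| p.1 <= 0, T <= `|p.1| | T <= `|p.2|] ->
    phi p = 0 /\ 'D_e phi p = 0.
  case/or3P => h.
  - by apply: (test_function_off _ tf) => /O0 /=; rewrite ltNge h.
  - by apply: off; rewrite (lt_le_trans MT h).
  - by apply: off; rewrite (lt_le_trans MT h) orbT.
have [C C0 hC] := bounded_of_box cphi (fun p pM => (off p dir_t pM).1).
have iW (v : R * R) : continuous ('D_v phi) -> intg mu2 (fun p => 'D_v phi p * W p).
  move=> cv; apply: (@intg_continuous_box _ M).
    by move=> p; apply: cvgM; [exact: cv|exact: cW].
  by move=> p /(off p v)[_ ->]; rewrite mul0r.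
exists T; split; [exact: lt_trans MT|exact: offT|exact: iW|exact: iW|].
have := intg_bounded_mul (continuous_measurable2 cphi) hC (iG T).
apply: intg_ext => p; rewrite indic_itvE in_itv /=.
have [_|] := boolP (0 <= p.1 <= T); first by rewrite mul1r.
rewrite negb_and -!ltNge => h; have [-> _] : phi p = 0 /\ 'D_dir_t phi p = 0.
  apply: offT; case/orP: h => [/ltW ->//|/ltW h].
  by rewrite (le_trans h (ler_norm _)) orbT.
by rewrite !mul0r.
Qed.

(** On each line [x = const] the function [W] is a primitive of [G], and the one-dimensional
    integration by parts applies; Fubini's theorem collects the lines. *)
Lemma weak_derivative_t O phi W G : test_function O phi ->
  O `<=` [set p | 0 < p.1] -> continuous W ->
  (forall T, intg mu2 (fun p => \1_(`[0, T]%classic) p.1 * G p)) ->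
  (forall T x, intg mu (fun s => \1_(`[0, T]%classic) s * G (s, x))) ->
  (forall t x, 0 <= t ->
    W (t, x) = W (0, x) + \int[mu]_s (\1_(`[0, t]%classic) s * G (s, x))) ->
  \int[mu2]_p ('D_dir_t phi p * W p) = - \int[mu2]_p (phi p * G p).
Proof.
move=> tf O0 cW iG iGx WE; have [_ cdphi _ dphi] := test_function_smooth tf.
have [T [T0 off iL _ iR]] := test_function_strip tf O0 cW iG.
rewrite (Rint_fubiniC iL) (Rint_fubiniC iR) -[RHS]mulN1r -RintZ; last first.
  exact: (intg_fubiniC iR).
apply: eq_Rint => x; rewrite mulN1r.
have inT t : \1_(`[0, T]%classic) t = 1 :> R \/
    phi (t, x) = 0 /\ 'D_dir_t phi (t, x) = 0.
  rewrite indic_itvE in_itv /=; have [_|] := boolP (0 <= t <= T); first by left.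
  rewrite negb_and -!ltNge => h; right; apply: off; case/orP: h => [/ltW ->//|/ltW h].
  by rewrite /= (le_trans h (ler_norm _)) orbT.
transitivity (\int[mu]_t (\1_(`[0, T]%classic) t * ('D_dir_t phi (t, x) * W (t, x)))).
  by apply: eq_Rint => t; have [->|[_ ->]] := inT t; rewrite ?mul1r ?mul0r ?mulr0.
have [pA _] := off (0, x) dir_t (introT or3P (Or31 _ _ (lexx 0))).
have [pB _] : phi (T, x) = 0 /\ 'D_dir_t phi (T, x) = 0.
  by apply: off; rewrite /= ler_norm orbT.
have dp t := is_derive_dir_t (dphi (t, x)).1.
have := @Rint_by_parts R 0 T (fun t => phi (t, x)) _ (fun s => G (s, x))
  (fun t => W (t, x)) (ltW T0) pA pB dp (continuous_hline cdphi) (iGx T x).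
move=> ->; last by move=> t /andP[t0 _]; exact: WE.
congr (- _); apply: eq_Rint => t.
by have [->|[-> _]] := inT t; rewrite ?mul1r ?mul0r ?mulr0.
Qed.

(** As [weak_derivative_t], on the lines [t = const]; those with [t <= 0], where nothing is
    known about [W], do not meet the support. *)
Lemma weak_derivative_x O phi W G : test_function O phi ->
  O `<=` [set p | 0 < p.1] -> continuous W ->
  (forall T, intg mu2 (fun p => \1_(`[0, T]%classic) p.1 * G p)) ->
  (forall t, intg mu (fun y => G (t, y))) ->
  (forall t a b, 0 <= t -> a <= b ->
    W (t, b) = W (t, a) + \int[mu]_y (\1_(`[a, b]%classic) y * G (t, y))) ->
  \int[mu2]_p ('D_dir_x phi p * W p) = - \int[mu2]_p (phi p * G p).
Proof.
move=> tf O0 cW iG iGx WE; have [_ _ cdphi dphi] := test_function_smooth tf.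
have [T [T0 off _ iL iR]] := test_function_strip tf O0 cW iG.
rewrite (Rint_fubini iL) (Rint_fubini iR) -[RHS]mulN1r -RintZ; last first.
  exact: (intg_fubini iR).
apply: eq_Rint => t; rewrite mulN1r.
have [t0|t0] := ltP 0 t; last first.
  have off0 x : phi (t, x) = 0 /\ 'D_dir_x phi (t, x) = 0 by apply: off; rewrite /= t0.
  rewrite !Rint_eq0 ?oppr0// => x; have [p0 d0] := off0 x.
    by rewrite p0 mul0r.
  by rewrite d0 mul0r.
have inX x : \1_(`[- T, T]%classic) x = 1 :> R \/
    phi (t, x) = 0 /\ 'D_dir_x phi (t, x) = 0.
  rewrite indic_itvE in_itv /= -ler_norml; have [_|/ltW xT] := leP `|x| T; first by left.
  by right; apply: off; rewrite /= xT !orbT.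
transitivity (\int[mu]_x (\1_(`[- T, T]%classic) x * ('D_dir_x phi (t, x) * W (t, x)))).
  by apply: eq_Rint => x; have [->|[_ ->]] := inX x; rewrite ?mul1r ?mul0r ?mulr0.
have [pA _] : phi (t, - T) = 0 /\ 'D_dir_x phi (t, - T) = 0.
  by apply: off; rewrite /= normrN ler_norm !orbT.
have [pB _] : phi (t, T) = 0 /\ 'D_dir_x phi (t, T) = 0.
  by apply: off; rewrite /= ler_norm !orbT.
have TT : - T <= T by rewrite (le_trans _ (ltW T0))// oppr_le0 ltW.
have dp x := is_derive_dir_x (dphi (t, x)).2.
have := @Rint_by_parts R (- T) T (fun x => phi (t, x)) _ (fun y => G (t, y))
  (fun x => W (t, x)) TT pA pB dp (continuous_vline cdphi) (intg_itv _ (iGx t)).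
move=> ->; last by move=> x /andP[x0 _]; apply: WE => //; exact: ltW.
congr (- _); apply: eq_Rint => x.
by have [->|[-> _]] := inX x; rewrite ?mul1r ?mul0r ?mulr0.
Qed.

End weak_derivatives_from_lines.

(** * Linear waves *)

Section waves.
Context {R : realType}.
Local Notation mu := (lebesgue1 R).
Local Notation mu2 := (lebesgue2 R).
Local Notation Rm := (measurableTypeR R).
Implicit Types (F : R * R -> R) (r : R -> R) (c t x y s a b T C : R).

(** The component of the gradient that the equation transports at speed [-c]:
    its initial value, plus the source collected along the characteristic. *)
Definition transp c r F (p : R * R) : R := r (p.2 + c * p.1) + duhamel c F p.

(** D'Alembert's formula, with data given through [r1 = v0 + u0'] and
    [r2 = v0 - u0']. *)
Definition wave C r1 r2 F (p : R * R) : R :=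
  C + 2^-1 * (primitive r1 (p.2 + p.1) - primitive r2 (p.2 - p.1)) +
  potential F p.

Definition wave_t r1 r2 F (p : R * R) : R :=
  2^-1 * (transp 1 r1 F p + transp (-1) r2 F p).

Definition wave_x r1 r2 F (p : R * R) : R :=
  2^-1 * (transp 1 r1 F p - transp (-1) r2 F p).

Lemma measurable_transp c r F : intg mu r -> intg mu2 F ->
  measurable_fun setT (transp c r F : Rm * Rm -> R).
Proof.
move=> ir iF; apply: measurable_funD; last exact: measurable_duhamel (intg_measurable iF).
apply: (measurableT_comp (intg_measurable ir)).
by apply: measurable_toRm; meas.
Qed.

Lemma intg_transp c r F t : intg mu r -> intg mu2 F ->
  intg mu (fun x => transp c r F (t, x)) /\
  \int[mu]_x `|transp c r F (t, x)| <= \int[mu]_x `|r x| + \int[mu2]_p `|F p|.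
Proof.
move=> ir iF; have [iD bD] := intg_duhamel c t iF.
have ir' := intg_shift (c * t) ir.
split; first exact: intgD.
apply: le_trans (_ : _ <= \int[mu]_x `|r x| + \int[mu]_x `|duhamel c F (t, x)|) _; last first.
  by rewrite lerD2l.
rewrite -(Rint_shift (c * t) (intg_norm ir)) -RintD; last exact: intg_norm.
  apply: Rint_le => [| |x]; first exact/intg_norm/intgD.
    by apply: intgD; exact: intg_norm.
  exact: ler_normD.
exact: intg_norm.
Qed.

(** The mass on horizontal lines is bounded uniformly in time, hence integrable over bounded
    times. *)
Lemma intg_transp_slab c r F T : intg mu r -> intg mu2 F ->
  intg mu2 (fun p => \1_(`[0, T]%classic) p.1 * transp c r F p).
Proof.
move=> ir iF; apply: (intg_tonelli (b := fun t =>
  \1_(`[0, T]%classic) t * (\int[mu]_x `|r x| + \int[mu2]_p `|F p|))).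
- apply: measurable_funM; last exact: measurable_transp.
  exact: (measurableT_comp (measurable_indic_itv _) measurable_fst).
- exact: intg_cst_itv.
apply: aeW => t; have [it bt] := intg_transp c t ir iF.
rewrite /= indic_itvE; case: (_ \in _); split.
- by apply: intg_ext it => x; rewrite mul1r.
- by rewrite mul1r; apply: le_trans bt; rewrite le_eqVlt; apply/orP; left;
    apply/eqP/eq_Rint => x; rewrite mul1r.
- by apply: intg_ext (intg0 mu) => x; rewrite mul0r.
- by rewrite mul0r Rint_eq0// => x; rewrite mul0r normr0.
Qed.

Lemma primitive_closed r a b : intg mu r -> a <= b ->
  primitive r b - primitive r a = \int[mu]_y (\1_(`[a, b]%classic) y * r y).
Proof.
move=> ir ab; rewrite primitiveB//; apply: Rint_ae_eq.
- exact: intg_measurable (intg_itv _ ir).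
- exact: intg_measurable (intg_itv _ ir).
exists [set a]; split => //; first exact: lebesgue_measure_set1.
move=> y /= h; apply: contrapT => ya; apply: h.
rewrite !indic_itvE !in_itv /=; congr ((_ && _)%:R * _).
by rewrite lt_neqAle eq_sym; case: eqP ya.
Qed.

(** The change of variables [y = x + c s] on the line [x = const], with the sign of
    [c] accounting for the orientation. *)
Lemma primitive_line c r t x : c * c = 1 -> intg mu r -> 0 <= t ->
  c * (primitive r (x + c * t) - primitive r x) =
  \int[mu]_s (\1_(`[0, t]%classic) s * r (x + c * s)).
Proof.
move=> cc ir t0; have c1 := sqr1_norm cc.
have c0 : c != 0 by rewrite -normr_gt0 c1.
have key a b : a <= b -> (forall s, (a <= x + c * s <= b) = (0 <= s <= t)) ->
    primitive r b - primitive r a = \int[mu]_s (\1_(`[0, t]%classic) s * r (x + c * s)).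
  move=> ab E; have cv : `|c^-1| = 1 by rewrite normfV c1 invr1.
  rewrite primitive_closed// -[LHS]mul1r -cv.
  rewrite -(Rint_affine x c0 (intg_itv `[a, b] ir)).
  by apply: eq_Rint => s; rewrite !indic_itvE !in_itv /= E.
have [cp|cn] := leP 0 c.
  have cE : c = 1 by rewrite -c1 ger0_norm.
  rewrite {1 2}cE !mul1r; apply: key => [|s]; first by rewrite lerDl.
  by rewrite cE mul1r lerDl lerD2l.
have cE : c = - 1 by rewrite -c1 ltr0_norm// opprK.
rewrite {1 2}cE !mulN1r opprB; apply: key => [|s]; first by rewrite gerBl.
by rewrite cE mulN1r lerD2l lerN2 gerBl andbC.
Qed.

Section wave_properties.
Variables (r1 r2 : R -> R) (F : R * R -> R) (C : R).
Hypotheses (ir1 : intg mu r1) (ir2 : intg mu r2) (iF : intg mu2 F).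

Lemma wave_continuous : continuous (wave C r1 r2 F).
Proof.
have cp : continuous (fun p : R * R => p.2 + p.1).
  by move=> p; apply: cvgD; [exact: cvg_snd|exact: cvg_fst].
have cm : continuous (fun p : R * R => p.2 - p.1).
  by move=> p; apply: cvgB; [exact: cvg_snd|exact: cvg_fst].
have c1 : continuous (fun p : R * R => primitive r1 (p.2 + p.1)).
  move=> p; apply: (@continuous_comp _ _ _ _ (primitive r1) p (cp p)).
  exact: primitive_continuous.
have c2 : continuous (fun p : R * R => primitive r2 (p.2 - p.1)).
  move=> p; apply: (@continuous_comp _ _ _ _ (primitive r2) p (cm p)).
  exact: primitive_continuous.
move=> p; apply: cvgD; last exact: potential_continuous.
apply: cvgD; first exact: cvg_cst.
apply: cvgM; first exact: cvg_cst.
by apply: cvgB; [exact: c1|exact: c2].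
Qed.

Lemma wave_bounded p : `|wave C r1 r2 F p| <=
  `|C| + \int[mu]_x `|r1 x| + \int[mu]_x `|r2 x| + \int[mu2]_q `|F q|.
Proof.
have h1 := primitive_le (p.2 + p.1) ir1; have h2 := primitive_le (p.2 - p.1) ir2.
have h3 := @potential_bound _ F (fun q => `|F q|) p (intg_measurable iF)
  (intg_norm iF) (aeW _ (fun=> lexx _)).
have F0 : 0 <= \int[mu2]_q `|F q| by apply: Rint_ge0.
have i1 : 0 <= \int[mu]_x `|r1 x| by apply: Rint_ge0.
have i2 : 0 <= \int[mu]_x `|r2 x| by apply: Rint_ge0.
rewrite /wave; apply: le_trans (ler_normD _ _) _.
apply: le_trans (lerD (ler_normD _ _) (lexx _)) _.
rewrite normrM ger0_norm ?invr_ge0//.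
have := ler_normB (primitive r1 (p.2 + p.1)) (primitive r2 (p.2 - p.1)).
move: (\int[mu]_x `|r1 x|) (\int[mu]_x `|r2 x|) (\int[mu2]_q `|F q|) h1 h2 h3 F0 i1 i2.
move: `|primitive r1 _ - _| `|primitive r1 _| `|primitive r2 _| `|potential F p| `|C|.
by clear; move=> *; lra.
Qed.

Let intg_transp_time c r t x : c * c = 1 -> intg mu r ->
  intg mu (fun s => \1_(`[0, t]%classic) s * transp c r F (s, x)).
Proof.
move=> cc ir; have c0 : c != 0 by rewrite -normr_gt0 (sqr1_norm cc).
have [iD _] := Rint_duhamel_time t x cc iF.
apply: intg_ext (intgD (intg_itv `[0, t] (intg_affine x c0 ir)) iD) => s.
by rewrite -mulrDr.
Qed.

Let cc1 : 1 * 1 = 1 :> R. Proof. exact: mul1r. Qed.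
Let ccN1 : -1 * -1 = 1 :> R. Proof. by rewrite mulrNN mul1r. Qed.

Lemma intg_wave_t_time t x :
  intg mu (fun s => \1_(`[0, t]%classic) s * wave_t r1 r2 F (s, x)).
Proof.
apply: intg_ext (intgZ 2^-1 (intgD (intg_transp_time t x cc1 ir1)
  (intg_transp_time t x ccN1 ir2))) => s.
by rewrite /wave_t; ring.
Qed.

(** [wave] is a primitive of [wave_t] on every vertical line, and below of [wave_x] on every
    horizontal line, without exception: this is what makes the integration by
    parts on lines apply. *)
Lemma wave_time t x : 0 <= t -> wave C r1 r2 F (t, x) =
  wave C r1 r2 F (0, x) + \int[mu]_s (\1_(`[0, t]%classic) s * wave_t r1 r2 F (s, x)).
Proof.
move=> t0.
have P0 : potential F (0, x) = 0.
  by rewrite potential_time// -Rint_indic set_itv1 Rintegral_set1.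
have h1 := primitive_line x cc1 ir1 t0; have h2 := primitive_line x ccN1 ir2 t0.
have [d1 _] := Rint_duhamel_time t x cc1 iF.
have [d2 _] := Rint_duhamel_time t x ccN1 iF.
have c0 : -1 != 0 :> R by rewrite oppr_eq0 oner_eq0.
have i1 := intg_itv `[0, t] (intg_affine x (oner_neq0 R) ir1).
have i2 := intg_itv `[0, t] (intg_affine x c0 ir2).
have -> : \int[mu]_s (\1_(`[0, t]%classic) s * wave_t r1 r2 F (s, x)) =
    2^-1 * (\int[mu]_s (\1_(`[0, t]%classic) s * r1 (x + 1 * s)) +
      \int[mu]_s (\1_(`[0, t]%classic) s * r2 (x + -1 * s))) +
    \int[mu]_s (\1_(`[0, t]%classic) s *
      (2^-1 * (duhamel 1 F (s, x) + duhamel (-1) F (s, x)))).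
  rewrite -RintD// -RintZ; last exact: intgD.
  rewrite -RintD; last 2 first.
  - exact/intgZ/intgD.
  - apply: intg_ext (intgZ 2^-1 (intgD d1 d2)) => s; ring.
  by apply: eq_Rint => s; rewrite /wave_t /transp /=; ring.
rewrite -potential_time// -h1 -h2 /wave P0 /=.
rewrite !mul1r !mulN1r !addr0 !subr0.
by ring.
Qed.

Lemma intg_wave_x t : intg mu (fun x => wave_x r1 r2 F (t, x)).
Proof.
apply: intg_ext (intgZ 2^-1 (intgB (intg_transp 1 t ir1 iF).1
  (intg_transp (-1) t ir2 iF).1)) => x.
by [].
Qed.

Lemma intg_wave_t t : intg mu (fun x => wave_t r1 r2 F (t, x)).
Proof.
apply: intg_ext (intgZ 2^-1 (intgD (intg_transp 1 t ir1 iF).1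
  (intg_transp (-1) t ir2 iF).1)) => x.
by [].
Qed.

Lemma wave_space t a b : 0 <= t -> a <= b -> wave C r1 r2 F (t, b) =
  wave C r1 r2 F (t, a) + \int[mu]_y (\1_(`[a, b]%classic) y * wave_x r1 r2 F (t, y)).
Proof.
move=> t0 ab.
have i1 := intg_itv `[a, b] (intg_shift (1 * t) ir1).
have i2 := intg_itv `[a, b] (intg_shift (-1 * t) ir2).
have d c := intg_itv `[a, b] (intg_duhamel c t iF).1.
have E c r : intg mu r -> primitive r (b + c * t) - primitive r (a + c * t) =
    \int[mu]_y (\1_(`[a, b]%classic) y * r (y + c * t)).
  move=> ir; rewrite primitive_closed//; last by rewrite lerD2r.
  rewrite -(Rint_shift (c * t) (intg_itv _ ir)); apply: eq_Rint => y.
  by rewrite !indic_itvE !in_itv /= !lerD2r.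
have -> : \int[mu]_y (\1_(`[a, b]%classic) y * wave_x r1 r2 F (t, y)) =
    2^-1 * (\int[mu]_y (\1_(`[a, b]%classic) y * r1 (y + 1 * t)) -
      \int[mu]_y (\1_(`[a, b]%classic) y * r2 (y + -1 * t))) +
    \int[mu]_y (\1_(`[a, b]%classic) y *
      (2^-1 * (duhamel 1 F (t, y) - duhamel (-1) F (t, y)))).
  rewrite -RintB// -RintZ; last exact: intgB.
  rewrite -RintD; last 2 first.
  - exact/intgZ/intgB.
  - apply: intg_ext (intgZ 2^-1 (intgB (d 1) (d (-1)))) => s; ring.
  by apply: eq_Rint => s; rewrite /wave_x /transp /=; ring.
rewrite -potential_space// -!E// /wave /= !mul1r !mulN1r.
by ring.
Qed.

Lemma intg_wave_t_slab T :
  intg mu2 (fun p => \1_(`[0, T]%classic) p.1 * wave_t r1 r2 F p).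
Proof.
apply: intg_ext (intgZ 2^-1 (intgD (intg_transp_slab 1 T ir1 iF)
  (intg_transp_slab (-1) T ir2 iF))) => p.
by rewrite /wave_t; ring.
Qed.

Lemma intg_wave_x_slab T :
  intg mu2 (fun p => \1_(`[0, T]%classic) p.1 * wave_x r1 r2 F p).
Proof.
apply: intg_ext (intgZ 2^-1 (intgB (intg_transp_slab 1 T ir1 iF)
  (intg_transp_slab (-1) T ir2 iF))) => p.
by rewrite /wave_x; ring.
Qed.

Lemma wave_weak_t O phi : test_function O phi -> O `<=` [set p | 0 < p.1] ->
  \int[mu2]_p ('D_dir_t phi p * wave C r1 r2 F p) =
  - \int[mu2]_p (phi p * wave_t r1 r2 F p).
Proof.
move=> tf O0; apply: (weak_derivative_t tf O0 wave_continuous).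
- exact: intg_wave_t_slab.
- exact: intg_wave_t_time.
- exact: wave_time.
Qed.

Lemma wave_weak_x O phi : test_function O phi -> O `<=` [set p | 0 < p.1] ->
  \int[mu2]_p ('D_dir_x phi p * wave C r1 r2 F p) =
  - \int[mu2]_p (phi p * wave_x r1 r2 F p).
Proof.
move=> tf O0; apply: (weak_derivative_x tf O0 wave_continuous).
- exact: intg_wave_x_slab.
- exact: intg_wave_x.
- exact: wave_space.
Qed.

End wave_properties.

End waves.

(** * Flat functions and smoothness *)

Section bumps.
Context {R : realType}.
Implicit Types (phi psi : R * R -> R) (x y h : R) (j k : nat).

(** The powers of [x^-1] are there to make the span of the family closed under
    differentiation, see [is_derive_flat]: smoothness follows by induction on the order for
    all [j] at once. *)
Definition flat j x : R := if 0 < x then x^-1 ^+ j * expR (- x^-1) else 0.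

Lemma flat_ge0 j x : 0 <= flat j x.
Proof.
rewrite /flat; case: ifP => // x0.
by rewrite mulr_ge0 ?expR_ge0// exprn_ge0// invr_ge0 ltW.
Qed.

(** With [y = x^-1] the claim reads [y^(j+1) <= (j+1)! exp y], one term of the exponential
    series.  With [j.+1] in place of [j] it bounds the difference quotients at the
    origin. *)
Lemma flat_bound j x : flat j x <= (j.+1)`!%:R * `|x|.
Proof.
rewrite /flat; case: ifPn => [x0|_]; last by rewrite mulr_ge0.
rewrite (gtr0_norm x0); set y := x^-1.
have y0 : 0 < y by rewrite invr_gt0.
have := @expR_ge1Dxn R y j (ltW y0) => ey.
rewrite expRN -[x]invrK -/y ler_pdivrMr ?expR_gt0//.
have -> : y ^+ j = y ^+ j.+1 / y by rewrite exprSr mulfK ?gt_eqF.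
rewrite ler_pdivrMr// mulrAC mulfVK ?gt_eqF//.
rewrite mulrC -ler_pdivrMr ?ltr0n ?fact_gt0//.
by apply: le_trans ey; rewrite lerDr.
Qed.

Lemma is_derive_flat j x :
  is_derive x 1 (flat j) (flat j.+2 x - j%:R * flat j.+1 x).
Proof.
have [x0|x0|->] := ltgtP x 0.
- have E : {near x, cst 0 =1 flat j}.
    have := lt_nbhsl x0; apply: filterS => y y0 /=.
    by rewrite /flat ltNge (ltW y0).
  rewrite /flat ltNge (ltW x0) /= mulr0 subr0.
  split; first by apply: near_eq_derivable E _; exact: derivable_cst.
  by rewrite -(near_eq_derive _ E) derive_cst.
- pose F (y : R) := y^-1 ^+ j * expR (- y^-1).
  have E : {near x, F =1 flat j}.
    by have := lt_nbhsr x0; apply: filterS => y y0 /=; rewrite /flat y0.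
  have x_neq0 : (id : R -> R) x != 0 by rewrite /= gt_eqF.
  have dV : is_derive x 1 (fun y : R => y^-1) (- x ^- 2 *: 1).
    by have := @is_deriveV R id x 1 1 x_neq0 (is_derive_id x 1).
  have dX := is_deriveX j dV.
  have dE := @is_derive1_comp R expR (- (fun y : R => y^-1)) x _ _
    (is_derive_expR (- x^-1)) (is_deriveN dV).
  have dF := is_deriveM dX dE.
  have FE : (fun y : R => y^-1) ^+ j * (expR \o - (fun y : R => y^-1)) = F.
    by apply/funext => y; rewrite /F !fctE.
  rewrite FE in dF.
  have -> : flat j.+2 x - j%:R * flat j.+1 x =
      ((fun y : R => y^-1) ^+ j) x *: (expR (- x^-1) * - (- x ^- 2 *: 1)) +
      (expR \o - (fun y : R => y^-1)) x *: ((j%:R * x^-1 ^+ j.-1) *: (- x ^- 2 *: 1)).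
    rewrite /flat x0 !fctE /= -!exprVn /GRing.scale /=.
    rewrite !mulr1 opprK.
    case: j {E F dX dF FE} => [|j]; first by rewrite !mul0r !mulr0 subr0 addr0 expr0 mul1r mulrC.
    by rewrite /= !exprSr; ring.
  case: dF => d1 d2; split; first exact: near_eq_derivable E _.
  by rewrite -(near_eq_derive _ E).
have flat0 i : flat i 0 = 0 by rewrite /flat ltxx.
rewrite !flat0 mulr0 subr0.
have cv : h^-1 *: (flat j (h *: 1 + 0) - flat j 0) @[h --> 0^'] --> (0 : R).
  apply/cvgrPdist_le => e e0; pose C : R := (j.+2)`!%:R.
  have C0 : 0 < C by rewrite ltr0n fact_gt0.
  exists (e / C); first by rewrite /= divr_gt0.
  move=> h; rewrite /ball /= sub0r normrN => hC h0.
  rewrite sub0r normrN flat0 subr0 addr0 [h *: 1]mulr1 /GRing.scale /=.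
  apply: (@le_trans _ _ (flat j.+1 h)).
    rewrite /flat; case: ifPn => [hp|hn]; last by rewrite mulr0 normr0.
    by rewrite mulrA -exprS ger0_norm// mulr_ge0 ?expR_ge0// exprn_ge0// invr_ge0 ltW.
  apply: le_trans (flat_bound _ _) _.
  by rewrite mulrC -ler_pdivlMr// ltW.
split; first by apply/cvg_ex; exists 0; exact: cv.
exact: (cvg_lim (@norm_hausdorff _ _) cv).
Qed.

Lemma flat_continuous j : continuous (flat j).
Proof.
move=> x; apply: differentiable_continuous; apply/derivable1_diffP.
by have [] := is_derive_flat j x.
Qed.

(** [Ck k.+1] does not mention the orders below; the cumulative form is what the induction
    for products needs, where a factor is used both with and without its
    derivative. *)
Definition smooth_upto k phi := forall i, (i <= k)%N -> Ck i phi.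

Lemma smooth_uptoS k phi : continuous phi ->
  (forall p, derivable phi p dir_t /\ derivable phi p dir_x) ->
  smooth_upto k ('D_(dir_t : R * R) phi) -> smooth_upto k ('D_(dir_x : R * R) phi) ->
  smooth_upto k.+1 phi.
Proof.
by move=> c d s1 s2 [|i] // ik; split => //; [exact: s1|exact: s2].
Qed.

Lemma smooth_uptoW k phi : smooth_upto k.+1 phi -> smooth_upto k phi.
Proof. by move=> s i ik; apply: s; exact: leqW. Qed.

Lemma smooth_uptoP k phi : smooth_upto k.+1 phi ->
  [/\ continuous phi, forall p, derivable phi p dir_t /\ derivable phi p dir_x,
      smooth_upto k ('D_(dir_t : R * R) phi) & smooth_upto k ('D_(dir_x : R * R) phi)].
Proof.
move=> s; split; first exact: (s 0%N).
- by have [] := s 1%N.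
- by move=> i ik; have [] := s i.+1 ik.
- by move=> i ik; have [] := s i.+1 ik.
Qed.

Lemma smooth_cst k (c : R) : smooth_upto k (fun=> c).
Proof.
elim: k c => [|k IH] c; first by move=> [|i]// _ p; exact: cvg_cst.
have D e : 'D_e (fun=> c : R) = (fun=> 0) :> (R * R -> R).
  by apply/funext => p; rewrite derive_cst.
apply: smooth_uptoS; rewrite ?D//.
by move=> p; exact: cvg_cst.
Qed.

Lemma smoothD k phi psi : smooth_upto k phi -> smooth_upto k psi ->
  smooth_upto k (fun p => phi p + psi p).
Proof.
elim: k phi psi => [|k IH] phi psi s1 s2.
  by move=> [|i]// _ p; apply: cvgD; [exact: (s1 0%N)|exact: (s2 0%N)].
have [c1 d1 t1 x1] := smooth_uptoP s1; have [c2 d2 t2 x2] := smooth_uptoP s2.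
have D e : (forall p, derivable phi p e) -> (forall p, derivable psi p e) ->
    'D_e (fun p => phi p + psi p) = (fun p => 'D_e phi p + 'D_e psi p).
  by move=> h1 h2; apply/funext => p; rewrite -deriveD.
apply: smooth_uptoS.
- by move=> p; apply: cvgD; [exact: c1|exact: c2].
- by move=> p; have [? ?] := d1 p; have [? ?] := d2 p; split; exact: derivableD.
- rewrite D; first exact: IH.
    by move=> p; have [] := d1 p.
  by move=> p; have [] := d2 p.
- rewrite D; first exact: IH.
    by move=> p; have [] := d1 p.
  by move=> p; have [] := d2 p.
Qed.

Lemma smoothM k phi psi : smooth_upto k phi -> smooth_upto k psi ->
  smooth_upto k (fun p => phi p * psi p).
Proof.
elim: k phi psi => [|k IH] phi psi s1 s2.
  by move=> [|i]// _ p; apply: cvgM; [exact: (s1 0%N)|exact: (s2 0%N)].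
have [c1 d1 t1 x1] := smooth_uptoP s1; have [c2 d2 t2 x2] := smooth_uptoP s2.
have D e : (forall p, derivable phi p e) -> (forall p, derivable psi p e) ->
    'D_e (fun p => phi p * psi p) =
    (fun p => phi p * 'D_e psi p + psi p * 'D_e phi p).
  by move=> h1 h2; apply/funext => p; have := deriveM (h1 p) (h2 p).
apply: smooth_uptoS.
- by move=> p; apply: cvgM; [exact: c1|exact: c2].
- by move=> p; have [a1 b1] := d1 p; have [a2 b2] := d2 p; split;
    [have := derivableM a1 a2|have := derivableM b1 b2].
- rewrite D; last 2 first.
  + by move=> p; have [] := d1 p.
  + by move=> p; have [] := d2 p.
  by apply: smoothD; apply: IH => //; exact: smooth_uptoW.
- rewrite D; last 2 first.
  + by move=> p; have [] := d1 p.
  + by move=> p; have [] := d2 p.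
  by apply: smoothD; apply: IH => //; exact: smooth_uptoW.
Qed.

(** Derivatives along a direction are derivatives on a line, where the chain rule in one
    variable applies. *)
Lemma is_derive_dir (g : R -> R) (dg : R) phi (p e : R * R) :
  is_derive (phi p) 1 g dg -> derivable phi p e ->
  is_derive p e (g \o phi) (dg * 'D_e phi p).
Proof.
move=> dgp dphi.
pose ell (h : R) := phi (h *: e + p).
have ell0 : ell 0 = phi p by rewrite /ell scale0r add0r.
have E (f : R * R -> R) :
    (fun h : R => h^-1 *: ((f \o shift p) (h *: e) - f p)) =
    (fun h : R => h^-1 *: (((fun h => f (h *: e + p)) \o shift 0) (h *: 1) -
       f (0 *: e + p))).
  apply/funext => h /=; rewrite /shift /= addr0 scale0r add0r.
  by rewrite [h *: 1]mulr1.
have dell : is_derive (0 : R) 1 ell ('D_e phi p).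
  by split; [have := dphi|]; rewrite /derivable /derive E.
rewrite -ell0 in dgp.
have [d1 d2] := is_derive1_comp dgp dell.
by split; rewrite /derivable /derive E; [exact: d1|exact: d2].
Qed.

Lemma smooth_exp k phi : smooth_upto k phi -> smooth_upto k (expR \o phi).
Proof.
elim: k phi => [|k IH] phi s.
  move=> [|i]// _ p; apply: continuous_comp; first exact: (s 0%N).
  exact: continuous_expR.
have [c d t x] := smooth_uptoP s.
have D e p : derivable phi p e -> is_derive p e (expR \o phi) (expR (phi p) * 'D_e phi p).
  by move=> dp; apply: is_derive_dir => //; exact: is_derive_expR.
apply: smooth_uptoS.
- by move=> p; apply: continuous_comp; [exact: c|exact: continuous_expR].
- by move=> p; have [h1 h2] := d p; split; [have [] := D _ _ h1|have [] := D _ _ h2].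
- have -> : 'D_(dir_t : R * R) (expR \o phi) = (fun p => (expR \o phi) p * 'D_dir_t phi p).
    by apply/funext => p; have [h1 h2] := d p; have [_ ->] := D _ _ h1.
  by apply: smoothM => //; apply: IH; exact: smooth_uptoW.
- have -> : 'D_(dir_x : R * R) (expR \o phi) = (fun p => (expR \o phi) p * 'D_dir_x phi p).
    by apply/funext => p; have [h1 h2] := d p; have [_ ->] := D _ _ h2.
  by apply: smoothM => //; apply: IH; exact: smooth_uptoW.
Qed.

(** Applied to affine functions [phi], which are given by their two constant partial
    derivatives. *)
Lemma smooth_flat k j phi (ct cx : R) : continuous phi ->
  (forall p, is_derive p (dir_t : R * R) phi ct) ->
  (forall p, is_derive p (dir_x : R * R) phi cx) ->
  smooth_upto k (flat j \o phi).
Proof.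
move=> cphi dt dx; elim: k j => [|k IH] j.
  move=> [|i]// _ p; apply: continuous_comp; [exact: cphi|exact: flat_continuous].
have D e c : (forall p, is_derive p (e : R * R) phi c) -> forall p,
    is_derive p e (flat j \o phi) (((flat j.+2 \o phi) p +
      - j%:R * (flat j.+1 \o phi) p) * c).
  move=> de p; have [h1 <-] := de p; rewrite mulNr.
  by apply: is_derive_dir => //; exact: is_derive_flat.
have S c : smooth_upto k (fun p => ((flat j.+2 \o phi) p +
      - j%:R * (flat j.+1 \o phi) p) * c).
  apply: smoothM; last exact: smooth_cst.
  by apply: smoothD => //; apply: smoothM => //; exact: smooth_cst.
apply: smooth_uptoS.
- by move=> p; apply: continuous_comp; [exact: cphi|exact: flat_continuous].
- by move=> p; split; [have [] := D _ _ dt p|have [] := D _ _ dx p].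
- have -> : 'D_(dir_t : R * R) (flat j \o phi) = _ := funext (fun p => derive_val (is_derive := D _ _ dt p)).
  exact: S.
- have -> : 'D_(dir_x : R * R) (flat j \o phi) = _ := funext (fun p => derive_val (is_derive := D _ _ dx p)).
  exact: S.
Qed.

End bumps.

(** * Smooth approximations of boxes *)

Section du_bois_reymond.
Context {R : realType}.
Implicit Types (g : R * R -> R) (O : set (R * R)) (q : R * R * R * R) (a b c d : R).

Let profile q (p : R * R) : R :=
  flat 0 (p.1 - q.1.1.1) * flat 0 (q.1.1.2 - p.1) *
  (flat 0 (p.2 - q.1.2) * flat 0 (q.2 - p.2)).

(** [profile] is positive exactly inside the box, so that the exponential tends to zero
    there and is one elsewhere.  This replaces a convolution. *)
Definition bump q (m : nat) (p : R * R) : R := 1 - expR (- m%:R * profile q p).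

Let flat00 (x : R) : x <= 0 -> flat 0 x = 0.
Proof. by rewrite /flat leNgt => /negbTE ->. Qed.

Let flat0_gt0 (x : R) : 0 < x -> 0 < flat 0 x.
Proof. by move=> x0; rewrite /flat x0 expr0 mul1r expR_gt0. Qed.

Let profile_ge0 q p : 0 <= profile q p.
Proof. by rewrite !mulr_ge0 ?flat_ge0. Qed.

Let profile_gt0 q p : open_box q p -> 0 < profile q p.
Proof.
by move=> [/andP[h1 h2] /andP[h3 h4]]; rewrite !mulr_gt0// flat0_gt0// subr_gt0.
Qed.

Lemma bump_off q m p : ~ open_box q p -> bump q m p = 0.
Proof.
move=> qp; suff -> : bump q m p = 1 - expR (- m%:R * 0) by rewrite mulr0 expR0 subrr.
congr (1 - expR (_ * _)); rewrite /profile.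
case: (ltP q.1.1.1 p.1) => h1; last by rewrite flat00 ?mul0r// subr_le0.
case: (ltP p.1 q.1.1.2) => h2; last by rewrite (@flat00 (q.1.1.2 - _)) ?mulr0 ?mul0r// subr_le0.
case: (ltP q.1.2 p.2) => h3; last by rewrite (@flat00 (p.2 - _)) ?mul0r ?mulr0// subr_le0.
case: (ltP p.2 q.2) => h4; last by rewrite (@flat00 (q.2 - _)) ?mulr0// subr_le0.
by exfalso; apply: qp; split; apply/andP.
Qed.

Lemma bump_ge0 q m p : 0 <= bump q m p.
Proof.
by rewrite subr_ge0 -expR0 ler_expR mulNr oppr_le0 mulr_ge0 ?profile_ge0.
Qed.

Lemma bump_le1 q m p : bump q m p <= 1.
Proof. by rewrite lerBlDr lerDl expR_ge0. Qed.

Lemma bump_cvg q p : bump q m p @[m --> \oo] --> (\1_(open_box q) p : R).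
Proof.
rewrite indicE; have [/set_mem qp|/negP qp] := boolP (p \in open_box q); last first.
  have E : (fun m => bump q m p) = (fun=> 0).
    by apply/funext => m; apply: bump_off => h; apply: qp; apply/mem_set.
  by rewrite E; exact: cvg_cst.
rewrite /= -[X in _ --> X]subr0; apply: cvgB; first exact: cvg_cst.
have -> : (fun m : nat => expR (- m%:R * profile q p)) =
    (fun x : R => expR (- x)) \o (fun m : nat => m%:R * profile q p).
  by apply/funext => m /=; rewrite mulNr.
apply: (@cvg_comp _ _ _ _ (fun x : R => expR (- x)) _ _ _ _ (@cvgr_expR R)).
have P := @gt0_cvgMly R +oo _ _ id (profile_gt0 qp) cvg_id.
exact: cvg_comp (@cvgr_idn R) (P _).
Qed.

(** The four factors of [profile]: [s] is a sign, and [e] selects the coordinate. *)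
Let smooth_coord k (e : bool) (s c : R) : s * s = 1 ->
  smooth_upto k (fun p : R * R => flat 0 (s * (if e then p.1 else p.2) + c)).
Proof.
move=> _; pose phi (p : R * R) : R := s * (if e then p.1 else p.2) + c.
have D (p v : R * R) : is_derive p v phi (s * (if e then v.1 else v.2)).
  have E : (fun h : R => h^-1 *: ((phi \o shift p) (h *: v) - phi p)) @ 0^' -->
      s * (if e then v.1 else v.2).
    apply: cvg_near_cst; near=> h.
    have h0 : h != 0 by near: h; exact: nbhs_dnbhs_neq.
    change (h^-1 * ((s * (if e then h * v.1 + p.1 else h * v.2 + p.2) + c) -
      (s * (if e then p.1 else p.2) + c)) = s * (if e then v.1 else v.2)).
    apply: (mulfI h0); rewrite mulrA mulfV// mul1r.
    by clear; case: e; ring.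
  split; first by apply/cvg_ex; eexists; exact: E.
  exact: (cvg_lim (@norm_hausdorff _ _) E).
apply: (@smooth_flat _ k 0 phi (s * (if e then 1 else 0)) (s * (if e then 0 else 1))).
move=> p; apply: cvgD; last exact: cvg_cst.
by apply: cvgM; [exact: cvg_cst|case: e {phi D}; [exact: cvg_fst|exact: cvg_snd]].
Unshelve. all: by end_near.
Qed.

Lemma bump_smooth q m k : Ck k (bump q m).
Proof.
suff : smooth_upto k (bump q m) by exact.
have -> : bump q m = (fun p => 1 + -1 * (expR \o (fun p => - m%:R *
    (flat 0 (1 * p.1 + - q.1.1.1) * flat 0 (-1 * p.1 + q.1.1.2) *
    (flat 0 (1 * p.2 + - q.1.2) * flat 0 (-1 * p.2 + q.2))))) p).
  apply/funext => p; rewrite /bump /profile /= mulN1r !mul1r !mulN1r.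
  by rewrite (addrC (- p.1)) (addrC (- p.2)).
have N1 : -1 * -1 = 1 :> R by rewrite mulrNN mul1r.
apply: smoothD; first exact: smooth_cst.
apply: smoothM; first exact: smooth_cst.
apply: smooth_exp; apply: smoothM; first exact: smooth_cst.
apply: smoothM; apply: smoothM.
- exact: (@smooth_coord k true 1 (- q.1.1.1) (mul1r 1)).
- exact: (@smooth_coord k true (-1) (q.1.1.2) N1).
- exact: (@smooth_coord k false 1 (- q.1.2) (mul1r 1)).
- exact: (@smooth_coord k false (-1) (q.2) N1).
Qed.

Let closed_boxE q :
  closed_box q = (`[q.1.1.1, q.1.1.2] `*` `[q.1.2, q.2])%classic.
Proof. by apply/seteqP; split=> p /=; rewrite /closed_box /= !in_itv /=. Qed.

Lemma closed_box_compact q : compact (closed_box q).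
Proof. by rewrite closed_boxE; apply: compact_setX; exact: segment_compact. Qed.

Let closed_box_closed q : closed (closed_box q).
Proof. by apply: compact_closed; [exact: norm_hausdorff|exact: closed_box_compact]. Qed.

Lemma bump_test q m O : closed_box q `<=` O -> test_function O (bump q m).
Proof.
move=> qO.
have S : closure [set p | bump q m p != 0] `<=` closed_box q.
  rewrite [X in _ `<=` X](closure_id _).1; last exact: closed_box_closed.
  apply: closure_subset => p /= /eqP h.
  have [[/andP[h1 h2] /andP[h3 h4]]|//] := pselect (open_box q p); last first.
    by move=> /(@bump_off q m).
  by split; rewrite ?(ltW h1) ?(ltW h2) ?(ltW h3) ?(ltW h4).
split; first exact: bump_smooth.
- by apply: subclosed_compact S; [exact: closed_closure|exact: closed_box_compact].
- exact: subset_trans qO.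
Qed.

End du_bois_reymond.

(** * The du Bois-Reymond lemma *)

Section du_bois_reymond_lemma.
Context {R : realType}.
Local Notation mu := (lebesgue1 R).
Local Notation mu2 := (lebesgue2 R).
Local Notation Rm := (measurableTypeR R).
Implicit Types (g G : R * R -> R) (O : set (R * R)) (q : R * R * R * R) (a b c d : R).

Lemma measurable_closed_box q : measurable (closed_box q : set (Rm * Rm)).
Proof.
apply: closed_measurable2; apply: compact_closed; first exact: norm_hausdorff.
exact: closed_box_compact.
Qed.

Lemma ae_fst (P : R -> Prop) : {ae mu, forall t, P t} -> {ae mu2, forall p, P p.1}.
Proof.
by move=> aP; have := ae_snd aP => /(scales_ae scales_swap).
Qed.

Lemma ae_neq (a : R) : {ae mu, forall t, t != a}.
Proof.
exists [set a]; split; [exact: measurable_set1|exact: lebesgue_measure_set1|].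
by move=> t /= /negP; rewrite negbK => /eqP.
Qed.

Lemma ae_rat (P : rat -> R -> Prop) : (forall r, {ae mu, forall t, P r t}) ->
  {ae mu, forall t, forall r, P r t}.
Proof.
move=> aP; have : {ae mu, forall t, forall k : nat, P (odflt 0 (unpickle k)) t}.
  by apply: ae_foralln => k; exact: aP.
by apply: aeS => t h r; have := h (pickle r); rewrite pickleK.
Qed.

Lemma ae0_of_sections G : intg mu2 G ->
  {ae mu, forall t, {ae mu, forall x, G (t, x) = 0}} -> {ae mu2, forall p, G p = 0}.
Proof.
move=> iG aG.
have inG := intg_norm iG.
have : {ae mu2, forall p, `|G p| = 0}.
  apply: ae_eq0_of_Rint => //; rewrite (Rint_fubini inG).
  rewrite -(@Rint_eq0 _ _ _ mu (fun=> 0)) //.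
  apply: Rint_ae_eq; first exact: (intg_measurable (intg_fubini inG)).
    exact: measurable_cst.
  have := intg_xsection iG; apply: aeS2 aG => t at0 it.
  rewrite -(@Rint_eq0 _ _ _ mu (fun=> 0)) //.
  apply: Rint_ae_eq; first exact: (intg_measurable (intg_norm it)).
    exact: measurable_cst.
  by apply: aeS at0 => x ->; rewrite normr0.
by apply: aeS => p /normr0_eq0.
Qed.

(** Quadrant integrals are primitives in [t] of primitives in [x]: [primitive_eq0] is
    applied in [t] for every rational [s], and then in [x]. *)
Lemma ae0_of_quadrants G : intg mu2 G ->
  (forall r s : rat, \int[mu2]_p ((p.1 <= ratr r)%R%:R *
     ((p.2 <= ratr s)%R%:R * G p)) = 0) ->
  {ae mu2, forall p, G p = 0}.
Proof.
move=> iG G0; apply: ae0_of_sections => //.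
have iGs (s : rat) : intg mu2 (fun p => (p.2 <= ratr s)%R%:R * G p).
  apply: (intg_bool (b := fun p => p.2 <= ratr s)) => //.
  by apply: measurable_fun_ler; meas.
have iGr (r s : rat) :
    intg mu2 (fun p => (p.1 <= ratr r)%R%:R * ((p.2 <= ratr s)%R%:R * G p)).
  apply: (intg_bool (b := fun p => p.1 <= ratr r)) => //.
  by apply: measurable_fun_ler; meas.
have H : {ae mu, forall t, forall s : rat,
    \int[mu]_x ((x <= ratr s)%R%:R * G (t, x)) = 0}.
  apply: ae_rat => s; apply: primitive_eq0; first exact: (intg_fubini (iGs s)).
  move=> r; rewrite /primitive -[RHS](G0 r s) (Rint_fubini (iGr r s)).
  apply: eq_Rint => t /=; rewrite indic_itvE in_itv /=; case: (t <= _); last first.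
    by rewrite mul0r; apply/esym/Rint_eq0 => x; rewrite mul0r.
  by rewrite mul1r; apply: eq_Rint => x; rewrite mul1r.
have := intg_xsection iG; apply: aeS2 H => t ht it.
apply: primitive_eq0 => // s; rewrite -[RHS](ht s); apply: eq_Rint => x.
by rewrite indic_itvE in_itv.
Qed.

Lemma Rint_bump_cvg q G : intg mu2 G ->
  \int[mu2]_p (bump q m p * G p) @[m --> \oo] -->
  \int[mu2]_p (\1_(open_box q) p * G p).
Proof.
move=> iG; have mG := intg_measurable iG.
apply: (@Rint_dominated _ _ _ mu2 (fun m p => bump q m p * G p) _ (fun p => `|G p|)).
- move=> m; apply: measurable_funM mG; apply: continuous_measurable2.
  by have := @bump_smooth R q m 0%N.
- apply: measurable_funM mG; apply: measurable_indic; exact: measurable_open_box.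
- exact: intg_norm.
- move=> m; apply: aeW => p; rewrite normrM ger0_norm ?bump_ge0//.
  by rewrite ler_piMl// bump_le1.
- apply: aeW => p; apply: cvgM; [exact: bump_cvg|exact: cvg_cst].
Qed.

(** The integrals over open boxes inside [O] vanish as limits of pairings with bumps.
    Inside a fixed box, the intersections with quadrants are again boxes up to null sets,
    so that [ae0_of_quadrants] applies; countably many boxes cover [O]. *)
Lemma du_bois_reymond O g : open O ->
  (forall q, closed_box q `<=` O -> intg mu2 (fun p => \1_(closed_box q) p * g p)) ->
  (forall phi, test_function O phi -> \int[mu2]_p (\1_O p * (phi p * g p)) = 0) ->
  {ae mu2, forall p, O p -> g p = 0}.
Proof.
move=> oO ig g0.
have H k : {ae mu2, forall p, closed_box (rat_box k) `<=` O ->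
    open_box (rat_box k) p -> g p = 0}.
  have [BO|nB] := pselect (closed_box (rat_box k : R * R * R * R) `<=` O); last first.
    by apply: aeW => p /nB.
  set B : R * R * R * R := rat_box k; have iB := ig _ BO.
  have oc (q : R * R * R * R) : open_box q `<=` closed_box q.
    by move=> p [/andP[h1 h2] /andP[h3 h4]]; split; rewrite ?(ltW h1) ?(ltW h2) ?(ltW h3) ?(ltW h4).
  pose G p := \1_(open_box B) p * g p.
  have iG : intg mu2 G.
    apply: intg_ext (intg_indic (@measurable_open_box R B) iB) => p.
    rewrite mulrA /G; congr (_ * _); rewrite !indicE.
    have [/set_mem h|_] := boolP (p \in open_box B); last by rewrite mul0r.
    by rewrite mul1r mem_set//; exact: oc.
  suff : {ae mu2, forall p, G p = 0}.
    by apply: aeS => p + _ pB; rewrite /G indicE mem_set// mul1r.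
  apply: ae0_of_quadrants => // r s.
  pose q : R * R * R * R :=
    (B.1.1.1, Num.min B.1.1.2 (ratr r), B.1.2, Num.min B.2 (ratr s)).
  have qB : closed_box q `<=` closed_box B.
    by move=> p; rewrite /closed_box /= !le_min => -[/andP[-> /andP[-> _]] /andP[-> /andP[-> _]]].
  have qO : closed_box q `<=` O by exact: subset_trans BO.
  have E0 : \int[mu2]_p (\1_(open_box q) p * (\1_(closed_box B) p * g p)) = 0.
    have := Rint_bump_cvg (q := q) iB.
    have -> : (fun m => \int[mu2]_p (bump q m p * (\1_(closed_box B) p * g p))) = (fun=> 0).
      apply/funext => m; rewrite -(g0 _ (bump_test m qO)); apply: eq_Rint => p.
      have [h|h] := pselect (open_box q p); last by rewrite bump_off// !mul0r mulr0.
      have h1 := oc _ _ h; rewrite !indicE mem_set ?(mem_set (qO _ h1)) ?mul1r//.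
      exact: qB.
    by move=> /cvg_lim <- //; rewrite lim_cst.
  rewrite -[RHS]E0; apply: Rint_ae_eq.
  - have mG := intg_measurable iG.
    by apply: measurable_funM; [meas|apply: measurable_funM mG; meas].
  - apply: measurable_funM (intg_measurable iB); apply: measurable_indic.
    exact: measurable_open_box.
  have := ae_fst (ae_neq (ratr r)); apply: aeS2 (ae_snd (ae_neq (ratr s))) => p ps pr.
  rewrite /G !mulrA; congr (_ * _).
  have [h|h] := pselect (open_box B p); last first.
    rewrite [\1_(open_box B) p]indicE memNset// mulr0 indicE memNset ?mul0r// => h1.
    by apply: h; move: h1; rewrite /open_box /= !lt_min => -[/andP[-> /andP[-> _]] /andP[-> /andP[-> _]]].
  rewrite [\1_(open_box B) p]indicE [\1_(closed_box B) p]indicE !mem_set//; last exact: oc.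
  rewrite !mulr1 !le_eqVlt (negbTE ps) (negbTE pr) /= -natrM mulnb indicE.
  congr (nat_of_bool _)%:R.
  case: h => [/andP[h1 h2] /andP[h3 h4]].
  apply/idP/idP => [/andP[h5 h6]|/set_mem].
    by apply/mem_set; rewrite /open_box /= !lt_min h1 h2 h3 h4 h5 h6.
  by rewrite /open_box /= !lt_min => -[/andP[_ /andP[_ ->]] /andP[_ /andP[_ ->]]].
have := ae_foralln H; apply: aeS => p hp Op.
by have [k [h1 h2]] := open_rat_boxes oO Op; exact: hp h1.
Qed.

End du_bois_reymond_lemma.

(** * Vectors and the nonlinearity *)

Section vectors.
Context {R : realType}.
Implicit Types (m n : nat) (M c : R).

Lemma mxnorm_entry m n (A : 'M[R]_(m, n)) i j : `|A i j| <= `|A|.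
Proof.
rewrite [leRHS]/Num.norm /= mx_normrE.
exact: (le_bigmax _ (fun ij : 'I_m * 'I_n => `|A ij.1 ij.2|) (i, j)).
Qed.

Lemma mxnorm_le m n (A : 'M[R]_(m, n)) c : 0 <= c ->
  (forall i j, `|A i j| <= c) -> `|A| <= c.
Proof.
move=> c0 Ac; have [->|/mx_norm_neq0] := eqVneq `|A| 0; first by [].
by rewrite [leLHS]/Num.norm /= => -[[i j] ->] /=; exact: Ac.
Qed.

Lemma colnorm_le n (v : 'cV[R]_n) c : 0 <= c ->
  (forall i, `|v i ord0| <= c) -> `|v| <= c.
Proof. by move=> c0 vc; apply: mxnorm_le => // i j; rewrite ord1. Qed.

Lemma colnorm_le_sum n (v : 'cV[R]_n) : `|v| <= \sum_i `|v i ord0|.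
Proof.
apply: colnorm_le => [|i]; first exact: sumr_ge0.
by rewrite (bigD1 i) //= lerDl sumr_ge0.
Qed.

Lemma mulmx_norm m n (A : 'M[R]_(m, n)) (v : 'cV[R]_n) :
  `|A *m v| <= n%:R * (`|A| * `|v|).
Proof.
apply: mxnorm_le; first by rewrite !mulr_ge0.
move=> i j; rewrite mxE; apply: (le_trans (ler_norm_sum _ _ _)).
rewrite mulr_natl -[X in _ *+ X]card_ord -sumr_const; apply: ler_sum => k _.
by rewrite normrM ler_pM// mxnorm_entry.
Qed.

(** One constant for the finitely many functions [Gamma j k]. *)
Lemma finite_uniform (T : finType) (Q : T -> R -> Prop) :
  (forall t M M', M <= M' -> Q t M -> Q t M') -> (forall t, exists M, Q t M) ->
  exists2 M : R, 0 < M & forall t, Q t M.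
Proof.
move=> mon /choice[b hb]; exists (1 + \sum_t `|b t|).
  by rewrite ltr_wpDr// sumr_ge0.
move=> t; apply: mon (hb t); rewrite (le_trans (ler_norm _))//.
by rewrite (bigD1 t) //= addrCA lerDl addr_ge0// sumr_ge0.
Qed.

Lemma bounded_uniform (V W : normedModType R) (T : finType) (g : T -> V -> W) :
  (forall t, [bounded g t w | w in [set: V]]) ->
  exists2 M : R, 0 < M & forall t w, `|g t w| <= M.
Proof.
move=> bg; apply: (@finite_uniform _ (fun t M => forall w, `|g t w| <= M)).
  by move=> t M M' MM h w; exact: le_trans (h w) MM.
move=> t; have [M [_ h]] := bg t; exists (M + 1) => w.
by apply: (h (M + 1)) => //; rewrite ltrDl.
Qed.

Lemma lipschitz_uniform (V W : normedModType R) (T : finType) (g : T -> V -> W) :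
  (forall t, lipschitz (g t)) ->
  exists2 M : R, 0 < M & forall t w w', `|g t w - g t w'| <= M * `|w - w'|.
Proof.
move=> lg; apply: (@finite_uniform _ (fun t M => forall w w', `|g t w - g t w'| <= M * `|w - w'|)).
  by move=> t M M' MM h w w'; apply: le_trans (h w w') _; rewrite ler_wpM2r.
move=> t; have [M [_ h]] := lg t; exists (M + 1) => w w'.
by apply: (h (M + 1) _ (w, w')) => //; rewrite ltrDl.
Qed.

Lemma continuous_cols n (w : R * R -> 'cV[R]_n) :
  (forall i, continuous (fun p => w p i ord0)) -> continuous w.
Proof.
move=> cw p; apply/cvgrPdist_le => e e0.
have : \forall q \near p, forall i : 'I_n, `|w p i ord0 - w q i ord0| <= e.
  apply: (@filter_forall _ _ (fun (i : 'I_n) q => `|w p i ord0 - w q i ord0| <= e) (nbhs p)) => i.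
  by have /cvgrPdist_le := cw i p; apply.
apply: filterS => q h; apply: colnorm_le; first exact: ltW.
by move=> i; rewrite !mxE; exact: h.
Qed.

Lemma continuous_lipschitz_entry m1 m2 n (g : 'cV[R]_n -> 'M[R]_(m1, m2)) i j
    (w : R * R -> 'cV[R]_n) : lipschitz g -> continuous w ->
  continuous (fun p => g (w p) i j).
Proof.
move=> lg cw p; have [M M0 hM] := @lipschitz_uniform _ _ unit (fun=> g) (fun=> lg).
apply/cvgrPdist_le => e e0.
have /cvgrPdist_le /(_ (e / M) (divr_gt0 e0 M0)) := cw p.
apply: filterS => q h; have := mxnorm_entry (g (w p) - g (w q)) i j.
rewrite !mxE => /le_trans; apply; apply: (le_trans (hM tt _ _)).
by rewrite mulrC -ler_pdivlMr.
Qed.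

End vectors.

Section nonlinearity.
Context {R : realType} {n : nat}.
Variables (Gamma : 'I_n -> 'I_n -> 'cV[R]_n -> 'cV[R]_n) (P : 'cV[R]_n -> 'M[R]_n).
Hypotheses (Gamma_bounded : forall j k, [bounded Gamma j k w | w in [set: 'cV[R]_n]])
  (Gamma_lipschitz : forall j k, lipschitz (Gamma j k))
  (P_bounded : [bounded P w | w in [set: 'cV[R]_n]]) (P_lipschitz : lipschitz P).
Implicit Types (u a b p q g : 'cV[R]_n).

Definition nonlin u a b g : 'cV[R]_n :=
  \sum_j \sum_k (a j ord0 * a k ord0 - b j ord0 * b k ord0) *: Gamma j k u
  + P u *m g.

Let null p q j k : R :=
  2^-1 * (p j ord0 * q k ord0 + q j ord0 * p k ord0).

(** The null structure: with [p = ut + ux] and [q = ut - ux] the products of two entries of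
    [p], and those of two entries of [q], cancel in the difference of the quadratic
    terms. *)
Lemma nonlin_null u p q g :
  nonlin u (2^-1 *: (p + q)) (2^-1 *: (p - q)) g =
  \sum_j \sum_k null p q j k *: Gamma j k u + P u *m g.
Proof.
congr (_ + _); apply: eq_bigr => j _; apply: eq_bigr => k _; congr (_ *: _).
by rewrite !mxE /null; field.
Qed.

Let null_le p q j k : `|null p q j k| <= `|p| * `|q|.
Proof.
rewrite /null normrM ger0_norm ?invr_ge0//.
have h1 : `|p j ord0 * q k ord0| <= `|p| * `|q|.
  by rewrite normrM ler_pM// mxnorm_entry.
have h2 : `|q j ord0 * p k ord0| <= `|p| * `|q|.
  by rewrite normrM mulrC ler_pM// mxnorm_entry.
have := ler_normD (p j ord0 * q k ord0) (q j ord0 * p k ord0).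
move: h1 h2; lra.
Qed.

Let null_dist p p' q q' j k :
  `|null p q j k - null p' q' j k| <= `|p - p'| * `|q| + `|p'| * `|q - q'|.
Proof.
have -> : null p q j k - null p' q' j k = null (p - p') q j k + null p' (q - q') j k.
  by rewrite /null !mxE; ring.
by apply: le_trans (ler_normD _ _) _; rewrite lerD// null_le.
Qed.

Let sum2_le (v : 'I_n -> 'I_n -> 'cV[R]_n) (c : R) :
  (forall j k, `|v j k| <= c) -> `|\sum_j \sum_k v j k| <= (n * n)%:R * c.
Proof.
move=> vc; have sum1 (x : 'I_n -> 'cV[R]_n) (b : R) : (forall i, `|x i| <= b) ->
    `|\sum_i x i| <= n%:R * b.
  move=> xb; apply: (le_trans (ler_norm_sum _ _ _)).
  rewrite mulr_natl -[X in _ *+ X]card_ord -sumr_const.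
  by apply: ler_sum => i _; exact: xb.
by rewrite natrM -mulrA; apply: (sum1) => j; apply: (sum1) => k; exact: vc.
Qed.

(** The bilinear form of [nonlin_null] and the bounds and Lipschitz constants of the
    coefficients; the last two terms are the two halves of the difference of a product. *)
Lemma nonlin_bounds : exists2 CN : R, 0 < CN &
  (forall u p q g, `|nonlin u (2^-1 *: (p + q)) (2^-1 *: (p - q)) g| <=
     CN * (`|p| * `|q| + `|g|)) /\
  (forall u u' p p' q q' g,
     `|nonlin u (2^-1 *: (p + q)) (2^-1 *: (p - q)) g -
       nonlin u' (2^-1 *: (p' + q')) (2^-1 *: (p' - q')) g| <=
     CN * (`|u - u'| * (`|p| * `|q| + `|g|) + `|p - p'| * `|q| + `|p'| * `|q - q'|)).
Proof.
have [M1 M10 h1] := @bounded_uniform R _ _ ('I_n * 'I_n)%type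
  (fun t => Gamma t.1 t.2) (fun t => Gamma_bounded t.1 t.2).
have [M2 M20 h2] := @lipschitz_uniform R _ _ ('I_n * 'I_n)%type
  (fun t => Gamma t.1 t.2) (fun t => Gamma_lipschitz t.1 t.2).
have [M3 M30 h3] := @bounded_uniform R _ _ unit (fun=> P) (fun=> P_bounded).
have [M4 M40 h4] := @lipschitz_uniform R _ _ unit (fun=> P) (fun=> P_lipschitz).
pose M := M1 + M2 + M3 + M4.
have M0 : 0 < M by rewrite /M !addr_gt0.
have b1 j k u : `|Gamma j k u| <= M.
  by apply: le_trans (h1 (j, k) u) _; move: M10 M20 M30 M40; rewrite /M; lra.
have b2 j k u u' : `|Gamma j k u - Gamma j k u'| <= M * `|u - u'|.
  apply: le_trans (h2 (j, k) u u') _; rewrite ler_wpM2r//.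
  by move: M10 M20 M30 M40; rewrite /M; lra.
have b3 u : `|P u| <= M.
  by apply: le_trans (h3 tt u) _; move: M10 M20 M30 M40; rewrite /M; lra.
have b4 u u' : `|P u - P u'| <= M * `|u - u'|.
  apply: le_trans (h4 tt u u') _; rewrite ler_wpM2r//.
  by move: M10 M20 M30 M40; rewrite /M; lra.
pose CN := (n * n)%:R * M + n%:R * M + 1.
have CN0 : 0 < CN by rewrite /CN ltr_wpDl// addr_ge0// mulr_ge0// ltW.
have c1 (x : R) : 0 <= x -> (n * n)%:R * (M * x) <= CN * x.
  move=> x0; rewrite mulrA ler_wpM2r// /CN -addrA lerDl addr_ge0//.
  by rewrite mulr_ge0// ltW.
have c2 (x : R) : 0 <= x -> n%:R * (M * x) <= CN * x.
  move=> x0; rewrite mulrA ler_wpM2r// /CN addrAC lerDr addr_ge0//.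
  by rewrite mulr_ge0// ltW.
exists CN => //; split=> [u p q g|u u' p p' q q' g].
  rewrite nonlin_null; apply: (le_trans (ler_normD _ _)).
  rewrite mulrDr lerD//.
    apply: le_trans (c1 _ _); last by rewrite mulr_ge0.
    apply: sum2_le => j k; rewrite normrZ mulrC.
    by apply: ler_pM => //; exact: null_le.
  apply: le_trans (mulmx_norm _ _) _.
  by apply: le_trans (c2 _ _) => //; rewrite ler_wpM2l// ler_wpM2r.
rewrite !nonlin_null opprD addrACA -sumrB -mulmxBl.
apply: (le_trans (ler_normD _ _)).
have -> (a b c d e : R) : a * (b + c) + d + e = (a * b + d + e) + a * c by ring.
rewrite mulrDr lerD//; last first.
  apply: le_trans (mulmx_norm _ _) _; apply: le_trans (c2 _ _).
    by rewrite ler_wpM2l// mulrA ler_wpM2r.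
  by rewrite mulr_ge0.
under eq_bigr do rewrite -sumrB.
apply: le_trans (c1 _ _); last by rewrite !addr_ge0// !mulr_ge0.
apply: sum2_le => j k.
have -> : null p q j k *: Gamma j k u - null p' q' j k *: Gamma j k u' =
  null p q j k *: (Gamma j k u - Gamma j k u') +
  (null p q j k - null p' q' j k) *: Gamma j k u'.
  by rewrite scalerBr scalerBl addrA subrK.
apply: (le_trans (ler_normD _ _)).
rewrite (normrZ (null p q j k)) (normrZ (null p q j k - _)) -addrA mulrDr lerD//.
  rewrite [X in _ <= M * X]mulrC mulrCA.
  by apply: ler_pM => //; exact: null_le.
by rewrite [leRHS]mulrC; apply: ler_pM => //; exact: null_dist.
Qed.

End nonlinearity.

(** * The interaction of opposite waves in a thin slab *)

Section interaction.
Context {R : realType}.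
Local Notation mu := (lebesgue1 R).
Local Notation mu2 := (lebesgue2 R).
Local Notation Rm := (measurableTypeR R).
Implicit Types (a : R -> R) (g H : R * R -> R) (s h e z c k th : R) (p : R * R).

(** The majorant of the right-hand side when the derivatives along the two families of
    characteristics are bounded by [a]; [g] stands for the forcing. *)
Definition interaction a g p : R := a (p.2 + p.1) * a (p.2 - p.1) + g p.

Definition slab s h H p : R := (s <= p.1 <= s + h)%R%:R * H p.

Lemma interaction_char a g c s z : c * c = 1 ->
  interaction a g (s, z - c * s) = a z * a (z + (-2 * c) * s) + g (s, z - c * s).
Proof.
move=> /eqP; rewrite -expr2 sqrf_eq1 => /orP[] /eqP ->; rewrite /interaction /=.
  by rewrite !mul1r subrK; congr (_ * a _ + _); ring.
by rewrite [X in X + _]mulrC; congr (a _ * a _ + _); ring.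
Qed.

(** The product is the tensor product of [a] with itself in characteristic
    coordinates: the null structure enters here. *)
Lemma intg_interaction a g : intg mu a -> intg mu2 g -> intg mu2 (interaction a g).
Proof.
move=> ia ig; apply: intgD => //.
have ma := intg_measurable ia.
have H : intg mu2 (fun p => a p.1 * a (p.1 + (-2) * p.2)).
  apply: (@intg_tonelli _ _ (fun z => `|a z| * (2^-1 * \int[mu]_x `|a x|))).
  - apply: measurable_funM; first exact: (measurableT_comp ma measurable_fst).
    by apply: (measurableT_comp ma); apply: measurable_toRm; meas.
  - by apply: (intg_ext _ (intgZ (2^-1 * \int[mu]_x `|a x|) (intg_norm ia))) => x; rewrite mulrC.
  apply: aeW => z; have i2 : intg mu (fun x => a (z + -2 * x)).
    by apply: intg_affine => //; rewrite oppr_eq0 pnatr_eq0.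
  rewrite /=; split; first by have := intgZ (a z) i2.
  under eq_Rint => x do rewrite /= normrM.
  rewrite (RintZ _ (intg_norm i2)).
  have -> : \int[mu]_x `|a (z + -2 * x)| = 2^-1 * \int[mu]_x `|a x|.
    rewrite (Rint_affine z (k := -2) _ (intg_norm ia)); last by rewrite oppr_eq0 pnatr_eq0.
    by rewrite invrN normrN ger0_norm// invr_ge0.
  by [].
have := intg_char (-1) (intg_swap H); apply: intg_ext => p /=.
by rewrite mulN1r opprK; congr (_ * a _); ring.
Qed.

Lemma measurable_slab s h H : measurable_fun setT (H : Rm * Rm -> R) ->
  measurable_fun setT (slab s h H : Rm * Rm -> R).
Proof. by move=> mH; apply: measurable_funM mH; meas. Qed.

Lemma intg_slab s h H : intg mu2 H -> intg mu2 (slab s h H).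
Proof.
move=> iH; apply: intg_le (intg_norm iH) _; last by move=> p; exact: norm_bool_le.
exact: measurable_slab (intg_measurable iH).
Qed.

(** On the characteristic [z] the first term is [a z] times an integral of [a] over a short
    interval, which is small uniformly in [z] and [s].  The forcing term has no such
    factor [a z]; it is bounded by all of [charmass c g z], which the last
    hypothesis makes small relative to [a z].  For the total mass the forcing term is small
    because the slab is thin. *)
Lemma small_interaction a g th : 0 < th -> (forall z, 0 <= a z) ->
  (forall p, 0 <= g p) -> intg mu a -> intg mu2 g ->
  (forall c z, c * c = 1 -> 2 * charmass c g z <= th * a z) ->
  exists2 h0, 0 < h0 & forall s h, h <= h0 ->
    (forall c, c * c = 1 -> {ae mu, forall z,
       \int[mu]_t slab s h (interaction a g) (t, z - c * t) <= th * a z}) /\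
    \int[mu2]_p slab s h (interaction a g) p <= th.
Proof.
move=> th0 a0 g0 ia ig ca.
pose A := \int[mu]_x a x; have A0 : 0 <= A by exact: Rint_ge0.
(* Half of [th] is for the quadratic term: [e] itself along characteristics, and [e * A]
   after integration over all of them; the other half is for the forcing. *)
pose e := th / 2 / (1 + A).
have A1 : 0 < 1 + A by rewrite ltr_pwDl.
have e0 : 0 < e by rewrite !divr_gt0.
have ie := intg_timemass ig.
have n2 : (-2 : R) != 0 by rewrite oppr_eq0 pnatr_eq0.
have p2 : (2 : R) != 0 by rewrite pnatr_eq0.
have [h1 h10 H1] := small_affine ia n2 e0.
have [h2 h20 H2] := small_affine ia p2 e0.
have [d d0 H3] := intg_small ie (divr_gt0 th0 (ltr0Sn R 1)).
exists (Num.min (Num.min h1 h2) (d / 2)); first by rewrite !lt_min h10 h20 divr_gt0.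
move=> s h; rewrite !le_min => /andP[/andP[hh1 hh2] hd].
have mono h' k z : h <= h' -> k != 0 ->
    \int[mu]_t (\1_(`[s, s + h]%classic) t * `|a (z + k * t)|) <=
    \int[mu]_t (\1_(`[s, s + h']%classic) t * `|a (z + k * t)|).
  move=> hh k0; have iak := intg_norm (intg_affine z k0 ia).
  apply: Rint_le => [||t]; try exact: intg_itv.
  rewrite ler_wpM2r// !indic_itvE ler_nat !in_itv /=.
  by case: (s <= t) => //=; case: leP => // /le_trans -> //; rewrite lerD2l.
have small c z : c * c = 1 ->
    \int[mu]_t (\1_(`[s, s + h]%classic) t * `|a (z + (-2 * c) * t)|) <= e.
  move=> /eqP; rewrite -expr2 sqrf_eq1 => /orP[] /eqP ->.
    by rewrite mulr1; apply: le_trans (mono _ _ _ hh1 n2) _; exact/ltW/H1.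
  by rewrite mulrNN mulr1; apply: le_trans (mono _ _ _ hh2 p2) _; exact/ltW/H2.
pose gpart c z := \int[mu]_t (\1_(`[s, s + h]%classic) t * `|g (t, z - c * t)|).
have split_char c : c * c = 1 -> {ae mu, forall z,
    \int[mu]_t slab s h (interaction a g) (t, z - c * t) <= e * a z + gpart c z /\
    gpart c z <= charmass c g z}.
  move=> cc; have := intg_char_ae c ig; apply: aeS => z igz.
  have c0 : -2 * c != 0.
    rewrite mulf_neq0//; apply/eqP => c00; move/eqP: cc.
    by rewrite c00 mul0r eq_sym oner_eq0.
  have i1 := intgZ (a z) (intg_itv `[s, s + h] (intg_norm (intg_affine z c0 ia))).
  have i2 := intg_itv `[s, s + h] (intg_norm igz).
  split; last first.
    apply: Rint_le => //; first exact: intg_norm.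
    by move=> t; rewrite indic_itvE; case: (t \in _); rewrite ?mul1r ?mul0r.
  have E t : slab s h (interaction a g) (t, z - c * t) =
      a z * (\1_(`[s, s + h]%classic) t * `|a (z + (-2 * c) * t)|) +
      \1_(`[s, s + h]%classic) t * `|g (t, z - c * t)|.
    rewrite /slab interaction_char// indic_itvE in_itv /= !ger0_norm//.
    by rewrite mulrDr mulrCA.
  have -> : \int[mu]_t slab s h (interaction a g) (t, z - c * t) =
      a z * \int[mu]_t (\1_(`[s, s + h]%classic) t * `|a (z + (-2 * c) * t)|) +
      gpart c z.
    have iA := intg_itv `[s, s + h] (intg_norm (intg_affine z c0 ia)).
    have EZ := RintZ (a z) iA; have ED := RintD i1 i2.
    transitivity (\int[mu]_t (a z * (\1_(`[s, s + h]%classic) t *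
        `|a (z + (-2 * c) * t)|) + \1_(`[s, s + h]%classic) t * `|g (t, z - c * t)|)).
      by apply: eq_Rint => t; exact: E.
    apply: etrans ED _.
    by congr (_ + _); exact: EZ.
  rewrite lerD2r.
  by rewrite mulrC ler_wpM2r//; exact: small.
split=> [c cc|].
  have := split_char _ cc; apply: aeS => z [b1 b2].
  apply: le_trans b1 _; have := ca c z cc.
  have : e * a z <= th / 2 * a z.
    rewrite ler_wpM2r// /e ler_pdivrMr// ler_peMr ?lerDl//.
    by rewrite divr_ge0// ltW.
  by move: b2; clear; lra.
have cc1 : 1 * 1 = 1 :> R by exact: mulr1.
have iI := intg_slab s h (intg_interaction ia ig).
rewrite -(Rint_char 1 iI) Rint_fubiniC; last exact: intg_char.
have [ig1 Eg1] := Rint_slab 1 s (s + h) ig.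
apply: (@le_trans _ _ (\int[mu]_z (e * a z + gpart 1 z))).
  apply: Rint_le_ae.
  - exact: intg_fubiniC (intg_char 1 iI).
  - by apply: intgD; [exact: intgZ|exact: ig1].
  by have := split_char _ cc1; apply: aeS => z [].
rewrite RintD; [|exact: intgZ|exact: ig1].
rewrite RintZ// Eg1.
have b1 : e * A <= th / 2.
  by rewrite /e mulrAC ler_pdivrMr// ler_wpM2l ?lerDr// divr_ge0// ltW.
have b2 : \int[mu]_t (\1_(`[s, s + h]%classic) t * \int[mu]_x `|g (t, x)|) <= th / 2.
  apply: le_trans (ltW (H3 s (s + h) _)).
    by rewrite le_eqVlt; apply/orP; left; apply/eqP/eq_Rint => t; rewrite ger0_norm// Rint_ge0.
  by rewrite addrAC subrr add0r; apply: le_lt_trans hd _; rewrite ltr_pdivrMr// ltr_pMr// ltr1n.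
by move: b1 b2; rewrite -/A; move: (\int[mu]_t _) => B; move: (e * A) => E; clear; lra.
Qed.

End interaction.

(** * Contraction in a thin slab *)

Lemma colnorm_dist (R : realType) n (v w : 'cV[R]_n) i :
  `|v i ord0 - w i ord0| <= `|v - w|.
Proof. by have := mxnorm_entry (v - w) i ord0; rewrite !mxE. Qed.

Section arithmetic.
Variable R : realType.
Implicit Types x y z w : R.

Lemma half_le x y : 0 <= x -> x <= y -> 2^-1 * x <= y.
Proof. by lra. Qed.

Lemma half_add x y z w : z <= w -> w <= 2^-1 * y -> 2 * x <= y -> x + z <= y.
Proof. by lra. Qed.

Lemma add3_le x y z w : x <= w -> y <= w -> z <= w -> x + y + z <= 3 * w.
Proof. by lra. Qed.

End arithmetic.

Section contraction.
Context {R : realType} {n : nat}.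
Local Notation mu := (lebesgue1 R).
Local Notation mu2 := (lebesgue2 R).
Local Notation Rm := (measurableTypeR R).
Variables (Gamma : 'I_n -> 'I_n -> 'cV[R]_n -> 'cV[R]_n) (P : 'cV[R]_n -> 'M[R]_n).
Hypotheses (Gamma_lipschitz : forall j k, lipschitz (Gamma j k))
  (P_lipschitz : lipschitz P).
Variables (f : R * R -> 'cV[R]_n) (C : 'I_n -> R) (p0 q0 : 'I_n -> R -> R).
Hypotheses (jf : forall i, intg mu2 (fun p => f p i ord0))
  (ip0 : forall i, intg mu (p0 i)) (iq0 : forall i, intg mu (q0 i)).
Implicit Types (F : 'I_n -> R * R -> R) (a : R -> R) (p : R * R).

Definition wave_col F p : 'cV[R]_n := \col_i wave (C i) (p0 i) (q0 i) (F i) p.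
(** [ut + ux] and [ut - ux], which issue from the right and the left foot of the
    backward triangle. *)
Definition right_col F p : 'cV[R]_n := \col_i transp 1 (p0 i) (F i) p.
Definition left_col F p : 'cV[R]_n := \col_i transp (-1) (q0 i) (F i) p.

(** The right-hand side of the equation at the wave driven by [F]; solutions are the
    fixed points of [source] on their domain. *)
Definition source F i p : R :=
  nonlin Gamma P (wave_col F p) (2^-1 *: (right_col F p + left_col F p))
    (2^-1 *: (right_col F p - left_col F p)) (f p) i ord0.

Lemma wave_col_continuous F : (forall i, intg mu2 (F i)) -> continuous (wave_col F).
Proof.
move=> iF; apply: continuous_cols => i.
have -> : (fun p => wave_col F p i ord0) = wave (C i) (p0 i) (q0 i) (F i).
  by apply/funext => p; rewrite mxE.
exact: wave_continuous.
Qed.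

Lemma measurable_source F i : (forall i, intg mu2 (F i)) ->
  measurable_fun setT (source F i : Rm * Rm -> R).
Proof.
move=> iF; have cw := wave_col_continuous iF.
have mp j : measurable_fun setT (transp 1 (p0 j) (F j) : Rm * Rm -> R).
  exact: measurable_transp.
have mq j : measurable_fun setT (transp (-1) (q0 j) (F j) : Rm * Rm -> R).
  exact: measurable_transp.
have mG j k : measurable_fun setT
    ((fun p => Gamma j k (wave_col F p) i ord0) : Rm * Rm -> R).
  by apply: continuous_measurable2; apply: (continuous_lipschitz_entry (g := Gamma j k)).
have mP k : measurable_fun setT ((fun p => P (wave_col F p) i k) : Rm * Rm -> R).
  by apply: continuous_measurable2; apply: (continuous_lipschitz_entry (g := P)).
pose E p := \sum_j \sum_k
  ((2^-1 * (transp 1 (p0 j) (F j) p + transp (-1) (q0 j) (F j) p)) *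
   (2^-1 * (transp 1 (p0 k) (F k) p + transp (-1) (q0 k) (F k) p)) -
   (2^-1 * (transp 1 (p0 j) (F j) p - transp (-1) (q0 j) (F j) p)) *
   (2^-1 * (transp 1 (p0 k) (F k) p - transp (-1) (q0 k) (F k) p))) *
   Gamma j k (wave_col F p) i ord0 +
  \sum_k P (wave_col F p) i k * f p k ord0.
have mf k := intg_measurable (jf k).
have mt j : measurable_fun setT
    ((fun p => 2^-1 * (transp 1 (p0 j) (F j) p + transp (-1) (q0 j) (F j) p)) : Rm * Rm -> R).
  by apply: measurable_funM (measurable_cst _) _; exact: measurable_funD.
have mx j : measurable_fun setT
    ((fun p => 2^-1 * (transp 1 (p0 j) (F j) p - transp (-1) (q0 j) (F j) p)) : Rm * Rm -> R).
  by apply: measurable_funM (measurable_cst _) _; exact: measurable_funB.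
have -> : source F i = E.
  apply/funext => p; rewrite /source /nonlin /E mxE; congr (_ + _).
    rewrite summxE; apply: eq_bigr => j _; rewrite summxE; apply: eq_bigr => k _.
    by rewrite !mxE.
  by rewrite mxE.
apply: measurable_funD.
  apply: measurable_sum => j; apply: measurable_sum => k.
  apply: measurable_funM (mG j k); apply: measurable_funB.
    exact: measurable_funM (mt j) (mt k).
  exact: measurable_funM (mx j) (mx k).
by apply: measurable_sum => k; apply: measurable_funM; [exact: mP|exact: mf].
Qed.

(** The same function [a] serves both families of characteristics. *)
Definition below a F := {ae mu2, forall p,
  `|right_col F p| <= a (p.2 + p.1) /\ `|left_col F p| <= a (p.2 - p.1)}.

Definition forcing_norm p : R := \sum_i `|f p i ord0|.

Lemma forcing_norm_ge0 p : 0 <= forcing_norm p.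
Proof. exact: sumr_ge0. Qed.

Lemma intg_forcing_norm : intg mu2 forcing_norm.
Proof. by apply: intg_sum => i; apply: intg_norm. Qed.

Variable CN : R.
Hypotheses (CN_gt0 : 0 < CN) (nonlin_le : forall u v w g : 'cV[R]_n,
    `|nonlin Gamma P u (2^-1 *: (v + w)) (2^-1 *: (v - w)) g| <=
     CN * (`|v| * `|w| + `|g|))
  (nonlin_dist : forall u u' v v' w w' g : 'cV[R]_n,
     `|nonlin Gamma P u (2^-1 *: (v + w)) (2^-1 *: (v - w)) g -
       nonlin Gamma P u' (2^-1 *: (v' + w')) (2^-1 *: (v' - w')) g| <=
     CN * (`|u - u'| * (`|v| * `|w| + `|g|) + `|v - v'| * `|w| + `|v'| * `|w - w'|)).
Variable a : R -> R.
Hypotheses (a_ge0 : forall z, 0 <= a z) (ia : intg mu a).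
Local Notation H := (interaction a forcing_norm).

Lemma interaction_ge0 p : 0 <= H p.
Proof. by rewrite addr_ge0 ?mulr_ge0// forcing_norm_ge0. Qed.

Lemma slab_ge0 s h p : 0 <= slab s h H p.
Proof. by rewrite mulr_ge0 ?interaction_ge0. Qed.

Lemma source_le F : below a F ->
  {ae mu2, forall p, forall i, `|source F i p| <= CN * H p}.
Proof.
apply: aeS => p [bp bq] i; apply: le_trans (mxnorm_entry _ _ _) _.
apply: le_trans (nonlin_le _ _ _ _) _; rewrite ler_wpM2l ?(ltW CN_gt0)//.
by rewrite lerD ?colnorm_le_sum// ler_pM.
Qed.

Section small_slab.
(** [6^-1] serves both uses: the fixed point is sought among sources below [2 * CN] times the
    majorant, which needs [2 * CN * th <= 2^-1], and the three terms of the
    Lipschitz bound give the factor [3 * CN * th <= 2^-1] in [contraction]. *)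
Variables (s h th : R).
Hypotheses (th0 : 0 < th) (CNth : CN * th <= 6^-1).
Hypotheses (small_char : forall c, c * c = 1 -> {ae mu, forall z,
       \int[mu]_t slab s h H (t, z - c * t) <= th * a z})
  (small_total : \int[mu2]_p slab s h H p <= th).

Let iS : intg mu2 (slab s h H).
Proof. exact/intg_slab/intg_interaction/intg_forcing_norm. Qed.

Let cc1 : 1 * 1 = 1 :> R. Proof. exact: mulr1. Qed.
Let ccN1 : -1 * -1 = 1 :> R. Proof. by rewrite mulrNN mulr1. Qed.

Lemma duhamel_slab c k G : c * c = 1 -> 0 <= k ->
  measurable_fun setT (G : Rm * Rm -> R) ->
  {ae mu2, forall p, `|G p| <= k * slab s h H p} ->
  {ae mu, forall z, forall t, `|duhamel c G (t, z - c * t)| <= k * (th * a z)}.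
Proof.
move=> cc k0 mG Gk; have iSk := intgZ k iS.
have := duhamel_bound c mG iSk Gk.
have := intg_char_ae c iS; apply: aeS3 (small_char cc) => z sz iz + t.
move=> /(_ t)/le_trans; apply.
by rewrite (RintZ _ iz) ler_wpM2l.
Qed.

Lemma potential_slab k G p : 0 <= k ->
  measurable_fun setT (G : Rm * Rm -> R) ->
  {ae mu2, forall p, `|G p| <= k * slab s h H p} ->
  `|potential G p| <= k * th.
Proof.
move=> k0 mG Gk; have := potential_bound p mG (intgZ k iS) Gk.
move=> /le_trans; apply; rewrite (RintZ _ iS).
apply: half_le; last exact: ler_wpM2l.
by rewrite mulr_ge0// Rint_ge0// => q; exact: slab_ge0.
Qed.

(** Half of [a] is for the data, half for the source. *)
Lemma below_of_slab k F : 0 <= k -> k * th <= 2^-1 ->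
  (forall i z, 2 * `|p0 i z| <= a z) -> (forall i z, 2 * `|q0 i z| <= a z) ->
  (forall i, measurable_fun setT (F i : Rm * Rm -> R)) ->
  (forall i, {ae mu2, forall p, `|F i p| <= k * slab s h H p}) -> below a F.
Proof.
move=> k0 kth hp hq mF Fk.
have B c (r : 'I_n -> R -> R) : c * c = 1 -> (forall i z, 2 * `|r i z| <= a z) ->
    {ae mu2, forall p, forall i, `|transp c (r i) (F i) p| <= a (p.2 + c * p.1)}.
  move=> cc hr; apply: ae_ord => i.
  apply: (@ae_char_points _ c (fun t x => `|transp c (r i) (F i) (t, x)| <= a (x + c * t))).
  have := duhamel_slab cc k0 (mF i) (Fk i); apply: aeS => z hz t.
  rewrite /transp /= subrK; apply: le_trans (ler_normD _ _) _.
  apply: half_add (hz t) _ (hr i z).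
  by rewrite mulrA ler_wpM2r.
apply: aeS2 (B _ _ cc1 hp) (B _ _ ccN1 hq) => p h1 h2; split.
  by apply: colnorm_le => // i; rewrite mxE; have := h1 i; rewrite mul1r.
by apply: colnorm_le => // i; rewrite mxE; have := h2 i; rewrite mulN1r.
Qed.

(** The three terms of the Lipschitz bound are estimated by [d * th] times the
    majorant: the wave itself by the total mass of the slab, its two transported
    derivatives by the mass on characteristics, which comes with the missing
    factor [a]. *)
Lemma contraction d F F' : 0 <= d ->
  (forall i, intg mu2 (F i)) -> (forall i, intg mu2 (F' i)) ->
  below a F -> below a F' ->
  (forall i, {ae mu2, forall p, p.1 <= s + h ->
     `|F i p - F' i p| <= d * slab s h H p}) ->
  {ae mu2, forall p, p.1 <= s + h ->
     forall i, `|source F i p - source F' i p| <= d / 2 * H p}.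
Proof.
move=> d0 iF iF' bF bF' dF.
(* Nothing is assumed after time [s + h]; by causality the difference may be cut off there. *)
pose D i p := (p.1 <= s + h)%R%:R * (F i p - F' i p).
have iB i : intg mu2 (fun p => F i p - F' i p) by exact: intgB.
have mB i := intg_measurable (iB i).
have mD i : measurable_fun setT (D i : Rm * Rm -> R).
  by apply: measurable_funM (mB i); meas.
have Dle i : {ae mu2, forall p, `|D i p| <= d * slab s h H p}.
  apply: aeS (dF i) => p; rewrite /D; case: leP => [_ /(_ isT)|_ _].
    by rewrite mul1r.
  by rewrite mul0r normr0 mulr_ge0// slab_ge0.
have DB i : {ae mu2, forall p, p.1 <= s + h -> F i p - F' i p = D i p}.
  by apply: aeW => p hp; rewrite /D hp mul1r.
have U p : p.1 <= s + h -> `|wave_col F p - wave_col F' p| <= d * th.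
  move=> hp; apply: colnorm_le => [|i]; first by rewrite mulr_ge0// ltW.
  rewrite !mxE /wave opprD addrACA subrr add0r.
  have -> : potential (F i) p - potential (F' i) p = potential (D i) p.
    rewrite -(potential_local (mB i) (mD i) (DB i) hp) /potential -mulrBr.
    rewrite -RintB; try by apply: (@intg_bool _ (in_tri p.1 p.2)) => //; exact: measurable_in_tri.
    by congr (_ * _); apply: eq_Rint => q; rewrite mulrBr.
  exact: potential_slab.
have V c (r : 'I_n -> R -> R) : c * c = 1 ->
    {ae mu2, forall p, forall i, p.1 <= s + h ->
     `|transp c (r i) (F i) p - transp c (r i) (F' i) p| <=
     d * (th * a (p.2 + c * p.1))}.
  move=> cc; apply: ae_ord => i.
  apply: (@ae_char_points _ c (fun t x => t <= s + h ->
    `|transp c (r i) (F i) (t, x) - transp c (r i) (F' i) (t, x)| <=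
     d * (th * a (x + c * t)))).
  have A1 := duhamel_slab cc d0 (mD i) (Dle i).
  have A2 := duhamel_local c (mB i) (mD i) (DB i).
  have A3 := aeS2 (fun z h1 h2 => conj h1 h2) (intg_char_ae c (iF i)) (intg_char_ae c (iF' i)).
  apply: aeS3 A1 A2 A3 => z h1 h2 [h3 h4] t ht.
  rewrite /transp /= subrK opprD addrACA subrr add0r.
  apply: le_trans (h1 t); rewrite -(h2 t ht) !duhamel_charE -RintB.
  - by under eq_Rint => x do rewrite -mulrBr.
  - have := intg_itv `[0, t] h3; apply: intg_ext => x.
    by rewrite indic_itvE in_itv.
  - have := intg_itv `[0, t] h4; apply: intg_ext => x.
    by rewrite indic_itvE in_itv.
have V1 := V _ p0 cc1; have V2 := V _ q0 ccN1.
have V12 := aeS2 (fun z h1 h2 => conj h1 h2) V1 V2.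
apply: aeS3 V12 bF bF' => p [v1 v2] [b1 b2] [b3 b4] hp i.
have : `|source F i p - source F' i p| <= `|nonlin Gamma P (wave_col F p)
    (2^-1 *: (right_col F p + left_col F p)) (2^-1 *: (right_col F p - left_col F p)) (f p)
    - nonlin Gamma P (wave_col F' p) (2^-1 *: (right_col F' p + left_col F' p))
    (2^-1 *: (right_col F' p - left_col F' p)) (f p)|.
  exact: colnorm_dist.
move=> /le_trans; apply; apply: le_trans (nonlin_dist _ _ _ _ _ _ _) _.
have w1 : `|right_col F p - right_col F' p| <= d * th * a (p.2 + p.1).
  apply: colnorm_le => [|j]; first by rewrite !mulr_ge0// ltW.
  by have := v1 j hp; rewrite mul1r !mxE -mulrA.
have w2 : `|left_col F p - left_col F' p| <= d * th * a (p.2 - p.1).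
  apply: colnorm_le => [|j]; first by rewrite !mulr_ge0// ltW.
  by have := v2 j hp; rewrite mulN1r !mxE -mulrA.
have dth : 0 <= d * th by rewrite mulr_ge0// ltW.
have X1 : `|wave_col F p - wave_col F' p| *
    (`|right_col F p| * `|left_col F p| + `|f p|) <= d * th * H p.
  apply: ler_pM => //; first exact: U.
  by rewrite lerD ?colnorm_le_sum// ler_pM.
have aaH : a (p.2 + p.1) * a (p.2 - p.1) <= H p by rewrite lerDl forcing_norm_ge0.
have X2 : `|right_col F p - right_col F' p| * `|left_col F p| <= d * th * H p.
  apply: (@le_trans _ _ (d * th * a (p.2 + p.1) * a (p.2 - p.1))).
    by apply: ler_pM.
  by rewrite -mulrA ler_wpM2l.
have X3 : `|right_col F' p| * `|left_col F p - left_col F' p| <= d * th * H p.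
  apply: (@le_trans _ _ (a (p.2 + p.1) * (d * th * a (p.2 - p.1)))).
    by apply: ler_pM.
  by rewrite mulrCA ler_wpM2l.
apply: (@le_trans _ _ (CN * (3 * (d * th * H p)))).
  by rewrite ler_wpM2l ?(ltW CN_gt0)//; exact: add3_le X1 X2 X3.
have -> : CN * (3 * (d * th * H p)) = 3 * (CN * th) * (d * H p) by ring.
have -> : d / 2 * H p = 3 * 6^-1 * (d * H p) by field.
by rewrite ler_wpM2r ?mulr_ge0 ?interaction_ge0// ler_wpM2l.
Qed.

End small_slab.
End contraction.

(** * Fixed points of the source map *)

Section real_sequences.
Context {R : realType}.
Implicit Types (x c : R) (u : nat -> R).

Lemma le_geometric_le0 x c : (forall m, x <= c * 2^-1 ^+ m) -> x <= 0.
Proof.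
move=> h; rewrite leNgt; apply/negP => x0.
have h2 : `|2^-1 : R| < 1 by rewrite ger0_norm// invf_lt1// ltr1n.
have /cvgrPdist_lt /(_ x x0) := cvg_geometric c h2.
case=> N _ /(_ N (leqnn N)) /=; rewrite sub0r normrN.
by move=> /(le_lt_trans (ler_norm _)); rewrite ltNge h.
Qed.

Lemma geometric_limit u c : 0 <= c ->
  (forall m, `|u m.+1 - u m| <= c * 2^-1 ^+ m) ->
  exists2 l, u m @[m --> \oo] --> l & forall m, `|l - u m| <= 2 * c * 2^-1 ^+ m.
Proof.
move=> c0 hu; pose g m : R := 2 * c * 2^-1 ^+ m.
have gS m : g m.+1 = c * 2^-1 ^+ m by rewrite /g exprS; field.
have g2 m : g m = 2 * (c * 2^-1 ^+ m) by rewrite /g mulrA.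
have mono (v : nat -> R) : (forall m, v m <= v m.+1) ->
    {homo v : m k / (m <= k)%N >-> m <= k}.
  by move=> hv; apply/nondecreasing_seqP.
pose w m := u m - g m; pose v m := - (u m + g m).
have hw : {homo w : m k / (m <= k)%N >-> m <= k}.
  apply: mono => m; have /ler_normlP[+ _] := hu m; rewrite /w gS g2.
  by move: (c * _) (u m) (u m.+1) => x y z; clear; lra.
have hv : {homo v : m k / (m <= k)%N >-> m <= k}.
  apply: mono => m; have /ler_normlP[_ +] := hu m; rewrite /v gS g2.
  by move: (c * _) (u m) (u m.+1) => x y z; clear; lra.
have g0 m : 0 <= g m by rewrite /g !mulr_ge0.
have wv m k : w m <= - v k.
  apply: (@le_trans _ _ (w (maxn m k))); first exact/hw/leq_maxl.
  apply: (@le_trans _ _ (- v (maxn m k))).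
    by rewrite /w /v opprK lerBlDr -addrA lerDl addr_ge0.
  by rewrite lerN2; exact/hv/leq_maxr.
have cg : g m @[m --> \oo] --> (0 : R).
  by apply: cvg_geometric; rewrite ger0_norm// invf_lt1// ltr1n.
have cw : cvgn w.
  by apply: nondecreasing_is_cvgn => //; exists (- v 0%N) => _ [m _ <-]; exact: wv.
have cu : u m @[m --> \oo] --> limn w.
  rewrite -[X in _ --> X]addr0; have -> : u = w \+ g by apply/funext => m /=; rewrite subrK.
  exact: cvgD.
exists (limn w) => // m; apply/ler_normlP; split.
  have := nondecreasing_cvgn_le hw cw m; rewrite /w /= -/(g m).
  by move: (limn _) (u m) (g m) => x y z; clear; lra.
have : limn w <= - v m by apply: limr_le => //; apply: nearW => k; exact: wv.
by rewrite /v -/(g m) opprK; move: (limn _) (u m) (g m) => x y z; clear; lra.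
Qed.

Lemma sum6 (x1 x2 x3 x4 x5 x6 y : R) : 0 <= x1 -> 0 <= x2 -> 0 <= x3 ->
    0 <= x4 -> 0 <= x5 -> 0 <= x6 ->
    [\/ y = x1 + x3, y = x1 + x5, y = x2 + x4 | y = x2 + x6] ->
  0 <= x1 + x2 + x3 + x4 + x5 + x6 - y.
Proof. by move=> ? ? ? ? ? ?; case=> ->; lra. Qed.

End real_sequences.

Section fixed_points.
Context {R : realType} {n : nat}.
Local Notation mu := (lebesgue1 R).
Local Notation mu2 := (lebesgue2 R).
Local Notation Rm := (measurableTypeR R).
Variables (Gamma : 'I_n -> 'I_n -> 'cV[R]_n -> 'cV[R]_n) (P : 'cV[R]_n -> 'M[R]_n).
Hypotheses (Gamma_bounded : forall j k, [bounded Gamma j k w | w in [set: 'cV[R]_n]])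
  (Gamma_lipschitz : forall j k, lipschitz (Gamma j k))
  (P_bounded : [bounded P w | w in [set: 'cV[R]_n]]) (P_lipschitz : lipschitz P).
Variables (f : R * R -> 'cV[R]_n) (C : 'I_n -> R) (p0 q0 : 'I_n -> R -> R).
Hypotheses (jf : forall i, intg mu2 (fun p => f p i ord0))
  (ip0 : forall i, intg mu (p0 i)) (iq0 : forall i, intg mu (q0 i)).
Implicit Types (F : 'I_n -> R * R -> R) (a b : R -> R) (p : R * R).
Local Notation source := (source Gamma P f C p0 q0).
Local Notation below := (below p0 q0).
Local Notation g := (forcing_norm f).

(** With this summand the forcing is small relative to the majorant, which is the last
    hypothesis of [small_interaction]. *)
Let majorant th b z := b z + 2 / th * (charmass 1 g z + charmass (-1) g z).

Let majorant_ge0 th b z : 0 < th -> (forall z, 0 <= b z) -> 0 <= majorant th b z.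
Proof.
by move=> t0 b0; rewrite addr_ge0// mulr_ge0 ?addr_ge0 ?charmass_ge0// divr_ge0// ltW.
Qed.

Let majorant_ge th b z : 0 < th -> b z <= majorant th b z.
Proof.
by move=> t0; rewrite lerDl mulr_ge0 ?addr_ge0 ?charmass_ge0// divr_ge0// ltW.
Qed.

Let intg_majorant th b : intg mu b -> intg mu (majorant th b).
Proof.
by move=> ib; apply: intgD => //; apply/intgZ/intgD; apply/intg_charmass/intg_forcing_norm.
Qed.

Let small_majorant th b : 0 < th -> (forall z, 0 <= b z) -> intg mu b ->
  exists2 h0 : R, 0 < h0 & forall s h, h <= h0 ->
    (forall c, c * c = 1 -> {ae mu, forall z,
       \int[mu]_t slab s h (interaction (majorant th b) g) (t, z - c * t) <=
       th * majorant th b z}) /\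
    \int[mu2]_p slab s h (interaction (majorant th b) g) p <= th.
Proof.
move=> th0 b0 ib; apply: small_interaction => //.
- by move=> z; exact: majorant_ge0.
- exact: forcing_norm_ge0.
- exact: intg_majorant.
- exact: intg_forcing_norm.
move=> c z /eqP; rewrite -expr2 sqrf_eq1 => cc.
have E : th * (2 / th * (charmass 1 g z + charmass (-1) g z)) =
    2 * charmass 1 g z + 2 * charmass (-1) g z.
  by rewrite mulrA mulrCA mulfV ?gt_eqF// mulr1 mulrDr.
rewrite /majorant mulrDr E; apply: ler_wpDl; first by rewrite mulr_ge0// ltW.
by case/orP: cc => /eqP ->; rewrite ?lerDl ?lerDr mulr_ge0// charmass_ge0.
Qed.

(** For a given fixed point there is no smallness, but its own mass along characteristics
    provides a majorant. *)
Let below_charmass a F : (forall i, intg mu2 (F i)) -> (forall z, 0 <= a z) ->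
  (forall i z, `|p0 i z| + charmass 1 (F i) z <= a z) ->
  (forall i z, `|q0 i z| + charmass (-1) (F i) z <= a z) -> below a F.
Proof.
move=> iF a0 hp hq.
have B c (r : 'I_n -> R -> R) : (forall i z, `|r i z| + charmass c (F i) z <= a z) ->
    {ae mu2, forall p, forall i, `|transp c (r i) (F i) p| <= a (p.2 + c * p.1)}.
  move=> hr; apply: ae_ord => i.
  apply: (@ae_char_points _ c (fun t x => `|transp c (r i) (F i) (t, x)| <= a (x + c * t))).
  have := duhamel_le_charmass c (iF i); apply: aeS => z hz t.
  rewrite /transp /= subrK; apply: le_trans (ler_normD _ _) _.
  by apply: le_trans (hr i z); rewrite lerD2l.
apply: aeS2 (B _ _ hp) (B _ _ hq) => p h1 h2; split.
  by apply: colnorm_le => // i; rewrite mxE; have := h1 i; rewrite mul1r.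
by apply: colnorm_le => // i; rewrite mxE; have := h2 i; rewrite mulN1r.
Qed.

Let ae_time_neq0 : {ae mu2, forall p, p.1 != 0}.
Proof. by have := ae_fst (ae_neq (0 : R)). Qed.

(** Gronwall in steps of fixed height: the difference of two fixed points that agree
    up to time [s] is supported in the next slab, where it is halved again and again. *)
Lemma source_unique (D : R * R -> bool) (T : R) F F' :
  (forall p, D p -> 0 <= p.1 <= T) ->
  (forall i, intg mu2 (F i)) -> (forall i, intg mu2 (F' i)) ->
  (forall i, {ae mu2, forall p, F i p = (D p)%:R * source F i p}) ->
  (forall i, {ae mu2, forall p, F' i p = (D p)%:R * source F' i p}) ->
  forall i, {ae mu2, forall p, F i p = F' i p}.
Proof.
move=> DT iF iF' eF eF'.
have [CN CN0 [nl nd]] := nonlin_bounds Gamma_bounded Gamma_lipschitz P_bounded P_lipschitz.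
pose th : R := (6 * CN)^-1; have th0 : 0 < th by rewrite invr_gt0 mulr_gt0.
have CNth : CN * th <= 6^-1 by rewrite /th invfM mulrCA mulfV ?gt_eqF// mulr1.
pose b z := \sum_i (`|p0 i z| + `|q0 i z| + charmass 1 (F i) z + charmass (-1) (F i) z +
  charmass 1 (F' i) z + charmass (-1) (F' i) z).
have t0 i z : 0 <= `|p0 i z| + `|q0 i z| + charmass 1 (F i) z + charmass (-1) (F i) z +
  charmass 1 (F' i) z + charmass (-1) (F' i) z by rewrite !addr_ge0// charmass_ge0.
have b0 z : 0 <= b z by exact: sumr_ge0.
have bi i z : `|p0 i z| + `|q0 i z| + charmass 1 (F i) z + charmass (-1) (F i) z +
  charmass 1 (F' i) z + charmass (-1) (F' i) z <= b z.
  by rewrite /b (bigD1 i) //= lerDl sumr_ge0.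
have ib : intg mu b.
  apply: intg_sum => i; apply: intgD; last exact: intg_charmass.
  apply: intgD; last exact: intg_charmass.
  apply: intgD; last exact: intg_charmass.
  apply: intgD; last exact: intg_charmass.
  by apply: intgD; exact: intg_norm.
pose a := majorant th b.
have a0 z : 0 <= a z by exact: majorant_ge0.
have ba z : b z <= a z by exact: majorant_ge.
have ia : intg mu a by exact: intg_majorant.
have B G r c i z : 0 <= `|p0 i z| + `|q0 i z| + charmass 1 (F i) z + charmass (-1) (F i) z +
  charmass 1 (F' i) z + charmass (-1) (F' i) z - (`|r i z| + charmass c (G i) z) ->
  `|r i z| + charmass c (G i) z <= a z.
  by rewrite subr_ge0 => h; apply: le_trans (ba z); apply: le_trans (bi i z).
have bF : below a F.
  apply: below_charmass => // i z; apply: B; apply: sum6; rewrite ?charmass_ge0//.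
    by apply: Or41.
  by apply: Or43.
have bF' : below a F'.
  apply: below_charmass => // i z; apply: B; apply: sum6; rewrite ?charmass_ge0//.
    by apply: Or42.
  by apply: Or44.
have [h h0 small] := small_majorant th0 b0 ib.
pose H := interaction a g.
have H0 p : 0 <= H p by exact: interaction_ge0.
have sF : {ae mu2, forall p, forall i, F i p = (D p)%:R * source F i p /\
                                       F' i p = (D p)%:R * source F' i p}.
  by apply: ae_ord => i; apply: aeS2 (eF i) (eF' i).
have step (k : nat) : {ae mu2, forall p, p.1 <= k%:R * h -> forall i, F i p = F' i p}.
  elim: k => [|k IH].
    apply: aeS2 ae_time_neq0 sF => p p0' sp; rewrite mul0r => hp i.
    have [-> ->] := sp i; have -> : D p = false.
      apply/negP => /DT /andP[h1 _]; move: p0'; rewrite eq_le.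
      by rewrite hp h1.
    by rewrite !mul0r.
  set s := k%:R * h in IH *.
  have sS : k.+1%:R * h = s + h by rewrite -addn1 natrD mulrDl mul1r.
  rewrite sS; have [sc st] := small s h (lexx h).
  have slabE d : 0 <= d -> {ae mu2, forall p, p.1 <= s + h -> forall i,
       `|F i p - F' i p| <= d * H p} ->
      forall i, {ae mu2, forall p, p.1 <= s + h -> `|F i p - F' i p| <= d * slab s h H p}.
    move=> d0 hd i; apply: aeS2 IH hd => p h1 h2 hp.
    have [ps|ps] := leP p.1 s.
      by rewrite (h1 ps) subrr normr0 mulr_ge0// mulr_ge0.
    by rewrite /slab (ltW ps) hp mul1r; exact: h2.
  have rec (m : nat) : forall i, {ae mu2, forall p, p.1 <= s + h ->
      `|F i p - F' i p| <= 2 * CN * 2^-1 ^+ m * slab s h H p}.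
    elim: m => [|m IHm].
      apply: slabE; first by rewrite expr0 mulr1 mulr_ge0// ltW.
      have A1 := source_le f C CN0 nl bF; have A2 := source_le f C CN0 nl bF'.
      apply: aeS3 sF A1 A2 => p sp h1 h2 _ i; have [-> ->] := sp i.
      rewrite -mulrBr; apply: le_trans (norm_bool_le _ _) _.
      apply: le_trans (ler_normB _ _) _; rewrite expr0 mulr1 -mulrA mulr_natl mulr2n.
      by rewrite lerD.
    have d0 : 0 <= 2 * CN * 2^-1 ^+ m.
      by rewrite mulr_ge0 ?exprn_ge0 ?invr_ge0// mulr_ge0// ltW.
    apply: slabE; first by rewrite mulr_ge0 ?exprn_ge0 ?invr_ge0// mulr_ge0// ltW.
    have := contraction C jf CN0 nd a0 ia th0 CNth sc st d0 iF iF' bF bF' IHm.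
    apply: aeS2 sF => p sp h1 hp i; have [-> ->] := sp i.
    rewrite -mulrBr; apply: le_trans (norm_bool_le _ _) _.
    by apply: le_trans (h1 hp i) _; rewrite exprSr mulrA.
  have : {ae mu2, forall p, forall m i, p.1 <= s + h ->
      `|F i p - F' i p| <= 2 * CN * 2^-1 ^+ m * slab s h H p}.
    by apply: ae_foralln => m; apply: ae_ord => i; exact: rec.
  apply: aeS => p hp ps i; apply/eqP; rewrite -subr_eq0 -normr_le0.
  apply: (@le_geometric_le0 _ _ (2 * CN * slab s h H p)) => m.
  by rewrite mulrAC; exact: hp.
(* Finitely many slabs of height [h] reach any given time. *)
move=> i; have := ae_foralln step; apply: aeS => p hp.
have [p10|p10] := leP p.1 0; first by apply: (hp 0%N); rewrite mul0r.
apply: (hp (Num.Def.archi_bound (p.1 / h))).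
rewrite -ler_pdivrMr//; apply/ltW/archi_boundP.
by rewrite divr_ge0// ltW.
Qed.

(** Picard iteration from zero.  Consecutive differences are halved pointwise against the
    majorant, so that the iterates converge almost everywhere, and the limit is
    within a summable distance of each of them. *)
Lemma source_fixpoint : exists2 h0 : R, 0 < h0 & forall T, 0 < T -> T <= h0 ->
  exists2 F : 'I_n -> R * R -> R, forall i, intg mu2 (F i) &
    forall i, {ae mu2, forall p, F i p = (0 <= p.1 <= T)%R%:R * source F i p}.
Proof.
have [CN CN0 [nl nd]] := nonlin_bounds Gamma_bounded Gamma_lipschitz P_bounded P_lipschitz.
pose th : R := (6 * CN)^-1; have th0 : 0 < th by rewrite invr_gt0 mulr_gt0.
have CNth6 : CN * th = 6^-1 by rewrite /th invfM mulrCA mulfV ?gt_eqF// mulr1.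
have CNth : CN * th <= 6^-1 by rewrite CNth6.
(* The factor 2 makes the data at most half of the majorant, see [below_of_slab]. *)
pose b z := \sum_i (2 * (`|p0 i z| + `|q0 i z|)).
have b0 z : 0 <= b z by apply: sumr_ge0 => i _; rewrite mulr_ge0// addr_ge0.
have bi i z : 2 * (`|p0 i z| + `|q0 i z|) <= b z.
  by rewrite /b (bigD1 i) //= lerDl sumr_ge0// => j _; rewrite mulr_ge0// addr_ge0.
have ib : intg mu b.
  by apply: intg_sum => i; apply/intgZ/intgD; exact: intg_norm.
pose a := majorant th b.
have a0 z : 0 <= a z by exact: majorant_ge0.
have ba z : b z <= a z by exact: majorant_ge.
have ia : intg mu a by exact: intg_majorant.
have ap i z : 2 * `|p0 i z| <= a z.
  by apply: le_trans (ba z); apply: le_trans (bi i z); rewrite ler_pM2l// lerDl.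
have aq i z : 2 * `|q0 i z| <= a z.
  by apply: le_trans (ba z); apply: le_trans (bi i z); rewrite ler_pM2l// lerDr.
have [h0 h00 small] := small_majorant th0 b0 ib.
exists h0 => // T T0 Th; have [sc st] := small 0 T Th.
pose H := interaction a g; pose S := slab 0 T H.
have H0 p : 0 <= H p by exact: interaction_ge0.
have S0 p : 0 <= S p by exact: slab_ge0.
have iS : intg mu2 S by exact/intg_slab/intg_interaction/intg_forcing_norm.
have SE p : S p = (0 <= p.1 <= T)%R%:R * H p by rewrite /S /slab add0r.
have belowS k F : 0 <= k -> k * th <= 2^-1 -> (forall i, intg mu2 (F i)) ->
    (forall i, {ae mu2, forall p, `|F i p| <= k * S p}) -> below a F.
  move=> k0 kth iF; apply: (below_of_slab jf a0 ia sc k0 kth ap aq) => i.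
  exact: intg_measurable (iF i).
pose cut F i p := (0 <= p.1 <= T)%R%:R * source F i p.
pose Fm := fix Fm (m : nat) : 'I_n -> R * R -> R :=
  if m is m'.+1 then cut (Fm m') else fun _ _ => 0.
have mcut F i : (forall i, intg mu2 (F i)) -> measurable_fun setT (cut F i : Rm * Rm -> R).
  move=> iF; have mS := measurable_source Gamma_lipschitz P_lipschitz C jf ip0 iq0 i iF.
  by apply: measurable_funM mS; meas.
have cut_le F : below a F -> forall i, {ae mu2, forall p, `|cut F i p| <= CN * S p}.
  move=> bF i; have := source_le f C CN0 nl bF; apply: aeS => p h.
  by rewrite SE mulrCA /cut normrM ger0_norm// ler_wpM2l.
have CN6 k : k <= 2 -> k * CN * th <= 2^-1.
  rewrite -mulrA CNth6 => k2; apply: le_trans (ler_wpM2r _ k2) _; first by rewrite invr_ge0.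
  by lra.
have CN1 : CN * th <= 2^-1 by have := CN6 1; rewrite mul1r; apply; rewrite ler1n.
have FmP m : (forall i, intg mu2 (Fm m i)) /\
    forall i, {ae mu2, forall p, `|Fm m i p| <= CN * S p}.
  elim: m => [|m [iF bF]].
    split=> i; first exact: intg0.
    by apply: aeW => p; rewrite /= normr0 mulr_ge0// ltW.
  have below_m : below a (Fm m).
    by apply: (@belowS CN) => //; exact: ltW.
  have le_m := cut_le _ below_m.
  split=> // i; apply: intg_le_ae (le_m i); last exact: intgZ.
  exact: mcut.
have iFm m i : intg mu2 (Fm m i) by have [] := FmP m.
have bFm m : below a (Fm m).
  by have [h1 h2] := FmP m; apply: (@belowS (1 * CN)); rewrite ?mul1r ?CN6// ltW.
have contr d F F' : 0 <= d -> (forall i, intg mu2 (F i)) -> (forall i, intg mu2 (F' i)) ->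
    below a F -> below a F' ->
    (forall i, {ae mu2, forall p, `|F i p - F' i p| <= d * S p}) ->
    forall i, {ae mu2, forall p, `|cut F i p - cut F' i p| <= d / 2 * S p}.
  move=> d0 iF iF' bF bF' h i.
  have h' j : {ae mu2, forall p, p.1 <= 0 + T -> `|F j p - F' j p| <= d * S p}.
    by apply: aeS (h j).
  have := contraction C jf CN0 nd a0 ia th0 CNth sc st d0 iF iF' bF bF' h'.
  apply: aeS => p hp; rewrite SE /cut -mulrBr normrM ger0_norm//.
  have [/andP[_ pT]|_] := boolP (0 <= p.1 <= T); last by rewrite !mul0r mulr0.
  by rewrite !mul1r; apply: hp; rewrite add0r.
have half0 (m : nat) : 0 <= (2^-1 : R) ^+ m by rewrite exprn_ge0// invr_ge0.
have dFm m : forall i, {ae mu2, forall p,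
    `|Fm m.+1 i p - Fm m i p| <= CN * 2^-1 ^+ m * S p}.
  elim: m => [|m IH] i.
    by have [_ /(_ i)] := FmP 1; apply: aeS => p; rewrite subr0 expr0 mulr1.
  have := contr _ _ _ (mulr_ge0 (ltW CN0) (half0 m)) (iFm m.+1) (iFm m) (bFm _) (bFm _) IH i.
  by apply: aeS => p h; rewrite [_ ^+ m.+1]exprSr [CN * _]mulrA; exact: h.
(* The upper limit is defined, and measurable, everywhere; almost everywhere it is a
   limit. *)
pose F i p := fine (limn_esup (fun m => (Fm m i p)%:E)).
have mF i : measurable_fun setT (F i : Rm * Rm -> R).
  apply: (measurableT_comp (@fine_measurable R _ measurableT)).
  apply: measurable_fun_limn_esup => m; apply/measurable_EFinP.
  exact: intg_measurable (iFm m i).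
have dist_le i : {ae mu2, forall p, forall m, `|F i p - Fm m i p| <= 2 * CN * 2^-1 ^+ m * S p}.
  have : {ae mu2, forall p, forall m, `|Fm m.+1 i p - Fm m i p| <= CN * 2^-1 ^+ m * S p}.
    by apply: ae_foralln => m; exact: dFm.
  apply: aeS => p hp m.
  have c0 : 0 <= CN * S p by rewrite mulr_ge0// ltW.
  have hp' k : `|Fm k.+1 i p - Fm k i p| <= CN * S p * 2^-1 ^+ k by rewrite mulrAC.
  have [l cl hl] := geometric_limit c0 hp'.
  suff -> : F i p = l by rewrite mulrAC -[2 * CN * _]mulrA; exact: hl.
  have cE : (Fm k i p)%:E @[k --> \oo] --> l%:E by apply: cvg_EFin => //; exact: nearW.
  by rewrite /F (cvg_limn_einf_sup cE).
have F_le i : {ae mu2, forall p, `|F i p| <= 2 * CN * S p}.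
  by apply: aeS (dist_le i) => p /(_ 0%N); rewrite subr0 expr0 mulr1.
have iF i : intg mu2 (F i) by apply: intg_le_ae (F_le i) => //; exact: intgZ.
have CN20 : 0 <= 2 * CN by rewrite mulr_ge0// ltW.
have bF : below a F by apply: (@belowS (2 * CN)) => //; exact: CN6.
exists F => // i.
have : {ae mu2, forall p, forall m,
    `|cut F i p - cut (Fm m) i p| <= 2 * CN * 2^-1 ^+ m / 2 * S p}.
  apply: ae_foralln => m.
  apply: (contr _ _ _ (mulr_ge0 CN20 (half0 m)) iF (iFm m) bF (bFm m)) => j.
  by apply: aeS (dist_le j) => p; exact.
apply: aeS2 (dist_le i) => p h1 h2; apply/eqP; rewrite -subr_eq0 -normr_le0.
apply: (@le_geometric_le0 _ _ (2 * CN * S p)) => m.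
have d2 := h1 m.+1; have d1 := h2 m; rewrite distrC in d1.
apply: le_trans (ler_distD (cut (Fm m) i p) _ _) _.
apply: le_trans (lerD d2 d1) _; rewrite exprSr.
by rewrite le_eqVlt; apply/orP; left; apply/eqP; field.
Qed.

End fixed_points.

(** * Geometry of trapezoids *)

Section trapezoids.
Context {R : realType}.
Local Notation mu2 := (lebesgue2 R).
Local Notation Rm := (measurableTypeR R).
Implicit Types (K : set (R * R)) (t s x y l T : R).

Lemma mem_section K t x : xsection K t x <-> K (t, x).
Proof. by rewrite /xsection /= inE. Qed.

Lemma convex_segment K l t x s y : convex_set K -> 0 <= l <= 1 ->
  K (t, x) -> K (s, y) -> K (l * t + (1 - l) * s, l * x + (1 - l) * y).
Proof.
move=> cK /andP[l0 l1] /mem_set k1 /mem_set k2.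
have l0' : 0 <= 1 - l by rewrite subr_ge0.
have l1' : 1 - l <= 1 by rewrite gerBl.
exact: (set_mem (cK (t, x) (s, y) (Itv01 l0 l1) k1 k2)).
Qed.

Lemma in_tri_time t x s y : y + s <= x + t -> x - t <= y - s -> s <= t.
Proof. by lra. Qed.

Section one_trapezoid.
Variable K : set (R * R).
Hypothesis tK : trapezoid K.

Lemma trapezoid_closed : closed K. Proof. by case: tK. Qed.

Lemma trapezoid_convex : convex_set K. Proof. by case: tK. Qed.

Lemma trapezoid_ge0 t x : K (t, x) -> 0 <= t.
Proof. by case: tK => _ _ h _ _ /h. Qed.

Lemma trapezoid_down t x s y : K (t, x) -> 0 <= s -> s <= t ->
  x - t <= y - s -> y + s <= x + t -> K (s, y).
Proof.
case: tK => _ _ _ _ h Kt s0 st h1 h2; apply: (h _ _ Kt); split=> /=.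
  by rewrite s0.
by rewrite -lerBrDr h1 lerBrDr.
Qed.

Lemma measurable_trapezoid : measurable (K : set (Rm * Rm)).
Proof. exact: closed_measurable2 trapezoid_closed. Qed.

Lemma measurable_section t : measurable (xsection K t : set Rm).
Proof. exact: (measurable_xsection _ measurable_trapezoid). Qed.

(** Positive measure excludes that all points have time zero. *)
Lemma trapezoid_high_point : exists2 t1 : R, 0 < t1 & exists x1, K (t1, x1).
Proof.
have [//|h] := pselect (exists2 t1 : R, 0 < t1 & exists x1, K (t1, x1)).
have K0 p : K p -> p.1 = 0.
  case: p => t x Kp /=; apply/eqP; rewrite eq_le (trapezoid_ge0 Kp) andbT leNgt.
  by apply/negP => t0; apply: h; exists t => //; exists x.
have muK : mu2 K = 0%E.
  have [N [mN N0 hN]] := ae_fst (ae_neq (0 : R)).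
  have KN : K `<=` N by move=> p Kp; apply: hN => /=; rewrite (K0 p Kp) eqxx.
  have := @subset_measure0 _ _ _ mu2 K N measurable_trapezoid mN KN N0; exact.
by case: tK => _ _ _ K_pos _; move: K_pos; rewrite muK ltxx.
Qed.

Lemma trapezoid_triangle t x : K (t, x) -> forall p, in_tri t x p -> K p.
Proof. by case: tK => _ _ _ _ h Kt p /triangleE; exact: h. Qed.

Lemma section_interval t a b x : K (t, a) -> K (t, b) -> a <= x <= b -> K (t, x).
Proof.
move=> Ka Kb /andP[ax xb]; have [ab|ab] := eqVneq a b.
  by have -> : x = a by apply/eqP; rewrite eq_le ax {1}ab xb.
have ba : 0 < b - a by rewrite subr_gt0 lt_neqAle ab (le_trans ax).
pose l := (b - x) / (b - a).
have l01 : 0 <= l <= 1.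
  apply/andP; split; first by rewrite divr_ge0 ?subr_ge0// -subr_ge0 ltW.
  by rewrite ler_pdivrMr// mul1r lerD2l lerN2.
have := convex_segment trapezoid_convex l01 Ka Kb.
have -> : l * t + (1 - l) * t = t by ring.
suff -> : l * a + (1 - l) * b = x by [].
by rewrite /l; field; rewrite gt_eqF.
Qed.

Section truncated.
Variables (T t1 x1 : R).
Hypotheses (T0 : 0 < T) (Tt : T < t1) (K1 : K (t1, x1)).

Lemma truncateE t x : truncate K T (t, x) <-> 0 <= t <= T /\ K (t, x).
Proof.
rewrite /truncate; split=> [[[/= h _] Kp]|[h Kp]]; first by rewrite in_itv in h.
split=> //; split=> /=; first by rewrite in_itv.
case/andP: h => h _.
by apply/mem_section; apply: (trapezoid_down Kp); rewrite ?addr0 ?subr0 ?gerBl ?lerDl.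
Qed.

Lemma truncate_sub p : truncate K T p -> K p.
Proof. by case: p => t x /truncateE[]. Qed.

Lemma truncate_triangle t x : truncate K T (t, x) ->
  forall p, in_tri t x p -> truncate K T p.
Proof.
move=> /truncateE[/andP[t0 tT] Kt] [s y] /= h; apply/truncateE; split.
  case/and3P: (h) => /= -> h1 h2 /=; apply: le_trans tT.
  exact: in_tri_time h1 h2.
exact: trapezoid_triangle Kt _ h.
Qed.

Lemma truncate_base : xsection (truncate K T) 0 = xsection K 0.
Proof.
apply/seteqP; split=> x /mem_section.
  by move=> /truncate_sub ?; apply/mem_section.
by move=> Kx; apply/mem_section/truncateE; rewrite lexx ltW.
Qed.

Lemma truncate_section t : 0 <= t <= T -> xsection (truncate K T) t = xsection K t.
Proof.
move=> tT; apply/seteqP; split=> x /mem_section.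
  by move=> /truncate_sub ?; apply/mem_section.
by move=> Kx; apply/mem_section/truncateE.
Qed.

(** The point [(t1, x1)] above [T] has points of the trapezoid below it at all times up to
    [T]. *)
Lemma height_truncate : height (truncate K T) = T%:E.
Proof.
apply/eqP; rewrite eq_le; apply/andP; split.
  apply: ge_ereal_sup => _ [t [x /mem_section/truncateE[/andP[_ tT] _]] <-].
  by rewrite lee_fin.
apply: ereal_sup_ubound; exists T => //; exists x1; apply/mem_section/truncateE.
rewrite lexx ltW//; split=> //; apply: (trapezoid_down K1); rewrite ?(ltW T0) ?(ltW Tt)//.
  by rewrite lerD2l lerN2 ltW.
by rewrite lerD2l ltW.
Qed.

Lemma height_ge : (t1%:E <= height K)%E.
Proof. by apply: ereal_sup_ubound; exists t1 => //; exists x1; apply/mem_section. Qed.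

Lemma interior_pos : (truncate K T)° `<=` [set p | 0 < p.1].
Proof.
move=> [t x] /nbhs_ballP[e /= e0 h] /=.
have := h (t - e / 2, x); rewrite /ball /= => /(_ _)/truncateE [|/andP[h0 _] _].
  split=> /=; last exact: ballxx.
  rewrite /ball /= opprB addrCA subrr addr0 ger0_norm ?divr_ge0 ?ltW//.
  by rewrite ltr_pdivrMr// ltr_pMr// ltr1n.
by rewrite subr_ge0 in h0; apply: lt_le_trans h0; rewrite divr_gt0.
Qed.

End truncated.
End one_trapezoid.
End trapezoids.

(** * Waves and the mild formula *)

Section mild_formula.
Context {R : realType} {n : nat}.
Local Notation mu := (lebesgue1 R).
Local Notation mu2 := (lebesgue2 R).
Local Notation Rm := (measurableTypeR R).
Implicit Types (G : R * R -> R) (t x y z s T : R) (I : set R) (u v : R -> 'cV[R]_n).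

Lemma indic_triangle t x p : \1_(triangle t x) p = (in_tri t x p)%:R :> R.
Proof.
rewrite indicE; congr (nat_of_bool _)%:R; apply/idP/idP.
  by move=> /set_mem/triangleE.
by move=> h; apply/mem_set/triangleE.
Qed.

Lemma measurable_triangle t x : measurable (triangle t x : set (Rm * Rm)).
Proof.
have := @measurable_in_tri R t x measurableT [set true] I; rewrite setTI.
congr (measurable _); apply/seteqP; split=> p /=; first by move=> /triangleE.
by move=> ?; apply/triangleE.
Qed.

Lemma Rint_triangle G t x : intg mu2 (fun q => (in_tri t x q)%:R * G q) ->
  \int[mu]_(s in `[0, t]) \int[mu]_(y in `[x - t + s, x + t - s]) G (s, y) =
  \int[mu2]_q ((in_tri t x q)%:R * G q).
Proof.
move=> iG; rewrite (Rint_fubini iG) Rint_indic; apply: eq_Rint => s.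
rewrite Rint_indic indic_itvE in_itv /=.
have [/andP[s0 st]|st] := boolP (0 <= s <= t).
  rewrite mul1r; apply: eq_Rint => y; congr (_ * _).
  rewrite indic_itvE in_itv /in_tri /= s0 /= andbC; congr (nat_of_bool _)%:R.
  by rewrite lerBrDr -[X in _ && X]lerBrDr.
rewrite mul0r; apply/esym/Rint_eq0 => y; rewrite /in_tri /=.
case: (leP 0 s) st => //= [_|_ _]; last by rewrite mul0r.
move=> /negbTE st; case: (boolP (_ && _)) => [/andP[h1 h2]|_]; last by rewrite mul0r.
by rewrite (in_tri_time h1 h2) in st.
Qed.

Lemma is_derive_entry v (w : 'cV[R]_n) x i : is_derive x 1 v w ->
  is_derive x 1 (fun y => v y i ord0) (w i ord0).
Proof.
move=> [d1 d2]; have cv : h^-1 *: ((v \o shift x) (h *: 1) - v x) @[h --> 0^'] --> w.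
  by rewrite -d2; exact: d1.
have ci : h^-1 *: (((fun y => v y i ord0) \o shift x) (h *: 1) - v x i ord0)
    @[h --> 0^'] --> w i ord0.
  apply/cvgrPdist_le => e e0; move/cvgrPdist_le: cv => /(_ e e0); apply: filterS => h.
  move=> /(le_trans (mxnorm_entry _ i ord0)); rewrite /= !mxE.
  by rewrite /GRing.scale /=.
split; first by apply/cvg_ex; eexists; exact: ci.
exact: (cvg_lim (@norm_hausdorff _ _) ci).
Qed.

Lemma absolutely_continuous_entry a b v i : absolutely_continuous a b v ->
  scalar_ac a b (fun y => v y i ord0).
Proof.
move=> ac e e0; have [d d0 h] := ac e e0; exists d => // m l r h1 h2 h3.
apply: le_lt_trans (h m l r h1 h2 h3); apply: ler_sum => k _.
exact: colnorm_dist.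
Qed.

(** The derivative, extended by zero off [I], is integrable on the line, and its primitive
    differs from [v] by a constant on [I]. *)
Lemma W11dot_primitive I v i : measurable (I : set Rm) ->
  (forall a b, I a -> I b -> `[a, b]%classic `<=` I) -> W11dot I v ->
  exists2 dv : R -> R, intg mu dv &
    forall a b, I a -> I b ->
      v b i ord0 - v a i ord0 = primitive dv b - primitive dv a.
Proof.
move=> mI intI [ac [dv idv ddv]].
exists (fun x => \1_I x * dv x i ord0).
  exact: (intg_restrict mu _ mI).1 (idv i).
have H a b : I a -> I b -> a <= b -> v b i ord0 - v a i ord0 =
    primitive (fun x => \1_I x * dv x i ord0) b -
    primitive (fun x => \1_I x * dv x i ord0) a.
  move=> Ia Ib ab.
  apply: (@scalar_ac_ftc R a b (fun x => v x i ord0)) => //.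
  - exact/absolutely_continuous_entry/ac/intI.
  - exact: (intg_restrict mu _ mI).1 (idv i).
  apply: aeS ddv => x h /andP[ax xb].
  have Ix : I x by apply: (intI a b) => //=; rewrite in_itv /= (ltW ax) (ltW xb).
  by rewrite indicE mem_set// mul1r; apply: is_derive_entry; exact: h.
move=> a b Ia Ib; have [ab|/ltW ba] := leP a b; first exact: H.
by apply: oppr_inj; rewrite !opprB; exact: H.
Qed.

(** D'Alembert's formula.  With [p0 = v0 + u0'] and [q0 = v0 - u0'], extended by zero off the
    interval, the data part of the representation is a constant plus half a difference
    of primitives.  The point [c] fixes the constant.  The source [F] is
    defined on the plane and need agree with [G] only on the triangle, which allows the
    same [F] for many triangles. *)
Lemma mild_wave I c u0 v0 : measurable (I : set Rm) -> I c ->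
  (forall a b, I a -> I b -> `[a, b]%classic `<=` I) -> L11 I u0 v0 ->
  exists C (p0 q0 : 'I_n -> R -> R),
  [/\ forall i, intg mu (p0 i), forall i, intg mu (q0 i) &
    forall t x (G : R * R -> 'cV[R]_n) (F : 'I_n -> R * R -> R),
      0 <= t -> I (x - t) -> I (x + t) -> (forall i, intg mu2 (F i)) ->
      (forall i, intg mu2 (fun q => (in_tri t x q)%:R * G q i ord0)) ->
      (forall i, {ae mu2, forall q, in_tri t x q -> F i q = G q i ord0}) ->
      wave_col C p0 q0 F (t, x) =
        2^-1 *: (u0 (x + t) + u0 (x - t))
        + 2^-1 *: vintegral mu `[x - t, x + t] v0
        + 2^-1 *: vintegral mu `[0, t] (fun tau =>
            vintegral mu `[x - t + tau, x + t - tau] (fun y => G (tau, y)))].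
Proof.
move=> mI Ic intI [_ w11 l1].
have /choice[du hdu] : forall i, exists dv : R -> R, intg mu dv /\
    forall a b, I a -> I b -> u0 b i ord0 - u0 a i ord0 = primitive dv b - primitive dv a.
  by move=> i; have [dv h1 h2] := W11dot_primitive i mI intI w11; exists dv.
have idu i : intg mu (du i) by case: (hdu i).
pose v i x := \1_I x * v0 x i ord0.
have iv i : intg mu (v i) by exact: (intg_restrict mu _ mI).1 (l1 i).
exists (fun i => u0 c i ord0 - primitive (du i) c),
  (fun i x => v i x + du i x), (fun i x => v i x - du i x).
have ip i : intg mu (fun x => v i x + du i x) by exact: intgD.
have iq i : intg mu (fun x => v i x - du i x) by exact: intgB.
split=> // t x G F t0 Im Ip iF iG FG; apply/matrixP => i j; rewrite (ord1 j : j = ord0) !mxE {j}.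
rewrite /wave /=.
have primD y : primitive (fun x => v i x + du i x) y = primitive (v i) y + primitive (du i) y.
  rewrite /primitive -RintD; try exact: intg_itv.
  by apply: eq_Rint => z; rewrite mulrDr.
have primB y : primitive (fun x => v i x - du i x) y = primitive (v i) y - primitive (du i) y.
  rewrite /primitive -RintB; try exact: intg_itv.
  by apply: eq_Rint => z; rewrite mulrBr.
have uE y : I y -> u0 y i ord0 = u0 c i ord0 - primitive (du i) c + primitive (du i) y.
  by move=> Iy; case: (hdu i) => _ /(_ c y Ic Iy) /eqP; rewrite subr_eq => /eqP ->; ring.
have xt : x - t <= x + t by rewrite lerD2l ge0_cp.
have vE : \int[mu]_(y in `[x - t, x + t]) v0 y i ord0 =
    primitive (v i) (x + t) - primitive (v i) (x - t).
  rewrite (primitive_closed (iv i) xt) Rint_indic; apply: eq_Rint => y.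
  rewrite indic_itvE; have [yI|_] := boolP (y \in _); last by rewrite !mul0r.
  by rewrite /v indicE mem_set ?mul1r//; exact: (intI _ _ Im Ip).
have pE : potential (F i) (t, x) = 2^-1 *
    \int[mu]_(s in `[0, t]) (vintegral mu `[x - t + s, x + t - s] (fun y => G (s, y))) i ord0.
  rewrite /potential /=; congr (_ * _).
  transitivity (\int[mu2]_q ((in_tri t x q)%:R * G q i ord0)).
    apply: Rint_ae_eq.
    - by apply/intg_measurable/(@intg_bool _ (in_tri t x)) => //; exact: measurable_in_tri.
    - exact: intg_measurable (iG i).
    by apply: aeS (FG i) => q; case: (in_tri t x q) => [->|_]; rewrite ?mul0r.
  apply: etrans (esym (Rint_triangle (iG i))) _.
  rewrite [LHS]Rint_indic [RHS]Rint_indic; apply: eq_Rint => s.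
  by congr (_ * _); rewrite mxE.
rewrite primD primB vE pE (uE _ Im) (uE _ Ip); congr (_ + _).
by field.
Qed.

End mild_formula.

Section wave_weak_derivatives.
Context {R : realType} {n : nat}.
Local Notation mu := (lebesgue1 R).
Local Notation mu2 := (lebesgue2 R).
Local Notation Rm := (measurableTypeR R).
Variables (C : 'I_n -> R) (p0 q0 : 'I_n -> R -> R) (F : 'I_n -> R * R -> R).
Hypotheses (ip0 : forall i, intg mu (p0 i)) (iq0 : forall i, intg mu (q0 i))
  (iF : forall i, intg mu2 (F i)).

Definition dt_col (p : R * R) : 'cV[R]_n :=
  2^-1 *: (right_col p0 F p + left_col q0 F p).
Definition dx_col (p : R * R) : 'cV[R]_n :=
  2^-1 *: (right_col p0 F p - left_col q0 F p).

Lemma dt_colE p i : dt_col p i ord0 = wave_t (p0 i) (q0 i) (F i) p.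
Proof. by rewrite !mxE. Qed.

Lemma dx_colE p i : dx_col p i ord0 = wave_x (p0 i) (q0 i) (F i) p.
Proof. by rewrite !mxE. Qed.

Lemma intg_slab_set (D : set (R * R)) (T : R) (w : R * R -> R) :
  measurable (D : set (Rm * Rm)) -> D `<=` [set p | 0 <= p.1 <= T] ->
  intg mu2 (fun p => \1_(`[0, T]%classic) p.1 * w p) ->
  intg mu2 (fun p => \1_D p * w p).
Proof.
move=> mD DT /(intg_indic mD); apply: intg_ext => p.
rewrite [\1_D p]indicE; have [/set_mem /DT h|_] := boolP (p \in D); last by rewrite !mul0r.
by rewrite indic_itvE in_itv /= h !mul1r.
Qed.

Lemma L1_dt (D : set (R * R)) (T : R) : measurable (D : set (Rm * Rm)) ->
  D `<=` [set p | 0 <= p.1 <= T] -> L1 mu2 D dt_col.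
Proof.
move=> mD DT i; apply: (intg_restrict mu2 _ mD).2; apply: (intg_slab_set mD DT).
have := intg_wave_t_slab (ip0 i) (iq0 i) (iF i) T.
by apply: intg_ext => p; rewrite dt_colE.
Qed.

Lemma L1_dx (D : set (R * R)) (T : R) : measurable (D : set (Rm * Rm)) ->
  D `<=` [set p | 0 <= p.1 <= T] -> L1 mu2 D dx_col.
Proof.
move=> mD DT i; apply: (intg_restrict mu2 _ mD).2; apply: (intg_slab_set mD DT).
have := intg_wave_x_slab (ip0 i) (iq0 i) (iF i) T.
by apply: intg_ext => p; rewrite dx_colE.
Qed.

Let compact_measurable (D : set (R * R)) : compact D -> measurable (D : set (Rm * Rm)).
Proof.
move=> cD; apply: closed_measurable2; apply: compact_closed cD; exact: norm_hausdorff.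
Qed.

Lemma Rint_test (O : set (R * R)) (phi w : R * R -> R) :
  (forall p, ~ O p -> phi p = 0) ->
  \int[mu2]_(p in O) (phi p * w p) = \int[mu2]_p (phi p * w p).
Proof.
move=> h; rewrite Rint_indic; apply: eq_Rint => p; rewrite indicE.
have [_|/negP pO] := boolP (p \in O); first by rewrite mul1r.
by rewrite h ?mul0r// => Op; apply: pO; exact/mem_set.
Qed.

Variables (O : set (R * R)) (T : R).
Hypotheses (O_pos : O `<=` [set p | 0 < p.1]) (O_le : O `<=` [set p | p.1 <= T]).

Let O_slab : O `<=` [set p | 0 <= p.1 <= T].
Proof. by move=> p Op /=; rewrite (ltW (O_pos Op)) (O_le Op). Qed.

Lemma weak_derivative_dt : weak_derivative O dir_t (wave_col C p0 q0 F) dt_col.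
Proof.
split=> [D cD DO|phi tphi].
  by apply: (@L1_dt _ T); [exact: compact_measurable|exact: subset_trans O_slab].
apply/matrixP => i j; rewrite ord1 !mxE.
transitivity (\int[mu2]_(p in O) ('D_dir_t phi p * wave (C i) (p0 i) (q0 i) (F i) p)).
  by rewrite [LHS]Rint_indic [RHS]Rint_indic; apply: eq_Rint => p; congr (_ * _); rewrite !mxE.
transitivity (- \int[mu2]_(p in O) (phi p * wave_t (p0 i) (q0 i) (F i) p)).
  have h1 p : ~ O p -> 'D_dir_t phi p = 0.
    by move=> /(test_function_off dir_t tphi) [].
  have h2 p : ~ O p -> phi p = 0 by move=> /(test_function_off dir_t tphi) [].
  apply: etrans (Rint_test _ h1) _; apply: etrans _ (congr1 -%R (esym (Rint_test _ h2))).
  exact: (wave_weak_t (C i) (ip0 i) (iq0 i) (iF i) tphi O_pos).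
congr (- _); rewrite [LHS]Rint_indic [RHS]Rint_indic; apply: eq_Rint => p.
by congr (_ * _); rewrite -dt_colE [in RHS]mxE.
Qed.

Lemma weak_derivative_dx : weak_derivative O dir_x (wave_col C p0 q0 F) dx_col.
Proof.
split=> [D cD DO|phi tphi].
  by apply: (@L1_dx _ T); [exact: compact_measurable|exact: subset_trans O_slab].
apply/matrixP => i j; rewrite ord1 !mxE.
transitivity (\int[mu2]_(p in O) ('D_dir_x phi p * wave (C i) (p0 i) (q0 i) (F i) p)).
  by rewrite [LHS]Rint_indic [RHS]Rint_indic; apply: eq_Rint => p; congr (_ * _); rewrite !mxE.
transitivity (- \int[mu2]_(p in O) (phi p * wave_x (p0 i) (q0 i) (F i) p)).
  have h1 p : ~ O p -> 'D_dir_x phi p = 0.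
    by move=> /(test_function_off dir_x tphi) [].
  have h2 p : ~ O p -> phi p = 0 by move=> /(test_function_off dir_x tphi) [].
  apply: etrans (Rint_test _ h1) _; apply: etrans _ (congr1 -%R (esym (Rint_test _ h2))).
  exact: (wave_weak_x (C i) (ip0 i) (iq0 i) (iF i) tphi O_pos).
congr (- _); rewrite [LHS]Rint_indic [RHS]Rint_indic; apply: eq_Rint => p.
by congr (_ * _); rewrite -dx_colE [in RHS]mxE.
Qed.

End wave_weak_derivatives.

(** * Continuity in time *)

Section column_integrals.
Context {R : realType} {n : nat}.
Local Notation mu := (lebesgue1 R).
Local Notation Rm := (measurableTypeR R).

Lemma measurable_colnorm (v : R -> 'cV[R]_n) :
  (forall i, measurable_fun setT ((fun x => v x i ord0) : Rm -> R)) ->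
  measurable_fun setT ((fun x => `|v x|) : Rm -> R).
Proof.
move=> mv; pose h (ij : 'I_n * 'I_1) x := `|v x ij.1 ij.2|.
have -> : (fun x => `|v x|) = (fun x => \big[Num.max/0]_(ij <- index_enum _) h ij x).
  by apply/funext => x; rewrite [LHS]/Num.norm /= mx_normrE.
elim: (index_enum _) => [|[i j] s IH].
  by under eq_fun do rewrite big_nil; exact: measurable_cst.
under eq_fun do rewrite big_cons; apply: measurable_maxr => //.
by apply: measurableT_comp => //; rewrite (ord1 j : j = ord0); exact: mv.
Qed.

Lemma integral_colnorm_le (A : set R) (v : R -> 'cV[R]_n) :
  measurable (A : set Rm) -> (forall i, intg mu (fun x => v x i ord0)) ->
  (\int[mu]_(x in A) `|v x|%:E <= (\sum_i \int[mu]_x `|v x i ord0|)%:E)%E.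
Proof.
move=> mA iv; have mv i := intg_measurable (iv i).
have mn : measurable_fun setT ((fun x => `|v x|) : Rm -> R) by exact: measurable_colnorm.
have isum : intg mu (fun x => \sum_i `|v x i ord0|).
  by apply: intg_sum => i; exact: intg_norm.
have := Rint_sum (index_enum 'I_n) (fun i => intg_norm (iv i)) => <-.
rewrite (EFin_Rint isum); apply: (@le_trans _ _ (\int[mu]_x `|v x|%:E)%E).
  apply: ge0_subset_integral => //; exact/measurable_EFinP.
apply: ge0_le_integral => //; try by move=> x _; rewrite lee_fin ?colnorm_le_sum.
  exact/measurable_EFinP.
apply/measurable_EFinP; exact: intg_measurable isum.
Qed.

End column_integrals.

Section time_continuity.
Context {R : realType}.
Local Notation mu := (lebesgue1 R).
Local Notation mu2 := (lebesgue2 R).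
Implicit Types (c t s e x : R) (r : R -> R) (F : R * R -> R).

(** Continuity in time with values in the integrable functions, for functions on the
    whole half-plane; the restriction to sections of a trapezoid comes afterwards. *)
Definition continuous_slices (w : R * R -> R) : Prop :=
  forall t e, 0 <= t -> 0 < e -> exists2 d : R, 0 < d & forall s, 0 <= s ->
    `|s - t| < d -> \int[mu]_x `|w (s, x) - w (t, x)| < e.

Lemma slicesD (w1 w2 : R * R -> R) :
  (forall t, intg mu (fun x => w1 (t, x))) -> (forall t, intg mu (fun x => w2 (t, x))) ->
  continuous_slices w1 -> continuous_slices w2 ->
  continuous_slices (fun p => w1 p + w2 p).
Proof.
move=> i1 i2 c1 c2 t e t0 e0; have e2 : 0 < e / 2 by rewrite divr_gt0.
have [d1 d10 h1] := c1 t _ t0 e2; have [d2 d20 h2] := c2 t _ t0 e2.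
exists (Num.min d1 d2); first by rewrite lt_min d10.
move=> s s0; rewrite lt_min => /andP[st1 st2].
have iE := intgB (i1 s) (i1 t); have iG := intgB (i2 s) (i2 t).
apply: le_lt_trans (_ : \int[mu]_x (`|w1 (s, x) - w1 (t, x)| +
    `|w2 (s, x) - w2 (t, x)|) < _).
  apply: Rint_le => [||x].
  - by apply/intg_norm/intgB; exact: intgD.
  - by apply: intgD; exact: intg_norm.
  by rewrite opprD addrACA ler_normD.
rewrite (RintD (intg_norm iE) (intg_norm iG)) [ltRHS](splitr e).
by apply: ltrD; [exact: h1|exact: h2].
Qed.

Lemma slicesZ k (w : R * R -> R) : (forall t, intg mu (fun x => w (t, x))) ->
  continuous_slices w -> continuous_slices (fun p => k * w p).
Proof.
move=> iw cw t e t0 e0; have k1 : 0 < 1 + `|k| by rewrite ltr_pwDl.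
have [d d0 h] := cw t _ t0 (divr_gt0 e0 k1); exists d => // s s0 st.
under eq_Rint do rewrite -mulrBr normrM.
rewrite (RintZ _ (intg_norm (intgB (iw s) (iw t)))).
apply: le_lt_trans (_ : (1 + `|k|) * \int[mu]_x `|w (s, x) - w (t, x)| < _).
  by rewrite ler_wpM2r ?lerDr// Rint_ge0.
by rewrite mulrC -ltr_pdivlMr//; exact: h.
Qed.

(** A travelling wave at two times: translate to make the second time zero. *)
Lemma translation_slices c r : intg mu r ->
  continuous_slices (fun p => r (p.2 + c * p.1)).
Proof.
move=> ir t e t0 e0; have c1 : 0 < 1 + `|c| by rewrite ltr_pwDl.
have := translation_L1 ir => /cvgrPdist_lt /(_ _ e0)[d /= d0 h].
exists (d / (1 + `|c|)); first by rewrite divr_gt0.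
move=> s s0 st; have cst : `|c * (s - t)| < d.
  rewrite normrM; apply: le_lt_trans (_ : (1 + `|c|) * `|s - t| < _).
    by rewrite ler_wpM2r// lerDr.
  by rewrite mulrC -ltr_pdivlMr.
have ih : intg mu (fun x => `|r (x + c * (s - t)) - r x|).
  by apply/intg_norm/intgB => //; exact: intg_shift.
have -> : \int[mu]_x `|r (x + c * s) - r (x + c * t)| =
    \int[mu]_x `|r (x + c * (s - t)) - r x|.
  rewrite -(Rint_shift (c * t) ih); apply: eq_Rint => x.
  by congr (`|r _ - _|); ring.
have := h (c * (s - t)); rewrite /= sub0r normrN => /(_ cst).
by rewrite sub0r normrN ger0_norm// Rint_ge0.
Qed.

(** In characteristic coordinates continuity in time is an estimate by the mass of the
    source between the two times.  The change of coordinates depends on time itself, so the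
    travelling wave [r (x + c * s)] with the profile at the fixed time [t] is inserted
    between the two slices. *)
Lemma duhamel_slices c F : intg mu2 F -> continuous_slices (duhamel c F).
Proof.
move=> iF t e t0 e0; have e2 : 0 < e / 2 by rewrite divr_gt0.
have iD s : intg mu (fun x => duhamel c F (s, x)) by case: (intg_duhamel c s iF).
pose r z := duhamel c F (t, z - c * t).
have ir : intg mu r by exact: (intg_shift (- (c * t)) (iD t)).
have [d1 d10 h1] := intg_small (intg_timemass iF) e2.
have [d2 d20 h2] := translation_slices c ir t0 e2.
exists (Num.min d1 d2); first by rewrite lt_min d10.
move=> s s0; rewrite lt_min => /andP[st1 st2].
have iE : intg mu (fun x => duhamel c F (s, x) - r (x + c * s)).
  by apply: intgB => //; exact: intg_shift.
have iG : intg mu (fun x => r (x + c * s) - r (x + c * t)).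
  by apply: intgB; exact: intg_shift.
apply: le_lt_trans (_ : \int[mu]_x (`|duhamel c F (s, x) - r (x + c * s)| +
    `|r (x + c * s) - r (x + c * t)|) < _).
  apply: Rint_le => [||x].
  - exact/intg_norm/intgB.
  - by apply: intgD; exact: intg_norm.
  have -> : duhamel c F (t, x) = r (x + c * t) by rewrite /r addrK.
  exact: ler_distD.
rewrite (RintD (intg_norm iE) (intg_norm iG)) [ltRHS](splitr e).
apply: ltrD; last exact: h2.
have -> : \int[mu]_x `|duhamel c F (s, x) - r (x + c * s)| =
    \int[mu]_z `|duhamel c F (s, z - c * s) - duhamel c F (t, z - c * t)|.
  rewrite -(Rint_shift (- (c * s)) (intg_norm iE)); apply: eq_Rint => z.
  by rewrite /r subrK.
have T a b : 0 <= a -> a <= b -> b - a < d1 ->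
    \int[mu]_z `|duhamel c F (b, z - c * b) - duhamel c F (a, z - c * a)| < e / 2.
  move=> a0 ab bad; apply: le_lt_trans (duhamel_time c iF a0 ab) _.
  apply: le_lt_trans (h1 a b bad); rewrite le_eqVlt; apply/orP; left; apply/eqP.
  by apply: eq_Rint => x; rewrite ger0_norm// Rint_ge0.
have [st|/ltW ts] := leP s t.
  under eq_Rint do rewrite distrC.
  by apply: T => //; rewrite -(ger0_norm (x := t - s)) ?subr_ge0// distrC.
by apply: T => //; rewrite -(ger0_norm (x := s - t)) ?subr_ge0.
Qed.

Lemma transp_slices c r F : intg mu r -> intg mu2 F -> continuous_slices (transp c r F).
Proof.
move=> ir iF; apply: (slicesD (w1 := fun p => r (p.2 + c * p.1)) (w2 := duhamel c F)).
- by move=> t; exact: (intg_shift (c * t) ir).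
- by move=> t; case: (intg_duhamel c t iF).
- exact: translation_slices.
- exact: duhamel_slices.
Qed.

End time_continuity.

Section section_continuity.
Context {R : realType}.
Local Notation mu := (lebesgue1 R).
Local Notation Rm := (measurableTypeR R).
Variables (K : set (R * R)) (T t1 x1 : R).
Hypotheses (tK : trapezoid K) (T0 : 0 < T) (Tt : T < t1) (K1 : K (t1, x1)).
Implicit Types (s t x y d e : R).

Let cone_step s t y : t <= s -> s <= t1 -> t < t1 -> K (t, y) ->
  K (s, (t1 - s) / (t1 - t) * y + (1 - (t1 - s) / (t1 - t)) * x1).
Proof.
move=> ts st tt Ky; have tt0 : 0 < t1 - t by rewrite subr_gt0.
have l01 : 0 <= (t1 - s) / (t1 - t) <= 1.
  apply/andP; split; first by rewrite divr_ge0 ?subr_ge0// ltW.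
  by rewrite ler_pdivrMr// mul1r lerD2l lerN2.
have := convex_segment (trapezoid_convex tK) l01 Ky K1.
suff -> : (t1 - s) / (t1 - t) * t + (1 - (t1 - s) / (t1 - t)) * t1 = s by [].
by field; rewrite gt_eqF.
Qed.

(** The times at which a fixed [x] belongs to the section do not jump near [t], unless
    [x] is an end point of the section at [t]: below [t] the sections contain the one at [t]
    by the triangle property, above [t] the segments towards the higher point [(t1, x1)]
    sweep a neighbourhood of [x]. *)
Lemma section_stable t : 0 <= t <= T -> {ae mu, forall x, exists2 d : R, 0 < d &
  forall s, 0 <= s <= T -> `|s - t| < d -> (K (s, x) <-> K (t, x))}.
Proof.
move=> /andP[t0 tT].
have tt1 : 0 < t1 - t by rewrite subr_gt0 (le_lt_trans tT).
have [a ha] : exists a, forall x, K (t, x) -> x != a -> exists2 y, y < x & K (t, y).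
  have [[a [Ka ha]]|h] := pselect (exists a, K (t, a) /\ forall y, K (t, y) -> a <= y).
    exists a => x Kx xa; exists a => //.
    by rewrite lt_neqAle eq_sym xa ha.
  exists 0 => x Kx _; have [//|h'] := pselect (exists2 y, y < x & K (t, y)).
  exfalso; apply: h; exists x; split=> // y Ky; rewrite leNgt; apply/negP => yx.
  by apply: h'; exists y.
have [b hb] : exists b, forall x, K (t, x) -> x != b -> exists2 y, x < y & K (t, y).
  have [[b [Kb hb]]|h] := pselect (exists b, K (t, b) /\ forall y, K (t, y) -> y <= b).
    exists b => x Kx xb; exists b => //.
    by rewrite lt_neqAle xb hb.
  exists 0 => x Kx _; have [//|h'] := pselect (exists2 y, x < y & K (t, y)).
  exfalso; apply: h; exists x; split=> // y Ky; rewrite leNgt; apply/negP => yx.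
  by apply: h'; exists y.
apply: aeS2 (ae_neq a) (ae_neq b) => x xa xb.
have [Kx|nKx] := pselect (K (t, x)); last first.
  have : nbhs (t, x) (~` K) by apply: open_nbhs_nbhs; split; [exact: closed_openC (trapezoid_closed tK)|].
  move=> /nbhs_ballP[d /= d0 h]; exists d => // s _ sd; split=> // Ksx; exfalso.
  apply: (h (s, x)) Ksx; split=> /=; last exact: ballxx.
  by rewrite /ball /= distrC.
have [y1 y1x Ky1] := ha x Kx xa; have [y2 xy2 Ky2] := hb x Kx xb.
pose M := `|x1 - y1| + `|x1 - y2| + 1.
have M0 : 0 < M by rewrite ltr_wpDl// addr_ge0.
pose m := Num.min (x - y1) (y2 - x).
have m0 : 0 < m by rewrite lt_min !subr_gt0 y1x.
exists (m * (t1 - t) / M); first by rewrite divr_gt0// mulr_gt0.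
move=> s /andP[s0 sT] sd; split=> // _.
have [st|/ltW ts] := leP s t.
  by apply: (trapezoid_down tK Kx) => //; [rewrite lerD2l lerN2|rewrite lerD2l].
have st1 : s <= t1 by exact: le_trans sT (ltW Tt).
have tlt : t < t1 by rewrite -subr_gt0.
have k1 := cone_step ts st1 tlt Ky1; have k2 := cone_step ts st1 tlt Ky2.
pose l := (s - t) / (t1 - t).
have lE : (t1 - s) / (t1 - t) = 1 - l by rewrite /l; field; rewrite gt_eqF.
have l0 : 0 <= l by rewrite divr_ge0 ?subr_ge0// ltW.
have lM : l * M <= m.
  rewrite /l mulrAC ler_pdivrMr// -ler_pdivlMr//; apply: ltW.
  by rewrite -(ger0_norm (x := s - t)) ?subr_ge0.
have lz (y : R) : `|x1 - y| <= M -> `|l * (x1 - y)| <= m.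
  by move=> h; rewrite normrM ger0_norm//; apply: le_trans lM; rewrite ler_wpM2l.
have My1 : `|x1 - y1| <= M by rewrite /M -addrA lerDl addr_ge0.
have My2 : `|x1 - y2| <= M by rewrite /M -addrA addrCA lerDl addr_ge0.
apply: (section_interval tK k1 k2); rewrite lE.
have E (y : R) : (1 - l) * y + (1 - (1 - l)) * x1 = y + l * (x1 - y) by ring.
rewrite !E; have := lz _ My1; have := lz _ My2.
rewrite /m !le_min => /andP[_ /ler_normlP[e1 _]] /andP[/ler_normlP[_ e2] _].
apply/andP; split; first by rewrite addrC -lerBrDr.
by rewrite -lerBlDl -[leLHS]opprB lerNl.
Qed.

(** The dominated convergence theorem is used for limits in the whole line; [clamp] extends
    functions of the time in [0 <= s <= T] to the line. *)
Let clamp s := Num.max 0 (Num.min T s).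

Let clamp_in s : 0 <= clamp s <= T.
Proof. by rewrite /clamp le_max lexx /= ge_max (ltW T0) /= ge_min lexx. Qed.

Let clamp_id s : 0 <= s <= T -> clamp s = s.
Proof. by move=> /andP[s0 sT]; rewrite /clamp (min_idPr sT) (max_idPr s0). Qed.

Let clamp_lip s t : 0 <= t <= T -> `|clamp s - t| <= `|s - t|.
Proof.
move=> tT; case/andP: (tT) => t0 tT'.
have [s0|s0] := leP 0 s; have [sT|sT] := leP s T.
- by rewrite clamp_id ?s0.
- rewrite /clamp (min_idPl (ltW sT)) (max_idPr (ltW T0)) ger0_norm ?subr_ge0//.
  by apply: le_trans (ler_norm _); rewrite lerD2r ltW.
- rewrite /clamp (min_idPr sT) (max_idPl (ltW s0)) sub0r normrN ger0_norm// distrC.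
  by apply: le_trans (ler_norm _); rewrite lerDl oppr_ge0 ltW.
- by have := lt_trans (lt_trans T0 sT) s0; rewrite ltxx.
Qed.

(** The indicators of the sections converge almost everywhere, being eventually constant by
    [section_stable]. *)
Lemma section_slices t (w : R -> R) e : 0 <= t <= T -> intg mu w -> 0 < e ->
  exists2 d : R, 0 < d & forall s, 0 <= s <= T -> `|s - t| < d ->
    \int[mu]_x (`|\1_(xsection K s) x - \1_(xsection K t) x| * `|w x|) < e.
Proof.
move=> tT iw e0; pose B s := \int[mu]_x (`|\1_(xsection K s) x - \1_(xsection K t) x| * `|w x|).
have mS s : measurable_fun setT (\1_(xsection K s) : Rm -> R).
  by apply: measurable_indic; exact: measurable_section.
have mB s : measurable_fun setT
    ((fun x => `|\1_(xsection K s) x - \1_(xsection K t) x| * `|w x|) : Rm -> R).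
  apply: measurable_funM; last exact: (intg_measurable (intg_norm iw)).
  by apply: measurableT_comp => //; exact: measurable_funB.
have : (B \o clamp) x @[x --> t] --> (0 : R).
  apply: cvg_of_seq => u ut.
  have -> : (0 : R) = \int[mu]_x (0 : R) by rewrite Rint_eq0.
  apply: (@Rint_dominated _ _ _ mu (fun j x =>
    `|\1_(xsection K (clamp (u j))) x - \1_(xsection K t) x| * `|w x|) _ (fun x => `|w x|)).
  - by move=> j; exact: mB.
  - exact: measurable_cst.
  - exact: intg_norm.
  - move=> j; apply: aeW => x; rewrite normrM !normr_id ler_piMl//.
    rewrite !indicE; case: (x \in _); case: (x \in _);
    by rewrite ?subrr ?subr0 ?sub0r ?normrN ?normr0 ?normr1.
  apply: aeS (section_stable tT) => x [d d0 h].
  apply: cvg_near_cst; move/cvgrPdist_lt: ut => /(_ d d0); apply: filterS => j uj.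
  have := h (clamp (u j)) (clamp_in _).
  move=> /(_ (le_lt_trans (clamp_lip _ tT) _)); rewrite distrC => /(_ uj) [h1 h2].
  suff -> : (\1_(xsection K (clamp (u j))) x : R) = \1_(xsection K t) x.
    by rewrite subrr normr0 mul0r.
  rewrite !indicE; congr (nat_of_bool _)%:R; apply/idP/idP.
    by move=> /set_mem/mem_section/h1 Kx; apply/mem_set/mem_section.
  by move=> /set_mem/mem_section/h2 Kx; apply/mem_set/mem_section.
move=> /cvgrPdist_lt /(_ e e0)[d /= d0 h]; exists d => // s sT st.
have := h s; rewrite /= clamp_id// sub0r normrN distrC => /(_ st).
by apply: le_lt_trans; exact: ler_norm.
Qed.

Variables (n : nat) (g : R * R -> 'cV[R]_n).
Hypotheses (ig : forall t i, intg mu (fun x => g (t, x) i ord0))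
  (cg : forall i, continuous_slices (fun p => g p i ord0)).

Let ext s x := zero_ext (truncate K T) g (s, x).

Let extE s x i : 0 <= s <= T ->
  ext s x i ord0 = \1_(xsection K s) x * g (s, x) i ord0.
Proof.
move=> sT; rewrite /ext /zero_ext /patch indicE.
have -> : ((s, x) \in truncate K T) = (x \in xsection K s).
  apply/idP/idP => [/set_mem/(truncateE tK)[_ Kx]|/set_mem/mem_section Kx].
    exact/mem_set/mem_section.
  exact/mem_set/(truncateE tK).
by case: (x \in _); rewrite ?mul1r// mul0r mxE.
Qed.

Let intg_ext_slice s i : 0 <= s <= T -> intg mu (fun x => ext s x i ord0).
Proof.
move=> sT; have := intg_indic (measurable_section tK s) (ig s i).
by apply: intg_ext => x; rewrite extE.
Qed.

(** The difference of two restricted slices splits into the difference of the slices and the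
    slice at [t] on the symmetric difference of the sections. *)
Let ext_slices t i e : 0 <= t <= T -> 0 < e -> exists2 d : R, 0 < d &
  forall s, 0 <= s <= T -> `|s - t| < d ->
    \int[mu]_x `|ext s x i ord0 - ext t x i ord0| < e.
Proof.
move=> tT e0; have e2 : 0 < e / 2 by rewrite divr_gt0.
have t0 : 0 <= t by case/andP: tT.
have [d1 d10 h1] := cg i t0 e2; have [d2 d20 h2] := section_slices tT (ig t i) e2.
exists (Num.min d1 d2); first by rewrite lt_min d10.
move=> s sT; rewrite lt_min => /andP[st1 st2]; have s0 : 0 <= s by case/andP: sT.
pose E x := g (s, x) i ord0 - g (t, x) i ord0.
pose G x := `|\1_(xsection K s) x - \1_(xsection K t) x| * `|g (t, x) i ord0|.
have iE : intg mu E by exact: intgB.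
have mS z : measurable_fun setT (\1_(xsection K z) : Rm -> R).
  by apply: measurable_indic; exact: measurable_section.
have b1 z x : `|\1_(xsection K z) x : R| <= 1.
  by rewrite indicE; case: (x \in _); rewrite ?normr1 ?normr0.
have iG : intg mu G.
  apply: intg_le (intgZ 2 (intg_norm (ig t i))) _ => [|x].
    apply: measurable_funM; last exact: (intg_measurable (intg_norm (ig t i))).
    by apply: measurableT_comp => //; exact: measurable_funB.
  rewrite /G normrM !normr_id ler_wpM2r//; apply: le_trans (ler_normB _ _) _.
  by apply: le_trans (lerD (b1 _ _) (b1 _ _)) _.
apply: (@le_lt_trans _ _ (\int[mu]_x `|E x| + \int[mu]_x G x)).
  rewrite -(RintD (intg_norm iE) iG); apply: Rint_le.
  - by apply/intg_norm/intgB; exact: intg_ext_slice.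
  - by apply: intgD => //; exact: intg_norm.
  move=> x; rewrite !extE// /E /G.
  have -> : \1_(xsection K s) x * g (s, x) i ord0 - \1_(xsection K t) x * g (t, x) i ord0 =
    \1_(xsection K s) x * (g (s, x) i ord0 - g (t, x) i ord0) +
    (\1_(xsection K s) x - \1_(xsection K t) x) * g (t, x) i ord0 by ring.
  apply: le_trans (ler_normD _ _) _; rewrite !normrM lerD2r.
  by rewrite ler_piMl.
rewrite [ltRHS](splitr e); apply: ltrD; first exact: h1.
exact: h2.
Qed.

Lemma continuous_L1_slices : continuous_L1 (truncate K T) g.
Proof.
rewrite /continuous_L1 (truncate_base tK T0) (height_truncate tK T0 Tt K1) /= => t.
rewrite /= in_itv /= => tT.
have mB : measurable (xsection K 0 : set Rm) by exact: measurable_section.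
split.
  by move=> i; apply: (intg_restrict mu _ mB).2; apply: intg_indic mB _; exact: intg_ext_slice.
pose psi s := \sum_i \int[mu]_x `|ext s x i ord0 - ext t x i ord0|.
have psi0 s : 0 <= psi s by apply: sumr_ge0 => i _; exact: Rint_ge0.
have W : (psi s)%:E @[s --> within `[0, T]%classic (nbhs t)] --> 0%:E.
  apply: cvg_EFin; first exact: nearW.
  apply/cvgrPdist_le => e e0.
  have en : 0 < e / n.+1%:R by rewrite divr_gt0.
  have /choice[d hd] : forall i, exists d : R, 0 < d /\ forall s, 0 <= s <= T ->
      `|s - t| < d -> \int[mu]_x `|ext s x i ord0 - ext t x i ord0| < e / n.+1%:R.
    by move=> i; have [d d0 h] := ext_slices i tT en; exists d.
  have : \forall s \near t, forall i, `|s - t| < d i.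
    apply: (@filter_forall _ _ (fun i s => `|s - t| < d i) (nbhs t)) => i.
    have [di _] := hd i; exists (d i) => // s /=; by rewrite distrC.
  apply: filterS => s hs; rewrite /= in_itv /= => sT.
  rewrite sub0r normrN ger0_norm//; apply: (@le_trans _ _ (\sum_(i < n) e / n.+1%:R)).
    by apply: ler_sum => i _; apply: ltW; case: (hd i) => _ h; exact: h.
  rewrite sumr_const card_ord -[_ *+ n]mulr_natr -mulrA ler_piMr ?ltW//.
  by rewrite mulrC ltr_pdivrMr// mul1r ltr_nat.
apply: (squeeze_cvge _ (cvg_cst _) W).
near=> s.
have sT : 0 <= s <= T.
  by have : `[0, T]%classic s by near: s; exact: withinT.
rewrite integral_ge0//=.
have iv i : intg mu (fun x => (ext s x - ext t x) i ord0).
  apply: (intg_ext _ (intgB (intg_ext_slice i sT) (intg_ext_slice i tT))) => x.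
  by rewrite !mxE.
have := integral_colnorm_le mB iv; rewrite /psi.
have -> : \sum_i \int[mu]_x `|(ext s x - ext t x) i ord0| =
    \sum_i \int[mu]_x `|ext s x i ord0 - ext t x i ord0|.
  by apply: eq_bigr => i _; apply: eq_Rint => x; rewrite !mxE.
exact.
Unshelve. all: by end_near.
Qed.

End section_continuity.

(** * Mild solutions and fixed points *)

Section weak_uniqueness.
Context {R : realType} {n : nat}.
Local Notation mu2 := (lebesgue2 R).
Local Notation Rm := (measurableTypeR R).
Implicit Types (O : set (R * R)) (v w : R * R -> 'cV[R]_n) (phi : R * R -> R) (e : R * R).

Lemma test_function_sub O O' phi : O `<=` O' -> test_function O phi -> test_function O' phi.
Proof. by move=> OO [h1 h2 h3]; split=> //; exact: subset_trans OO. Qed.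

Let vintegral_test O phi v i : (forall p, ~ O p -> phi p = 0) ->
  vintegral mu2 O (fun p => phi p *: v p) i ord0 = \int[mu2]_p (phi p * v p i ord0).
Proof.
move=> h; rewrite mxE -[RHS](Rint_test (fun p => v p i ord0) h).
rewrite [LHS]Rint_indic [RHS]Rint_indic; apply: eq_Rint => p.
by congr (_ * _); rewrite mxE.
Qed.

Lemma weak_derivative_test O e v w phi i : test_function O phi ->
  weak_derivative O e v w ->
  \int[mu2]_p ('D_e phi p * v p i ord0) = - \int[mu2]_p (phi p * w p i ord0).
Proof.
move=> tphi [_ /(_ phi tphi)] /(congr1 (fun m : 'cV[R]_n => m i ord0)).
rewrite [RHS]mxE !vintegral_test//.
  by move=> p /(test_function_off e tphi)[].
by move=> p /(test_function_off e tphi)[].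
Qed.

Lemma intg_test O phi w i : test_function O phi -> locL1 O w ->
  intg mu2 (fun p => phi p * w p i ord0).
Proof.
move=> tphi lw; have [_ cS SO] := tphi; set S := closure _ in cS SO.
have mS : measurable (S : set (Rm * Rm)).
  by apply: closed_measurable2; exact: closed_closure.
have iS := (intg_restrict mu2 _ mS).1 (lw S cS SO i).
have [M M0 hM] := test_function_box tphi; have [cphi _ _ _] := test_function_smooth tphi.
have [B B0 hB] : exists2 B : R, 0 <= B & forall p, `|phi p| <= B.
  by apply: (bounded_of_box cphi) => p /(hM p 0) [].
have := intg_bounded_mul (continuous_measurable2 cphi) hB iS; apply: intg_ext => p.
rewrite mulrA; congr (_ * _); rewrite indicE; have [_|/negP pS] := boolP (p \in S).
  by rewrite mulr1.
have [->|p0] := eqVneq (phi p) 0; first by rewrite mul0r.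
by exfalso; apply: pS; apply/mem_set/subset_closure.
Qed.

(** The difference of the weak derivatives is orthogonal to all test functions of the
    smaller set. *)
Lemma weak_derivative_unique O O' e v v' w w' : open O -> O `<=` O' ->
  weak_derivative O' e v w -> weak_derivative O e v' w' ->
  (forall p, O p -> v p = v' p) ->
  {ae mu2, forall p, O p -> w p = w' p}.
Proof.
move=> oO OO' wd wd' vv.
have : {ae mu2, forall p, forall i, O p -> w p i ord0 - w' p i ord0 = 0}.
  apply: ae_ord => i; apply: du_bois_reymond => // [q qO|phi tphi].
    have mq := measurable_closed_box q.
    have cq : compact (closed_box q) by exact: closed_box_compact.
    have i1 := (intg_restrict mu2 _ mq).1 (wd.1 _ cq (subset_trans qO OO') i).
    have i2 := (intg_restrict mu2 _ mq).1 (wd'.1 _ cq qO i).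
    by have := intgB i1 i2; apply: intg_ext => p; rewrite mulrBr.
  have tphi' := test_function_sub OO' tphi.
  have e1 := weak_derivative_test i tphi' wd; have e2 := weak_derivative_test i tphi wd'.
  have i1 := intg_test i tphi' wd.1; have i2 := intg_test i tphi wd'.1.
  have -> : \int[mu2]_p (\1_O p * (phi p * (w p i ord0 - w' p i ord0))) =
      \int[mu2]_p (phi p * w p i ord0 - phi p * w' p i ord0).
    apply: eq_Rint => p; rewrite -mulrBr indicE.
    have [_|/negP pO] := boolP (p \in O); first by rewrite mul1r.
    have [-> _] := test_function_off e tphi (fun Op => pO (mem_set Op)).
    by rewrite !mul0r.
  rewrite (RintB i1 i2); apply/eqP; rewrite subr_eq0 -eqr_opp -e1 -e2; apply/eqP.
  apply: eq_Rint => p; have [Op|nOp] := pselect (O p); first by rewrite vv.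
  by have [_ ->] := test_function_off e tphi nOp; rewrite !mul0r.
apply: aeS => p h Op; apply/matrixP => i j; rewrite (ord1 j : j = ord0).
by apply/eqP; rewrite -subr_eq0 h.
Qed.

End weak_uniqueness.

Section solutions.
Context {R : realType} {n : nat}.
Local Notation mu := (lebesgue1 R).
Local Notation mu2 := (lebesgue2 R).
Local Notation Rm := (measurableTypeR R).
Variables (Gamma : 'I_n -> 'I_n -> 'cV[R]_n -> 'cV[R]_n) (P : 'cV[R]_n -> 'M[R]_n).
Hypotheses (Gamma_bounded : forall j k, [bounded Gamma j k w | w in [set: 'cV[R]_n]])
  (Gamma_lipschitz : forall j k, lipschitz (Gamma j k))
  (P_bounded : [bounded P w | w in [set: 'cV[R]_n]]) (P_lipschitz : lipschitz P).
Variables (K : set (R * R)) (u0 v0 : R -> 'cV[R]_n) (f : R * R -> 'cV[R]_n).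
Hypotheses (tK : trapezoid K) (data_L11 : L11 (xsection K 0) u0 v0) (f_L1 : L1 mu2 K f).
Variables (T t1 x1 : R).
Hypotheses (T0 : 0 < T) (Tt : T < t1) (K1 : K (t1, x1)).
Variables (C : 'I_n -> R) (p0 q0 : 'I_n -> R -> R).
Hypotheses (ip0 : forall i, intg mu (p0 i)) (iq0 : forall i, intg mu (q0 i)).
Hypothesis dalembert : forall t x (G : R * R -> 'cV[R]_n) (F : 'I_n -> R * R -> R),
  0 <= t -> xsection K 0 (x - t) -> xsection K 0 (x + t) -> (forall i, intg mu2 (F i)) ->
  (forall i, intg mu2 (fun q => (in_tri t x q)%:R * G q i ord0)) ->
  (forall i, {ae mu2, forall q, in_tri t x q -> F i q = G q i ord0}) ->
  wave_col C p0 q0 F (t, x) =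
    2^-1 *: (u0 (x + t) + u0 (x - t))
    + 2^-1 *: vintegral mu `[x - t, x + t] v0
    + 2^-1 *: vintegral mu `[0, t] (fun tau =>
        vintegral mu `[x - t + tau, x + t - tau] (fun y => G (tau, y))).
Implicit Types (t x : R) (F : 'I_n -> R * R -> R) (u w : R * R -> 'cV[R]_n).

Local Notation f0 := (zero_ext K f).
Local Notation src := (source Gamma P f0 C p0 q0).
Local Notation Kt := (truncate K T).

Lemma intg_forcing i : intg mu2 (fun p => f0 p i ord0).
Proof.
have := (intg_restrict mu2 _ (measurable_trapezoid tK)).1 (f_L1 i); apply: intg_ext => p.
by rewrite /zero_ext /patch indicE; case: (p \in K); rewrite ?mul1r// mul0r mxE.
Qed.

Let forcingE p : K p -> f0 p = f p.
Proof. by move=> Kp; rewrite /zero_ext /patch mem_set. Qed.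

Let base_ends t x : Kt (t, x) -> [/\ 0 <= t, xsection K 0 (x - t) & xsection K 0 (x + t)].
Proof.
move=> /(truncateE tK)[/andP[t0 _] Kx]; split=> //; apply/mem_section.
  by apply: (trapezoid_down tK Kx) => //; rewrite ?subr0 ?addr0// lerD2l ge0_cp.
by apply: (trapezoid_down tK Kx) => //; rewrite ?subr0 ?addr0// lerD2l ge0_cp.
Qed.

Lemma in_tri_trans t x s y p : in_tri t x (s, y) -> in_tri s y p -> in_tri t x p.
Proof.
move=> /and3P[_ /= h1 h2] /and3P[h3 h4 h5]; rewrite /in_tri h3 /=.
by rewrite (le_trans h4 h1) (le_trans h2 h5).
Qed.

Lemma in_tri_refl t x : 0 <= t -> in_tri t x (t, x).
Proof. by move=> t0; rewrite /in_tri /= t0 !lexx. Qed.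

(** Weak derivatives live on open sets, so that the comparison on a triangle is made in its
    interior; the boundary is null. *)
Definition interior_tri t x : set (R * R) :=
  [set p | 0 < p.1 /\ p.2 + p.1 < x + t /\ x - t < p.2 - p.1].

Lemma interior_tri_sub t x p : interior_tri t x p -> in_tri t x p.
Proof. by move=> [h1 [h2 h3]]; rewrite /in_tri (ltW h1) (ltW h2) (ltW h3). Qed.

Lemma interior_tri_open t x : open (interior_tri t x).
Proof.
have -> : interior_tri t x = [set p | 0 < p.1] `&`
    ([set p | 0 < x + t - (p.2 + p.1)] `&` [set p | 0 < p.2 - p.1 - (x - t)]).
  by apply/seteqP; split=> p /=; rewrite /interior_tri /= !subr_gt0.
have c1 : continuous (fst : R * R -> R) by move=> p; exact: cvg_fst.
have c2 : continuous (snd : R * R -> R) by move=> p; exact: cvg_snd.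
have opos (h : R * R -> R) : continuous h -> open [set p | 0 < h p].
  move=> ch; apply: (@open_comp _ _ h [set r : R | 0 < r]); last exact: open_gt.
  by move=> p _; exact: ch.
apply: openI; [|apply: openI]; apply: opos.
- exact: c1.
- by move=> p; apply: cvgB; [exact: cvg_cst|apply: cvgD; [exact: c2|exact: c1]].
- by move=> p; apply: cvgB; [apply: cvgB; [exact: c2|exact: c1]|exact: cvg_cst].
Qed.

Lemma ae_interior_tri t x : {ae mu2, forall p, in_tri t x p -> interior_tri t x p}.
Proof.
have m1 : measurable_fun setT ((fun s => x + t - s) : Rm -> R).
  by apply: measurable_funB; [exact: measurable_cst|exact: measurable_idR].
have m2 : measurable_fun setT ((fun s => x - t + s) : Rm -> R).
  by apply: measurable_funD; [exact: measurable_cst|exact: measurable_idR].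
apply: aeS3 (ae_fst (ae_neq (0 : R))) (ae_graph m1) (ae_graph m2) => p h1 h2 h3.
move=> /and3P[k1 k2 k3]; split; first by rewrite lt_neqAle eq_sym h1.
split; rewrite lt_neqAle ?k2 ?k3 andbT.
  by apply: contraNneq h2 => <-; rewrite addrK.
by apply: contraNneq h3 => ->; rewrite subrK.
Qed.

(** A mild solution is, on each triangle, the wave driven by its own right-hand side;
    uniqueness of weak derivatives turns this into a fixed point equation. *)
Lemma mild_solution_fixpoint w t x : mild_solution Gamma P Kt u0 v0 f w -> Kt (t, x) ->
  exists F, [/\ forall i, intg mu2 (F i),
    forall i, {ae mu2, forall p, F i p = (in_tri t x p)%:R * src F i p} &
    w (t, x) = wave_col C p0 q0 F (t, x)].
Proof.
move=> [cw [wt [wx [dwt dwx mild]]]] Ktx.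
pose G := wave_rhs Gamma P f w wt wx.
pose F i p := (in_tri t x p)%:R * G p i ord0.
have [t0 _ _] := base_ends Ktx.
have iF i : intg mu2 (F i).
  have [/(_ i) l1 _] := mild t x Ktx.
  have := (intg_restrict mu2 _ (measurable_triangle t x)).1 l1; apply: intg_ext => p.
  by rewrite indic_triangle.
have triK p : in_tri t x p -> Kt p by exact: truncate_triangle.
have wE p : in_tri t x p -> w p = wave_col C p0 q0 F p.
  case: p => s y h; have Ksy := triK _ h.
  have [s0 b1 b2] := base_ends Ksy; have [_ ->] := mild s y Ksy.
  apply/esym/dalembert => // [i|i].
    have := @intg_bool R (in_tri s y) _ (measurable_in_tri s y) (iF i).
    apply: intg_ext => q; rewrite /F; case: (boolP (in_tri s y q)) => [hq|]; last by rewrite !mul0r.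
    by rewrite (in_tri_trans h hq) !mul1r.
  by apply: aeW => q hq; rewrite /F (in_tri_trans h hq) mul1r.
exists F; split=> //; last by apply: wE; exact: in_tri_refl.
have oO : open (interior_tri t x) by exact: interior_tri_open.
have OK : interior_tri t x `<=` Kt°.
  rewrite -[X in X `<=` _](interior_id _).1//; apply: interiorS => p /interior_tri_sub.
  exact: triK.
have Opos : interior_tri t x `<=` [set p | 0 < p.1] by move=> p [].
have Ole : interior_tri t x `<=` [set p | p.1 <= t].
  move=> [s y] /interior_tri_sub/and3P[/= _ h1 h2]; exact: in_tri_time h1 h2.
have wO p : interior_tri t x p -> w p = wave_col C p0 q0 F p.
  by move=> /interior_tri_sub; exact: wE.
have at_ := weak_derivative_unique oO OK dwt (weak_derivative_dt C ip0 iq0 iF Opos Ole) wO.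
have ax := weak_derivative_unique oO OK dwx (weak_derivative_dx C ip0 iq0 iF Opos Ole) wO.
move=> i; apply: aeS3 at_ ax (ae_interior_tri t x) => p h1 h2 h3.
rewrite {1}/F; have [hp|_] := boolP (in_tri t x p); last by rewrite !mul0r.
have Op := h3 hp; congr (_ * _).
have Kp : K p by have := truncate_sub tK (triK _ hp).
by rewrite /source (forcingE Kp) -(wO p Op) /G /wave_rhs (h1 Op) (h2 Op).
Qed.

(** Both solutions are waves on the backward triangle of each point, with the same data, and
    with sources that are equal by [source_unique]. *)
Lemma mild_solution_unique w u : mild_solution Gamma P Kt u0 v0 f w ->
  mild_solution Gamma P Kt u0 v0 f u -> forall p, Kt p -> w p = u p.
Proof.
move=> mw mu_ [t x] Ktx.
have [F [iF eF ->]] := mild_solution_fixpoint mw Ktx.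
have [F' [iF' eF' ->]] := mild_solution_fixpoint mu_ Ktx.
have DT p : in_tri t x p -> 0 <= p.1 <= t.
  by case: p => s y /and3P[/= -> h1 h2] /=; exact: in_tri_time h1 h2.
have FF := source_unique Gamma_bounded Gamma_lipschitz P_bounded P_lipschitz
  intg_forcing ip0 iq0 DT iF iF' eF eF'.
apply/matrixP => i j; rewrite !mxE /wave; congr (_ + _ + _).
apply: (potential_local (intg_measurable (iF i)) (intg_measurable (iF' i)) (T := t)) => //.
by apply: aeS (FF i) => q ->.
Qed.

Variable F : 'I_n -> R * R -> R.
Hypotheses (iF : forall i, intg mu2 (F i))
  (eF : forall i, {ae mu2, forall p, F i p = (0 <= p.1 <= T)%R%:R * src F i p}).

Let u := wave_col C p0 q0 F.
Let ut := dt_col p0 q0 F.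
Let ux := dx_col p0 q0 F.

Let Kt_pos : Kt° `<=` [set p | 0 < p.1]. Proof. exact: interior_pos. Qed.

Let Kt_le : Kt° `<=` [set p | p.1 <= T].
Proof. by move=> [t x] /interior_subset/(truncateE tK)[/andP[]]. Qed.

Let u_continuous : {within Kt, continuous u}.
Proof. exact/continuous_subspaceT/wave_col_continuous. Qed.

Let u_weak_t : weak_derivative Kt° dir_t u ut.
Proof. exact: weak_derivative_dt Kt_pos Kt_le. Qed.

Let u_weak_x : weak_derivative Kt° dir_x u ux.
Proof. exact: weak_derivative_dx Kt_pos Kt_le. Qed.

(** The source is the right-hand side for the forcing extended by zero, which agrees with the
    given one on the trapezoid, in particular on backward triangles. *)
Lemma fixpoint_mild : mild_solution Gamma P Kt u0 v0 f u.
Proof.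
split=> //; exists ut, ux; split=> // t x Ktx.
have [t0 b1 b2] := base_ends Ktx; set G := wave_rhs Gamma P f u ut ux.
have GE p i : in_tri t x p -> G p i ord0 = src F i p.
  move=> hp; have Kp : K p by have := truncate_sub tK (truncate_triangle tK Ktx hp).
  by rewrite /source (forcingE Kp).
have FG i : {ae mu2, forall q, in_tri t x q -> F i q = G q i ord0}.
  apply: aeS (eF i) => q -> hq; rewrite GE//.
  have Kq := truncate_triangle tK Ktx hq.
  by case: q hq Kq => s y _ /(truncateE tK)[/= -> _]; rewrite mul1r.
have iG i : intg mu2 (fun q => (in_tri t x q)%:R * G q i ord0).
  have mS := measurable_source Gamma_lipschitz P_lipschitz C intg_forcing ip0 iq0 i iF.
  apply: (@intg_le_ae _ _ _ mu2 _ (fun q => `|F i q|)); last 2 first.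
  - exact: intg_norm.
  - apply: aeS (FG i) => q; case: (in_tri t x q) => [->//|_]; first by rewrite mul1r.
    by rewrite mul0r normr0.
  have -> : (fun q => (in_tri t x q)%:R * G q i ord0) = (fun q => (in_tri t x q)%:R * src F i q).
    by apply/funext => q; case: (boolP (in_tri t x q)) => [/GE ->|]; rewrite ?mul0r.
  by apply: measurable_funM mS; apply: measurable_bool => //; exact: measurable_in_tri.
split; last exact: dalembert.
move=> i; apply: (intg_restrict mu2 _ (measurable_triangle t x)).2.
by have := iG i; apply: intg_ext => p; rewrite indic_triangle.
Qed.

Let slices_half c i : continuous_slices (fun p =>
  2^-1 * (transp 1 (p0 i) (F i) p + c * transp (-1) (q0 i) (F i) p)).
Proof.
have i1 t := (intg_transp 1 t (ip0 i) (iF i)).1.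
have i2 t := (intg_transp (-1) t (iq0 i) (iF i)).1.
have ic t := intgZ c (i2 t).
apply: slicesZ => [t|]; first exact: intgD.
apply: slicesD => //; first exact: transp_slices.
by apply: slicesZ => //; exact: transp_slices.
Qed.

Let slices_t i : continuous_slices (fun p => ut p i ord0).
Proof.
have := slices_half 1 i; congr continuous_slices; apply/funext => p.
by rewrite dt_colE mul1r.
Qed.

Let slices_x i : continuous_slices (fun p => ux p i ord0).
Proof.
have := slices_half (-1) i; congr continuous_slices; apply/funext => p.
by rewrite dx_colE mulN1r.
Qed.

Let slice_t t i : intg mu (fun x => ut (t, x) i ord0).
Proof.
by have := intg_wave_t (ip0 i) (iq0 i) (iF i) t; apply: intg_ext => x; rewrite dt_colE.
Qed.

Let slice_x t i : intg mu (fun x => ux (t, x) i ord0).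
Proof.
by have := intg_wave_x (ip0 i) (iq0 i) (iF i) t; apply: intg_ext => x; rewrite dx_colE.
Qed.

(** The supremum of [u] is bounded by the masses of data and source, and so are the integrals
    of both transported derivatives at every time. *)
Let Hnorm_finite : (Hnorm Kt u ut ux < +oo)%E.
Proof.
apply: lte_add_pinfty.
  pose M := \sum_i (`|C i| + \int[mu]_x `|p0 i x| + \int[mu]_x `|q0 i x| + \int[mu2]_q `|F i q|).
  apply: (@le_lt_trans _ _ M%:E); last exact: ltry.
  apply: ge_ereal_sup => _ [p _ <-]; rewrite lee_fin.
  apply: le_trans (colnorm_le_sum _) _; apply: ler_sum => i _.
  by rewrite mxE; exact: wave_bounded.
pose M := \sum_i ((\int[mu]_x `|p0 i x| + \int[mu2]_q `|F i q|) +
  (\int[mu]_x `|q0 i x| + \int[mu2]_q `|F i q|)).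
apply: (@le_lt_trans _ _ M%:E); last exact: ltry.
apply: ge_ereal_sup => _ [t tT <-].
have tT' : 0 <= t <= T by move: tT; rewrite (height_truncate tK T0 Tt K1) /= in_itv.
have mKt : measurable (xsection Kt t : set Rm).
  by rewrite (truncate_section tK)//; exact: measurable_section.
pose S x := \sum_i (`|transp 1 (p0 i) (F i) (t, x)| + `|transp (-1) (q0 i) (F i) (t, x)|).
have i1 i : intg mu (fun x => transp 1 (p0 i) (F i) (t, x)).
  by case: (intg_transp 1 t (ip0 i) (iF i)).
have i2 i : intg mu (fun x => transp (-1) (q0 i) (F i) (t, x)).
  by case: (intg_transp (-1) t (iq0 i) (iF i)).
have i12 i : intg mu (fun x => `|transp 1 (p0 i) (F i) (t, x)| + `|transp (-1) (q0 i) (F i) (t, x)|).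
  by apply: intgD; exact: intg_norm.
have iS : intg mu S by exact: intg_sum.
have S_ge x : `|ux (t, x)| + `|ut (t, x)| <= S x.
  have nP : `|right_col p0 F (t, x)| + `|left_col q0 F (t, x)| <= S x.
    rewrite /S big_split lerD//= ; apply: le_trans (colnorm_le_sum _) _;
    by apply: ler_sum => i _; rewrite mxE.
  apply: le_trans nP; rewrite /ut /ux /dt_col /dx_col !normrZ ger0_norm ?invr_ge0//.
  have := ler_normD (right_col p0 F (t, x)) (left_col q0 F (t, x)).
  have := ler_normB (right_col p0 F (t, x)) (left_col q0 F (t, x)).
  move: (`|_ + left_col _ _ _|) (`|_ - left_col _ _ _|) (`|right_col _ _ _|) (`|left_col _ _ _|).
  by move=> ????; lra.
have S0 x : 0 <= S x by apply: le_trans (S_ge x); rewrite addr_ge0.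
apply: (@le_trans _ _ (\int[mu]_x (S x)%:E)%E).
  apply: (@le_trans _ _ (\int[mu]_x (`|ux (t, x)| + `|ut (t, x)|)%:E)%E).
    apply: ge0_subset_integral => //.
    apply/measurable_EFinP/measurable_funD; apply: measurable_colnorm => i.
      exact: intg_measurable (slice_x t i).
    exact: intg_measurable (slice_t t i).
  apply: ge0_le_integral => //.
  - apply/measurable_EFinP/measurable_funD; apply: measurable_colnorm => i.
      exact: intg_measurable (slice_x t i).
    exact: intg_measurable (slice_t t i).
  - by apply/measurable_EFinP; exact: intg_measurable iS.
  - by move=> x _; rewrite lee_fin; exact: S_ge.
have := EFin_Rint iS => <-; rewrite lee_fin (Rint_sum _ i12); apply: ler_sum => i _.
rewrite (RintD (intg_norm (i1 i)) (intg_norm (i2 i))); apply: lerD.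
  by case: (intg_transp 1 t (ip0 i) (iF i)).
by case: (intg_transp (-1) t (iq0 i) (iF i)).
Qed.

Lemma fixpoint_Hspace : Hspace Kt u.
Proof.
have mI : measurable (Kt° : set (Rm * Rm)) by apply: open_measurable2; exact: open_interior.
have IT : Kt° `<=` [set p | 0 <= p.1 <= T].
  by move=> p Kp /=; rewrite (ltW (Kt_pos Kp)) (Kt_le Kp).
split=> //; exists ut, ux; split.
- by split.
- by split; [exact: (L1_dt ip0 iq0 iF mI IT)|exact: (L1_dx ip0 iq0 iF mI IT)].
- split; apply: (continuous_L1_slices tK T0 Tt K1).
  + exact: slice_t.
  + exact: slices_t.
  + exact: slice_x.
  + exact: slices_x.
- exact: Hnorm_finite.
Qed.

End solutions.

(** * Local existence and uniqueness *)

Theorem theorem5p12 (R : realType) (n : nat)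
  (Gamma : 'I_n -> 'I_n -> 'cV[R]_n -> 'cV[R]_n) (P : 'cV[R]_n -> 'M[R]_n)
  (Gamma_bounded : forall j k, [bounded Gamma j k w | w in [set: 'cV[R]_n]])
  (Gamma_lipschitz : forall j k, lipschitz (Gamma j k))
  (P_bounded : [bounded P w | w in [set: 'cV[R]_n]])
  (P_lipschitz : lipschitz P)
  (K : set (R * R)) (K_trapezoid : trapezoid K)
  (K_unbounded : ~ bounded_set K) (L : \bar R) (K_height : height K = L)
  (u0 v0 : R -> 'cV[R]_n) (data_L11 : L11 (xsection K 0) u0 v0)
  (f : R * R -> 'cV[R]_n) (f_L1 : L1 (lebesgue2 R) K f) :
  exists2 T0 : R, 0 < T0 /\ (T0%:E <= L)%E &
    exists u : R * R -> 'cV[R]_n,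
      (Hspace (truncate K T0) u /\
       mild_solution Gamma P (truncate K T0) u0 v0 f u) /\
      forall w : R * R -> 'cV[R]_n,
        Hspace (truncate K T0) w ->
        mild_solution Gamma P (truncate K T0) u0 v0 f w ->
        forall p, truncate K T0 p -> w p = u p.
Proof.
have [t1 t10 [x1 K1]] := trapezoid_high_point K_trapezoid.
have K0x : xsection K 0 x1.
  apply/mem_section; apply: (trapezoid_down K_trapezoid K1); rewrite ?subr0 ?addr0 ?(ltW t10)//.
    by rewrite gerBl ltW.
  by rewrite lerDl ltW.
have intK0 a b : xsection K 0 a -> xsection K 0 b -> `[a, b]%classic `<=` xsection K 0.
  move=> /mem_section Ka /mem_section Kb x /=; rewrite in_itv /= => abx.
  by apply/mem_section; exact: section_interval Ka Kb abx.
have [C [p0 [q0 [ip0 iq0 dalembert]]]] :=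
  mild_wave (measurable_section K_trapezoid 0) K0x intK0 data_L11.
have [h0 h00 fixpoint] := source_fixpoint Gamma_bounded Gamma_lipschitz P_bounded
  P_lipschitz C (intg_forcing K_trapezoid f_L1) ip0 iq0.
(* Strictly below [t1]: the sections up to time [T] are controlled through a higher
     point, and [T] is attained as a height. *)
pose T := Num.min h0 (t1 / 2).
have T0 : 0 < T by rewrite lt_min h00 divr_gt0.
have Tt : T < t1.
  by rewrite gt_min; apply/orP; right; rewrite ltr_pdivrMr// ltr_pMr// ltr1n.
have Th : T <= h0 by rewrite ge_min lexx.
have [F iF eF] := fixpoint T T0 Th.
exists T.
  split=> //; rewrite -K_height; apply: (@le_trans _ _ t1%:E); first by rewrite lee_fin ltW.
  exact: height_ge K1.
have mild_u := fixpoint_mild Gamma_lipschitz P_lipschitz K_trapezoid f_L1 ip0 iq0 dalembert iF eF.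
exists (wave_col C p0 q0 F); split.
  by split=> //; exact: (fixpoint_Hspace K_trapezoid T0 Tt K1 C ip0 iq0 iF).
move=> w _ mild_w; exact: (mild_solution_unique Gamma_bounded Gamma_lipschitz
  P_bounded P_lipschitz K_trapezoid f_L1 ip0 iq0 dalembert mild_w mild_u).
Qed.
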